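(* Assume that $(a,b,c,d,e,f,g)$ satisfies $$a+b+c+d=\tfrac13,\qquad d+e+f+g=\tfrac23 .$$ Consider the system for $(v,w,\zeta)$, $t>0$, $(x,y)\in\mathbb{R}^2$, $$\left\{\begin{aligned} &(1-b\varepsilon \partial_x^2)v_t+(1+a\varepsilon \partial_x^2)\zeta_x+\varepsilon(vv_x+\tfrac12ww_x)+\tfrac{\varepsilon^{3/2}}{2}wv_y=0,\\ &(1-e\varepsilon \partial_x^2)w_t+\varepsilon^{1/2}(1+f\varepsilon \partial_x^2)\zeta_y+\tfrac{\varepsilon}{2}vw_x+\varepsilon^{3/2}(ww_y+\tfrac12vv_y)=0,\\ &(1-d\varepsilon \partial_x^2)\zeta_t+(1+c\varepsilon \partial_x^2)v_x+\varepsilon^{1/2}(1+g\varepsilon\partial_x^2)w_y+\varepsilon(\zeta v)_x+\varepsilon^{3/2}(\zeta w)_y=0, \end{aligned}\right.\qquad(\mathrm{B})$$ and the system $$\left\{\begin{aligned} &(1-b\varepsilon \partial_x^2)v_t+(1+a\varepsilon\partial_x^2)\zeta_x+\varepsilon (vv_x+ \tfrac{1}{2} ww_x) + \tfrac{\varepsilon^{3/2}}{2} wv_y + \tfrac{\varepsilon}{2} \zeta\zeta_x=0,\\ &(1-e\varepsilon \partial_x^2)w_t+\varepsilon^{1/2}(1+f\varepsilon\partial_x^2)\zeta_y+\tfrac{\varepsilon }{2}vw_x + \varepsilon^{3/2} (ww_y+\tfrac{1}{2}vv_y+ \tfrac{1}{2}\zeta\zeta_y)=0,\\ &(1-d\varepsilon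 \partial_x^2)\zeta_t+(1+c\varepsilon\partial_x^2)v_x+\varepsilon^{1/2}(1+g\varepsilon\partial_x^2)w_y+\varepsilon v\zeta_x+\varepsilon^{3/2} w\zeta_y+ \tfrac{\varepsilon}{2} \zeta v_x + \tfrac{\varepsilon^{3/2}}{2}\zeta w_y=0. \end{aligned}\right.\qquad(\mathrm{B}')$$ Then the systems $(\mathrm{B})$ and $(\mathrm{B}')$ are consistent with precision $O(\varepsilon^2)$, in the following sense: for all sufficiently smooth solutions $(v,w,\zeta)\in C([0,T/\varepsilon];H^s_\varepsilon(\mathbb{R}^2))$ of $(\mathrm{B})$, the triplet $(v,w,\tilde\zeta)\in C([0,T/\varepsilon];H^N_\varepsilon(\mathbb{R}^2))$ with $\tilde\zeta=\zeta-\frac{\varepsilon}{4}|\zeta|^2$ solves $(\mathrm{B}')$ up to a residual $\varepsilon^2R$, where $R$ is bounded in $L^\infty([0,T/\varepsilon];H^N_\varepsilon(\mathbb{R}^2))$ $(N\ge2)$, uniformly with respect to $\varepsilon\in(0,1)$.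
   Context: $H^s_\varepsilon(\mathbb{R}^2)$ denotes $H^s(\mathbb{R}^2)$ equipped with the norm $\|f\|_{H^s_\varepsilon}^2=\varepsilon^{-1/2}\int_{\mathbb{R}^2}(|\xi_1|^2+\varepsilon|\xi_2|^2)^s|\hat f(\xi)|^2\,d\xi$. ''Solves $(\mathrm{B}')$ up to a residual $\varepsilon^2R$'' means that substituting $(v,w,\tilde\zeta)$ for $(v,w,\zeta)$ in the left-hand sides of $(\mathrm{B}')$ gives the vector $\varepsilon^2R$ instead of $0$. In the underlying convention, the $O(\varepsilon^2)$ precision encompasses linear and nonlinear terms in $(v,w,\zeta)$ and their derivatives with respect to $\partial_t$, $\partial_x$ and $\varepsilon^{1/2}\partial_y$. *)

(* Defs.v *)
From HB Require Import structures.
From mathcomp Require Import all_boot all_order all_algebra.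
From mathcomp Require Import all_classical all_reals all_analysis.
Set Implicit Arguments.
Unset Strict Implicit.
Unset Printing Implicit Defensive.
Import Order.TTheory GRing.Theory Num.Theory.
Import numFieldNormedType.Exports.
Local Open Scope classical_set_scope.
Local Open Scope ring_scope.

Notation plane R := (measurableTypeR R * measurableTypeR R)%type.
Notation mu2 R := (@lebesgue_measure R \x @lebesgue_measure R)%E.

Section Sobolev.
Context {R : realType}.
Implicit Types (f : plane R -> R) (eps s sigma : R).

Definition L2 f : Prop :=
  measurable_fun setT f /\ (\int[mu2 R]_x (f x ^+ 2)%:E < +oo)%E.

Definition box (n : nat) : set (plane R) :=
  `[- n%:R, n%:R]%classic `*` `[- n%:R, n%:R]%classic.

(* Complex numbers are represented by pairs (real part, imaginary part). *)
Definition sqmod (z : R * R) : R := z.1 ^+ 2 + z.2 ^+ 2.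

Definition truncated_fourier (n : nat) f (xi : plane R) : R * R :=
  (Rintegral (mu2 R) (box n) (fun x => f x * cos (x.1 * xi.1 + x.2 * xi.2)),
   - Rintegral (mu2 R) (box n) (fun x => f x * sin (x.1 * xi.1 + x.2 * xi.2))).

(* Fourier-Plancherel transform on L^2: the L^2 limit of the integrals of
   f(x) e^{-i x.xi} over [-n,n]^2. The normalisation constant is 1. *)
Definition is_fourier f (g : plane R -> R * R) : Prop :=
  [/\ L2 (fun xi => (g xi).1), L2 (fun xi => (g xi).2) &
   (\int[mu2 R]_xi (sqmod (truncated_fourier n f xi - g xi))%:E)%E
     @[n --> \oo] --> (0 : \bar R)%E].

(* Determined up to almost everywhere equality. *)
Definition fourier f : plane R -> R * R :=
  xget (fun=> 0) [set g | is_fourier f g].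

(* By Plancherel's theorem the second conjunct follows from the first. *)
Definition Hs s f : Prop :=
  [/\ L2 f, is_fourier f (fourier f) &
   (\int[mu2 R]_xi
      ((1 + xi.1 ^+ 2 + xi.2 ^+ 2) `^ s * sqmod (fourier f xi))%:E < +oo)%E].

Definition Hnorm2 eps s f : \bar R :=
  ((eps `^ (- 2^-1))%:E * \int[mu2 R]_xi
     ((xi.1 ^+ 2 + eps * xi.2 ^+ 2) `^ s * sqmod (fourier f xi))%:E)%E.

(* Hnorm2 is homogeneous in frequency and, for one fixed order, does not define
   the topology of H^s. Since H^s is contained in H^sigma for sigma <= s,
   bounds and limits in H^s_eps are taken for all the norms of H^sigma_eps with
   0 <= sigma <= s; the order sigma = s is the norm of H^s_eps itself. *)
Definition le_Hs eps s (M : R) f : Prop :=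
  forall sigma, 0 <= sigma <= s -> (Hnorm2 eps sigma f <= (M ^+ 2)%:E)%E.

Definition cvg0_Hs eps s {I : Type} (F : set_system I) (h : I -> plane R -> R) :
    Prop :=
  forall sigma, 0 <= sigma <= s ->
    Hnorm2 eps sigma (h i) @[i --> F] --> (0 : \bar R)%E.

(* u \in C(J; H^s_eps) *)
Definition C_Hs eps s (J : set R) (u : R -> plane R -> R) : Prop :=
  forall t0, J t0 ->
    Hs s (u t0) /\ cvg0_Hs eps s (within J (nbhs t0)) (fun t => u t \- u t0).

Definition simple_Hs s (u : R -> plane R -> R) : Prop :=
  [/\ finite_set (range u),
   forall h, measurable (u @^-1` [set h] : set (measurableTypeR R)) &
   forall t, Hs s (u t)].

(* u belongs to the ball of radius C of L^oo([0, T]; H^s_eps); the first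
   conjunct is strong (Bochner) measurability. *)
Definition Linfty_Hs eps s (T C : R) (u : R -> plane R -> R) : Prop :=
  (exists S : nat -> R -> plane R -> R,
     (forall n, simple_Hs s (S n)) /\
     {ae lebesgue_measure, forall t : measurableTypeR R, 0 <= t <= T ->
        cvg0_Hs eps s \oo (fun n => u t \- S n t)}) /\
  {ae lebesgue_measure, forall t : measurableTypeR R, 0 <= t <= T ->
     Hs s (u t) /\ le_Hs eps s C (u t)}.

End Sobolev.

Section Systems.
Context {R : realType}.
Implicit Types (h : plane R -> R) (p : plane R) (v w z u : R -> plane R -> R).

Definition dx h p : R := derive1 (fun x : R => h (x, p.2)) p.1.
Definition dy h p : R := derive1 (fun y : R => h (p.1, y)) p.2.
Definition dt u (t : R) p : R := derive1 (fun r : R => u r p) t.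

(* (1 + k \partial_x^2) h *)
Definition one_dxx (k : R) h p : R := h p + k * dx (dx h) p.

Definition B1 (a b eps : R) v w z (t : R) p : R :=
  one_dxx (- (b * eps)) (dt v t) p + one_dxx (a * eps) (dx (z t)) p
  + eps * (v t p * dx (v t) p + 2^-1 * (w t p * dx (w t) p))
  + eps `^ (3 / 2) / 2 * (w t p * dy (v t) p).

Definition B2 (e f eps : R) v w z (t : R) p : R :=
  one_dxx (- (e * eps)) (dt w t) p
  + eps `^ (1 / 2) * one_dxx (f * eps) (dy (z t)) p
  + eps / 2 * (v t p * dx (w t) p)
  + eps `^ (3 / 2) * (w t p * dy (w t) p + 2^-1 * (v t p * dy (v t) p)).

Definition B3 (c d g eps : R) v w z (t : R) p : R :=
  one_dxx (- (d * eps)) (dt z t) p + one_dxx (c * eps) (dx (v t)) p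
  + eps `^ (1 / 2) * one_dxx (g * eps) (dy (w t)) p
  + eps * dx (fun q => z t q * v t q) p
  + eps `^ (3 / 2) * dy (fun q => z t q * w t q) p.

Definition B1' (a b eps : R) v w z (t : R) p : R :=
  one_dxx (- (b * eps)) (dt v t) p + one_dxx (a * eps) (dx (z t)) p
  + eps * (v t p * dx (v t) p + 2^-1 * (w t p * dx (w t) p))
  + eps `^ (3 / 2) / 2 * (w t p * dy (v t) p)
  + eps / 2 * (z t p * dx (z t) p).

Definition B2' (e f eps : R) v w z (t : R) p : R :=
  one_dxx (- (e * eps)) (dt w t) p
  + eps `^ (1 / 2) * one_dxx (f * eps) (dy (z t)) p
  + eps / 2 * (v t p * dx (w t) p)
  + eps `^ (3 / 2) * (w t p * dy (w t) p + 2^-1 * (v t p * dy (v t) p)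
                      + 2^-1 * (z t p * dy (z t) p)).

Definition B3' (c d g eps : R) v w z (t : R) p : R :=
  one_dxx (- (d * eps)) (dt z t) p + one_dxx (c * eps) (dx (v t)) p
  + eps `^ (1 / 2) * one_dxx (g * eps) (dy (w t)) p
  + eps * (v t p * dx (z t) p) + eps `^ (3 / 2) * (w t p * dy (z t) p)
  + eps / 2 * (z t p * dx (v t) p)
  + eps `^ (3 / 2) / 2 * (z t p * dy (w t) p).

Definition solves_B (a b c d e f g eps T : R) v w z : Prop :=
  forall t p, 0 < t < T ->
    [/\ B1 a b eps v w z t p = 0, B2 e f eps v w z t p = 0
      & B3 c d g eps v w z t p = 0].

(* (v, w, z) turns the left-hand sides of the second system into
   eps ^+ 2 *: (r1, r2, r3). *)
Definition solves_B'_up_to (a b c d e f g eps T : R) v w z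
    (r1 r2 r3 : R -> plane R -> R) : Prop :=
  forall t p, 0 < t < T ->
    [/\ B1' a b eps v w z t p = eps ^+ 2 * r1 t p,
        B2' e f eps v w z t p = eps ^+ 2 * r2 t p
      & B3' c d g eps v w z t p = eps ^+ 2 * r3 t p].

(* u \in C([0, T]; H^s_eps) with \partial_t u \in C(]0, T[; H^(s-3)_eps), 3 being
   the order in space of the systems. Classes of functions are represented by
   their continuous member (s > 1), so that, for s large, the pointwise
   derivatives dx, dy of u t and dt u t are genuine. *)
Definition smooth_curve (eps s T : R) u : Prop :=
  [/\ C_Hs eps s [set t | 0 <= t <= T] u,
      forall t, 0 <= t <= T -> continuous (u t),
      forall t p, 0 < t < T -> derivable (fun r : R => u r p) t 1,
      C_Hs eps (s - 3) [set t | 0 < t < T] (dt u)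
    & forall t, 0 < t < T -> continuous (dt u t)].

(* For d >= 0 the third equation provides a bound on \partial_t z uniform in eps,
   since 1 - d eps \partial_x^2 has symbol 1 + d eps xi_1^2 >= 1. For d < 0 this
   symbol vanishes somewhere and gives no control, so the bound on \partial_t z
   is then part of the uniform smoothness of the solutions. *)
Definition bounded_solution (d eps s T M : R) v w z : Prop :=
  (forall t, 0 <= t <= T ->
     [/\ le_Hs eps s M (v t), le_Hs eps s M (w t) & le_Hs eps s M (z t)]) /\
  (d < 0 -> forall t, 0 < t < T -> le_Hs eps (s - 3) M (dt z t)).

Definition modified_height (eps : R) z : R -> plane R -> R :=
  fun t p => z t p - eps / 4 * `|z t p| ^+ 2.

End Systems.

(* Main.v *)
From HB Require Import structures.
From mathcomp Require Import all_boot all_order all_algebra.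
From mathcomp Require Import all_classical all_reals all_analysis.
From mathcomp Require Import measurable_realfun zify ring lra.
Require Import Defs.
Set Implicit Arguments.
Unset Strict Implicit.
Unset Printing Implicit Defensive.
Import Order.TTheory GRing.Theory Num.Theory.
Import numFieldNormedType.Exports.
Local Open Scope classical_set_scope.
Local Open Scope ring_scope.

(** Why the statement holds.

    Put [s = sqrt eps] and let [X = \partial_x], [Y = s \partial_y] be the two
    derivations counted by the norms of [H^s_eps]. The system and its
    modification are then polynomial in [v], [w], [zeta], their [X] and [Y]
    derivatives and [\partial_t], with coefficients polynomial in [eps] alone.
    Substituting [zeta - eps / 4 * zeta ^+ 2] in the modified system, the terms of
    order [eps] cancel: in the first two equations because
    [- eps / 4 * X (zeta ^+ 2) + eps / 2 * zeta * X zeta = 0], in the third one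
    because what is left is [- eps / 2 * zeta] times
    [\partial_t zeta + X v + Y w], which the third equation of the original
    system shows to be [eps] times a combination of higher derivatives and of
    products. The residuals [residual1], [residual2] and [residual3] are thus
    explicit, and each of their terms is a product of at least two functions, or
    a derivative of such a product ([B1'_modified_height],
    [B2'_modified_height], [B3'_modified_height]).

    The norms remain to be bounded uniformly in [eps]. The class [smooth s k B]
    consists of the functions whose [X], [Y] derivatives up to order [k] are at
    most [B] in absolute value and at most [B * sqrt s] in [L^2]; it is stable
    under sums, products and derivations with constants that do not depend on
    [s]. It is compared with the Sobolev norms in both directions.

    - A continuous function with [k + 2] orders of Sobolev regularity is smooth
      of order [k] ([Hs_smooth]). Fourier inversion for continuous functions
      ([fourier_inversion]) represents it by its transform, and Cauchy-Schwarz
      against [weight ^- 1], whose square has integral at most [pi ^+ 2 / s],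
      compensates exactly the factor [eps^(-1/2)] of the norm.
    - A smooth function with integrable derivatives has bounded Sobolev norms
      ([smooth_Hs], [smooth_Hnorm2]): its transform is an absolutely convergent
      integral, derivations become multiplications by integration by parts, and
      Plancherel's inequality applies. Products of two smooth functions have
      integrable derivatives, which is all that the residuals require.

    Only the inequality in Plancherel's theorem is used ([plancherel_le]); it and
    the inversion formula come from Abel summation with the weight
    [exp (- D (|xi_1| + |xi_2|))], which amounts to convolution with the Poisson kernel.

    For [d < 0] the bound on [\partial_t zeta] is a hypothesis. For [d >= 0] the
    third equation gives a uniform bound of
    [(1 - d eps X^2) \partial_t zeta], and the inverse of [1 - d eps X^2] does
    not increase the bounds defining [smooth] ([resolvent_smooth]).

    Finally the residuals are continuous in time with values in the classes
    above, so that they are strongly measurable: step functions on a grid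
    approximate them at every time ([Linfty_Hs_extend0]). *)

(** * Integrable and square-integrable functions *)
Section fubini.
Context {R : realType} d1 d2 (T1 : measurableType d1) (T2 : measurableType d2).
Variables (m1 : {sigma_finite_measure set T1 -> \bar R})
          (m2 : {sigma_finite_measure set T2 -> \bar R}).

Lemma integrableP_EFin d (T : measurableType d) (m : {measure set T -> \bar R})
    (f : T -> R) :
  measurable_fun setT f -> (\int[m]_x `|f x|%:E < +oo)%E ->
  m.-integrable setT (EFin \o f).
Proof. by move=> mf h; apply/integrableP; split => //; apply/measurable_EFinP. Qed.

Lemma Rintegral12 (f : T1 * T2 -> R) : (m1 \x m2)%E.-integrable setT (EFin \o f) ->
  Rintegral m1 setT (fun x => Rintegral m2 setT (fun y => f (x, y)))
  = Rintegral (m1 \x m2)%E setT f.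
Proof.
move=> fi; rewrite /Rintegral; congr fine.
rewrite -(integral12_prod_meas1 fi); apply: ae_eq_integral => //.
- apply/measurable_EFinP; apply: measurableT_comp => //.
  exact: (measurable_fubini_F fi).
- exact: (measurable_fubini_F fi).
- by have := ae_integrable1 fi; apply: filterS => x ix _; rewrite fineK ?integrable_fin_num.
Qed.

Lemma Rintegral21 (f : T1 * T2 -> R) : (m1 \x m2)%E.-integrable setT (EFin \o f) ->
  Rintegral m2 setT (fun y => Rintegral m1 setT (fun x => f (x, y)))
  = Rintegral (m1 \x m2)%E setT f.
Proof.
move=> fi; rewrite /Rintegral; congr fine.
rewrite -(integral21_prod_meas1 fi); apply: ae_eq_integral => //.
- apply/measurable_EFinP; apply: measurableT_comp => //.
  exact: (measurable_fubini_G fi).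
- exact: (measurable_fubini_G fi).
- by have := ae_integrable2 fi; apply: filterS => y iy _; rewrite fineK ?integrable_fin_num.
Qed.

(** A kernel bounded by a product of two integrable functions is integrable on
    the product space, so that the order of integration may be exchanged. *)
Lemma integrable_prod_dominated (f : T1 * T2 -> R) (g : T1 -> R) (h : T2 -> R) :
  measurable_fun setT f ->
  m1.-integrable setT (EFin \o g) -> m2.-integrable setT (EFin \o h) ->
  (forall x y, `|f (x, y)| <= `|g x| * `|h y|) ->
  (m1 \x m2)%E.-integrable setT (EFin \o f).
Proof.
move=> mf ig ih le_f.
have /integrableP[/measurable_EFinP mg gf] := ig.
have /integrableP[/measurable_EFinP mh hf] := ih.
apply/(integrable12ltyP m1 m2) => /=.
  exact/measurable_EFinP.
apply: (@le_lt_trans _ _ (\int[m1]_x (`|g x|%:E * \int[m2]_y `|h y|%:E))%E).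
  apply: ge0_le_integral => //=.
  - by move=> x _; exact: integral_ge0.
  - apply: (measurable_fun_fubini_tonelli_F (fun p : T1 * T2 => `|(f p)%:E|%E)) => //.
    by apply: measurableT_comp => //; exact/measurable_EFinP.
  - by apply: emeasurable_funM => //; apply/measurable_EFinP; exact: measurableT_comp.
  - move=> x _; rewrite -ge0_integralZl//; last 1 first.
    + by apply/measurable_EFinP; exact: measurableT_comp.
    apply: ge0_le_integral => //=.
    + apply/measurable_EFinP; apply: measurableT_comp => //.
      exact: measurableT_comp mf _.
    + apply/measurable_EFinP; apply: measurable_funM => //.
      exact: measurableT_comp.
    + by move=> y _; rewrite -?EFinM lee_fin.
rewrite ge0_integralZr//=.
- apply: lte_mul_pinfty => //; first exact: integral_ge0.
  by rewrite ge0_fin_numE//; exact: integral_ge0.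
- by apply/measurable_EFinP; exact: measurableT_comp.
- exact: integral_ge0.
Qed.

End fubini.

Section square_integrable.
Context {R : realType} d (T : measurableType d) (m : {measure set T -> \bar R}).
Implicit Types f g : T -> R.

Definition L1 f := m.-integrable setT (EFin \o f).

Definition square_integrable f :=
  measurable_fun setT f /\ (\int[m]_x (f x ^+ 2)%:E < +oo)%E.

Lemma L1_measurable f : L1 f -> measurable_fun setT f.
Proof. by move/integrableP => -[/measurable_EFinP]. Qed.

Lemma le_L1 f g : measurable_fun setT f -> (forall x, `|f x| <= g x) -> L1 g -> L1 f.
Proof.
move=> mf fg ig; apply: le_integrable ig => //; first exact/measurable_EFinP.
by move=> x _ /=; rewrite lee_fin (le_trans (fg x))// ler_norm.
Qed.

Lemma L1_norm f : L1 f -> L1 (fun x => `|f x|).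
Proof. exact: integrable_norm. Qed.

Lemma L1D f g : L1 f -> L1 g -> L1 (fun x => f x + g x).
Proof. by move=> hf hg; have := integrableD measurableT hf hg. Qed.

Lemma L1B f g : L1 f -> L1 g -> L1 (fun x => f x - g x).
Proof. by move=> hf hg; have := integrableB measurableT hf hg. Qed.

Lemma L1Z (c : R) f : L1 f -> L1 (fun x => c * f x).
Proof. by move=> hf; have := integrableZl measurableT c hf. Qed.

Lemma L1_ge0 f : measurable_fun setT f -> (forall x, 0 <= f x) ->
  (\int[m]_x (f x)%:E < +oo)%E -> L1 f.
Proof.
move=> mf f0 foo; apply: integrableP_EFin => //.
by under eq_integral do rewrite ger0_norm//.
Qed.

Lemma L1_EFin f : L1 f -> (\int[m]_x (f x)%:E)%E = (\int[m]_x f x)%:E.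
Proof. by move=> hf; rewrite fineK// integrable_fin_num. Qed.

Lemma RintZ (c : R) f : L1 f -> \int[m]_x (c * f x) = c * \int[m]_x f x.
Proof. by move=> hf; rewrite RintegralZl. Qed.

Lemma RintD f g : L1 f -> L1 g -> \int[m]_x (f x + g x) = \int[m]_x f x + \int[m]_x g x.
Proof. by move=> hf hg; rewrite RintegralD. Qed.

Lemma RintB f g : L1 f -> L1 g -> \int[m]_x (f x - g x) = \int[m]_x f x - \int[m]_x g x.
Proof. by move=> hf hg; rewrite RintegralB. Qed.

Lemma L1_mul_bounded f g (c : R) : measurable_fun setT g ->
  (forall x, `|g x| <= c) -> L1 f -> L1 (fun x => f x * g x).
Proof.
move=> mg gc hf; apply: (@le_L1 _ (fun x => c * `|f x|)).
- by apply: measurable_funM => //; exact: L1_measurable.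
- by move=> x; rewrite normrM mulrC ler_wpM2r.
- by apply: L1Z; exact: L1_norm.
Qed.

Lemma measurable_sqr f : measurable_fun setT f -> measurable_fun setT (fun x => f x ^+ 2).
Proof. by move=> mf; exact: (measurable_funX 2 mf). Qed.

Lemma square_integrableP f :
  square_integrable f <-> measurable_fun setT f /\ L1 (fun x => f x ^+ 2).
Proof.
split=> -[mf h]; split => //.
- by apply: L1_ge0 => //; [exact: measurable_sqr|move=> x; exact: sqr_ge0].
- exact: integrable_lty.
Qed.

Lemma square_integrable_mul f g :
  square_integrable f -> square_integrable g -> L1 (fun x => f x * g x).
Proof.
move=> /square_integrableP[mf if2] /square_integrableP[mg ig2].
apply: (@le_L1 _ (fun x => f x ^+ 2 + g x ^+ 2)); last exact: L1D.
  exact: measurable_funM.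
move=> x; rewrite ler_norml; apply/andP; split.
  have := sqr_ge0 (f x + g x); nra.
have := sqr_ge0 (f x - g x); nra.
Qed.

Lemma square_integrableD f g :
  square_integrable f -> square_integrable g -> square_integrable (fun x => f x + g x).
Proof.
move=> hf hg; have hfg := square_integrable_mul hf hg.
move: hf hg => /square_integrableP[mf if2] /square_integrableP[mg ig2].
apply/square_integrableP; split; first exact: measurable_funD.
apply: (@le_L1 _ (fun x => (f x ^+ 2 + g x ^+ 2) + 2 * (f x * g x))).
- by apply: measurable_sqr; exact: measurable_funD.
- by move=> x; rewrite ger0_norm ?sqr_ge0// le_eqVlt; apply/orP; left; apply/eqP; ring.
- by apply: L1D; [exact: L1D|exact: L1Z].
Qed.

Lemma square_integrableZ (c : R) f :
  square_integrable f -> square_integrable (fun x => c * f x).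
Proof.
move=> /square_integrableP[mf if2]; apply/square_integrableP; split.
  exact: measurable_funM.
apply: (@le_L1 _ (fun x => c ^+ 2 * f x ^+ 2)).
- by apply: measurable_sqr; exact: measurable_funM.
- by move=> x; rewrite ger0_norm ?sqr_ge0// exprMn.
- exact: L1Z.
Qed.

Lemma le_square_integrable f g : measurable_fun setT f ->
  (forall x, `|f x| <= `|g x|) -> square_integrable g -> square_integrable f.
Proof.
move=> mf fg /square_integrableP[mg ig2]; apply/square_integrableP; split => //.
apply: le_L1 ig2; first exact: measurable_sqr.
by move=> x; rewrite ger0_norm ?sqr_ge0// -[leLHS]real_normK ?num_real//
  -[leRHS]real_normK ?num_real// lerXn2r ?nnegrE.
Qed.

Lemma le_Rint f g : L1 f -> L1 g -> (forall x, f x <= g x) ->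
  \int[m]_x f x <= \int[m]_x g x.
Proof. by move=> hf hg fg; apply: le_Rintegral => // x _; exact: fg. Qed.

Lemma cauchy_schwarz f g : square_integrable f -> square_integrable g ->
  (\int[m]_x `|f x * g x|) ^+ 2 <= (\int[m]_x (f x ^+ 2)) * (\int[m]_x (g x ^+ 2)).
Proof.
move=> hf hg; have hfg := L1_norm (square_integrable_mul hf hg).
move: hf hg => /square_integrableP[mf if2] /square_integrableP[mg ig2].
set A := \int[m]_x (f x ^+ 2); set B := \int[m]_x (g x ^+ 2).
set J := \int[m]_x `|f x * g x|.
have A0 : 0 <= A by apply: Rintegral_ge0 => x _; exact: sqr_ge0.
have B0 : 0 <= B by apply: Rintegral_ge0 => x _; exact: sqr_ge0.
(* From [0 <= (t |f| - |g|)^2]; the choice of [t] then gives the claim. *)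
have quad (t : R) : 2 * t * J <= t ^+ 2 * A + B.
  rewrite /A /B /J -RintegralZl// -RintegralZl// -RintegralD//; last first.
    exact: L1Z.
  apply: le_Rint; [exact: L1Z|by apply: L1D => //; exact: L1Z|].
  move=> x; rewrite normrM -(real_normK (num_real (f x))) -(real_normK (num_real (g x))).
  have := sqr_ge0 (t * `|f x| - `|g x|); nra.
have J0 : 0 <= J by apply: Rintegral_ge0 => x _.
have [A_eq0|Ane0] := eqVneq A 0.
  have [->|Jne0] := eqVneq J 0; first by rewrite expr0n/= mulr_ge0.
  have Jgt0 : 0 < J by rewrite lt_neqAle eq_sym Jne0.
  (* Any [t] with [2 * t * J] larger than [B] contradicts [quad]. *)
  have := quad ((B + 1) / J); rewrite A_eq0 mulr0 add0r.
  rewrite -mulrA divfK//; nra.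
have Agt0 : 0 < A by rewrite lt_neqAle eq_sym Ane0.
have := quad (J / A); rewrite expr_div_n -mulrA => h.
have {}h : J ^+ 2 / A <= B.
  have e : 2 * (J / A * J) = J ^+ 2 / A + J ^+ 2 / A by rewrite expr2; field.
  have e' : J ^+ 2 / A ^+ 2 * A = J ^+ 2 / A by field.
  by move: h; rewrite e' e; lra.
by rewrite -ler_pdivrMl// mulrC.
Qed.

End square_integrable.

(** * Lebesgue measure on the plane *)
Section plane.
Context {R : realType}.

Lemma boxE n (p : plane R) : box n p <-> `|p.1| <= n%:R /\ `|p.2| <= n%:R.
Proof. by rewrite /box /= !in_itv/= -!ler_norml. Qed.

Lemma near_box (p : plane R) : \forall n \near \oo, box n p.
Proof.
near=> n; apply/boxE; split.
- by near: n; exact: nbhs_infty_ger.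
- by near: n; exact: nbhs_infty_ger.
Unshelve. all: by end_near. Qed.

Lemma measurable_box n : measurable (@box R n).
Proof. by apply: measurableX; exact: measurable_itv. Qed.

Lemma box_finite n : (mu2 R (box n) < +oo)%E.
Proof.
have itv_lty : (lebesgue_measure ([set` `[- n%:R, n%:R]%R] : set R) < +oo)%E.
  by rewrite lebesgue_measure_itv/=; case: ifP => _; rewrite -?EFinB ltry.
rewrite /box product_measure1E; [|exact: measurable_itv..].
by rewrite lte_mul_pinfty// ge0_fin_numE.
Qed.

(** The canonical sigma-finite structure on products of measures is found only
    on a constant of its own; it is convertible with the Lebesgue measure of
    the plane. *)
Definition leb2 : set (plane R) -> \bar R := mu2 R.
HB.instance Definition _ := Measure.on leb2.

Lemma leb2_sigma_finite : sigma_finite setT leb2.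
Proof.
exists (@box R).
  rewrite predeqE => p; split => // _; have [n _ h] := near_box p.
  by exists n => //; apply: h => /=.
by move=> n; split; [exact: measurable_box|exact: box_finite].
Qed.

HB.instance Definition _ := @Measure_isSigmaFinite.Build _ _ _ leb2 leb2_sigma_finite.

Let plane_measure : {sigma_finite_measure set (plane R) -> \bar R} := leb2.

Lemma Rintegral_plane_swap (f : plane R * plane R -> R) (g h : plane R -> R) :
  measurable_fun setT f -> L1 (mu2 R) g -> L1 (mu2 R) h ->
  (forall x y, `|f (x, y)| <= `|g x| * `|h y|) ->
  \int[mu2 R]_x (\int[mu2 R]_y f (x, y)) = \int[mu2 R]_y (\int[mu2 R]_x f (x, y)).
Proof.
move=> mf ig ih le_f.
have fi := @integrable_prod_dominated R _ _ _ _ plane_measure plane_measure f g h mf ig ih le_f.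
exact: etrans (Rintegral12 fi) (esym (Rintegral21 fi)).
Qed.

Lemma measurable_Rintegral_plane (f : plane R * plane R -> R) (g h : plane R -> R) :
  measurable_fun setT f -> L1 (mu2 R) g -> L1 (mu2 R) h ->
  (forall x y, `|f (x, y)| <= `|g x| * `|h y|) ->
  measurable_fun setT (fun x => \int[mu2 R]_y f (x, y)).
Proof.
move=> mf ig ih le_f.
have fi := @integrable_prod_dominated R _ _ _ _ plane_measure plane_measure f g h mf ig ih le_f.
apply: measurableT_comp; first exact: fine_measurable.
exact: (measurable_fubini_F fi).
Qed.

Lemma integral_plane_swap (f : plane R * plane R -> R) :
  measurable_fun setT f -> (forall p, 0 <= f p) ->
  (\int[mu2 R]_x \int[mu2 R]_y (f (x, y))%:E =
   \int[mu2 R]_y \int[mu2 R]_x (f (x, y))%:E)%E.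
Proof.
move=> mf f0; apply: (@fubini_tonelli _ _ _ _ R plane_measure plane_measure (EFin \o f)) => //.
exact/measurable_EFinP.
Qed.

Lemma measurable_integral_plane (f : plane R * plane R -> R) :
  measurable_fun setT f -> (forall p, 0 <= f p) ->
  measurable_fun setT (fun x => \int[mu2 R]_y (f (x, y))%:E)%E.
Proof.
move=> mf f0.
apply: (@measurable_fun_fubini_tonelli_F _ _ _ _ R plane_measure (EFin \o f)) => //.
exact/measurable_EFinP.
Qed.

End plane.

(** * Limits of integrals and integrals over the line *)
Section dominated.
Context {R : realType} d (T : measurableType d) (m : {measure set T -> \bar R}).

Lemma L1_limit (u : nat -> T -> R) (f g : T -> R) :
  (forall n, measurable_fun setT (u n)) -> (forall x, u n x @[n --> \oo] --> f x) ->
  L1 m g -> (forall n x, `|u n x| <= g x) -> L1 m f.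
Proof.
move=> mu uf ig le_u; apply: (@le_L1 _ _ _ _ _ g) => //.
  by apply: measurable_fun_cvg => [n|x _]; [exact: mu|exact: uf].
by move=> x; apply: (cvgr_to_le (cvg_norm (uf x))); apply: nearW => n.
Qed.

Lemma cvg_Rint (u : nat -> T -> R) (f g : T -> R) :
  (forall n, measurable_fun setT (u n)) -> (forall x, u n x @[n --> \oo] --> f x) ->
  L1 m g -> (forall n x, `|u n x| <= g x) ->
  \int[m]_x u n x @[n --> \oo] --> \int[m]_x f x.
Proof.
move=> mu uf ig le_u; have hf := L1_limit mu uf ig le_u.
apply: fine_cvg; rewrite -L1_EFin//.
apply: (@dominated_cvg _ _ _ m _ measurableT (fun n x => (u n x)%:E) (EFin \o f) (EFin \o g)) => //.
- by move=> n; exact/measurable_EFinP.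
- by move=> x _; apply: cvg_EFin; [exact: nearW|exact: uf].
- by move=> n x _; rewrite lee_fin.
Qed.

End dominated.

Lemma Rintegral_measure_preserving {R : realType} d (T : measurableType d)
    (m : {measure set T -> \bar R}) (phi : T -> T) (f : T -> R) :
  measurable_fun setT phi -> (forall A, measurable A -> pushforward m phi A = m A) ->
  L1 m f -> \int[m]_x f (phi x) = \int[m]_x f x.
Proof.
move=> mphi phiE hf; congr fine.
have pushE (g : T -> \bar R) : (\int[pushforward m phi]_x g x = \int[m]_x g x)%E.
  by apply: eq_measure_integral => A mA _; exact: phiE.
have mf := L1_measurable hf.
have hN : L1 m (f \o phi).
  apply/integrableP; split; first by apply/measurable_EFinP; exact: measurableT_comp.
  have /integrableP[_] := hf; apply: le_lt_trans.
  rewrite -[leRHS]pushE (ge0_integral_pushforward mphi)//.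
  have maf : measurable_fun setT (abse \o (EFin \o f)).
    by apply: measurableT_comp => //; exact/measurable_EFinP.
  exact: maf.
rewrite -[RHS]pushE (integral_pushforward mphi)//.
exact/measurable_EFinP.
Qed.

Section FTC_line.
Context {R : realType}.
Local Notation mu := (@lebesgue_measure R).

Definition symitv (n : nat) : set R := `[- n%:R, n%:R]%classic.

Lemma symitvE n x : symitv n x <-> `|x| <= n%:R.
Proof. by rewrite /symitv /= in_itv/= -ler_norml. Qed.

Lemma measurable_symitv n : measurable (symitv n).
Proof. exact: measurable_itv. Qed.

Lemma near_symitv x : \forall n \near \oo, symitv n x.
Proof. by near=> n; apply/symitvE; near: n; exact: nbhs_infty_ger.
Unshelve. all: by end_near. Qed.

Lemma integral_symitv_FTC (f F : R -> R) (n : nat) : continuous f ->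
  (forall x, is_derive x (1:R) F (f x)) ->
  (\int[mu]_(x in symitv n) (f x)%:E = (F n%:R - F (- n%:R))%:E)%E.
Proof.
move=> cf dF; rewrite /symitv; case: n => [|n].
  by rewrite mulr0n oppr0 subrr set_itv1 integral_set1.
have cF x : {for x, continuous F}.
  by apply: differentiable_continuous; apply/derivable1_diffP; have := dF x.
rewrite (@continuous_FTC2 _ f F)//.
- by rewrite ltrNl (lt_trans _ (ltr0Sn _ n))// oppr_lt0.
- exact: continuous_subspaceT.
- split; first by move=> x _; have := dF x.
  + by apply: cvg_at_right_filter; exact: cF.
  + by apply: cvg_at_left_filter; exact: cF.
- by move=> x _; rewrite derive1E; exact: derive_val.
Qed.

Lemma integral_line_ge0_FTC (f F : R -> R) (a b : R) : continuous f ->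
  (forall x, 0 <= f x) -> (forall x, is_derive x (1:R) F (f x)) ->
  F n%:R @[n --> \oo] --> b -> F (- n%:R) @[n --> \oo] --> a ->
  (\int[mu]_x (f x)%:E = (b - a)%:E)%E.
Proof.
move=> cf f0 dF Fb Fa.
have mf := continuous_measurable_fun cf.
have h : (\int[mu]_(x in symitv n) (f x)%:E @[n --> \oo] --> \int[mu]_x (f x)%:E)%E.
  have eT : [set: R] = \bigcup_n symitv n.
    apply/esym; rewrite predeqE => x; split => // _.
    by have [n _ hn] := near_symitv x; exists n => //; apply: hn => /=.
  rewrite [in X in _ --> X]eT; apply: ge0_nondecreasing_set_cvg_integral.
  - move=> n k nk; apply/subsetPset => x /symitvE xn; apply/symitvE.
    by rewrite (le_trans xn)// ler_nat.
  - by move=> n; exact: measurable_symitv.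
  - by move=> n; apply/measurable_EFinP; exact: measurable_funTS.
  - by move=> n x _; rewrite lee_fin.
apply: (cvg_unique _ h) => //.
have e : (fun n => (\int[mu]_(x in symitv n) (f x)%:E)%E) = (fun n => (F n%:R - F (- n%:R))%:E).
  by apply/funext => n; exact: integral_symitv_FTC.
rewrite /= e.
by apply: cvg_EFin; [exact: nearW|exact: cvgB].
Qed.

Lemma Rintegral_line_FTC (f F : R -> R) (a b : R) : continuous f -> L1 mu f ->
  (forall x, is_derive x (1:R) F (f x)) ->
  F n%:R @[n --> \oo] --> b -> F (- n%:R) @[n --> \oo] --> a ->
  \int[mu]_x f x = b - a.
Proof.
move=> cf hf dF Fb Fa.
have mf := L1_measurable hf.
pose u n x := f x * \1_(symitv n) x.
have h : \int[mu]_x u n x @[n --> \oo] --> \int[mu]_x f x.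
  apply: (@cvg_Rint _ _ _ mu u f (fun x => `|f x|)).
  - by move=> n; apply: measurable_funM => //; apply: measurable_indic; exact: measurable_symitv.
  - move=> x; apply: cvg_near_cst.
    near=> n; rewrite /u indicE mem_set ?mulr1//.
    by near: n; exact: near_symitv.
  - exact: L1_norm.
  - move=> n x; rewrite /u normrM indicE; case: (_ \in _); rewrite ?normr1 ?mulr1//.
    by rewrite normr0 mulr0.
apply: (cvg_unique _ h) => //.
rewrite (_ : (fun _ => _) = (fun n => F n%:R - F (- n%:R))); first exact: cvgB.
apply/funext => n.
have e := congr1 fine (integral_symitv_FTC n cf dF); rewrite /= in e; rewrite -e; congr fine.
rewrite [RHS]integral_mkcond; apply: eq_integral => x _.
rewrite /u patchE indicE; case: ifP => _; by rewrite ?mulr1 ?mulr0.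
Unshelve. all: by end_near. Qed.

Lemma integralNx (f : R -> R) : L1 mu f -> \int[mu]_x f (- x) = \int[mu]_x f x.
Proof.
apply: (@Rintegral_measure_preserving _ _ (measurableTypeR R) mu -%R).
  exact: (@oppr_measurable R setT).
by move=> A mA; exact: lebesgue_measureN.
Qed.

Lemma integral_odd (f : R -> R) : L1 mu f -> (forall x, f (- x) = - f x) ->
  \int[mu]_x f x = 0.
Proof.
move=> hf oddf; have := integralNx hf.
rewrite (_ : (fun x => f (- x)) = (fun x => (-1) * f x)); last first.
  by apply/funext => x; rewrite oddf mulN1r.
by rewrite RintegralZl//; lra.
Qed.

End FTC_line.

(** * The Poisson kernel of the line *)
Section poisson.
Context {R : realType}.
Local Notation mu := (@lebesgue_measure R).
Variable D : R.
Hypothesis D_gt0 : 0 < D.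

Definition decay (x : R) : R := expR (- (D * `|x|)).
Definition poisson (u : R) : R := 2 * D / (D ^+ 2 + u ^+ 2).

Lemma decay_gt0 x : 0 < decay x. Proof. exact: expR_gt0. Qed.

Lemma decay_le1 x : decay x <= 1.
Proof. by rewrite -expR0 ler_expR oppr_le0 mulr_ge0// ltW. Qed.

Lemma continuous_decay : continuous decay.
Proof.
move=> x; apply: continuous_comp; last exact: continuous_expR.
by apply: cvgN; apply: cvgM; [exact: cvg_cst|apply: norm_continuous].
Qed.

Lemma D2u2_gt0 (u : R) : 0 < D ^+ 2 + u ^+ 2.
Proof. by rewrite ltr_wpDr ?sqr_ge0// exprn_gt0. Qed.

Lemma poisson_ge0 u : 0 <= poisson u.
Proof. by rewrite /poisson divr_ge0 ?(ltW (D2u2_gt0 _))// mulr_ge0// ltW. Qed.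

Lemma poisson_le u : poisson u <= 2 / D.
Proof.
rewrite /poisson ler_pdivrMr ?D2u2_gt0// mulrAC ler_pdivlMr//.
by rewrite -mulrA ler_wpM2l// -expr2 lerDl sqr_ge0.
Qed.

(** On the half line. The summand [1] makes the integrand below nonnegative, as
    the fundamental theorem of calculus on an unbounded interval requires. *)
Let primitive (u x : R) : R :=
  expR (- (D * x)) * (- D^-1 + (u * sin (u * x) - D * cos (u * x)) / (D ^+ 2 + u ^+ 2)).

Lemma is_derive_primitive (u x : R) :
  is_derive x (1:R) (primitive u) (expR (- (D * x)) * (1 + cos (u * x))).
Proof.
have Dne0 : D != 0 by rewrite gt_eqF.
have dne0 : D ^+ 2 + u ^+ 2 != 0 by rewrite gt_eqF// D2u2_gt0.
have d1 : is_derive x (1:R) (fun y : R => expR (- (D * y))) (expR (- (D * x)) * (- D)).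
  apply: is_derive_eq; rewrite ?scaler0 ?addr0 /GRing.scale/=; ring.
have ds : is_derive x (1:R) (fun y : R => sin (u * y)) (cos (u * x) * u).
  by apply: (@is_derive1_comp _ sin (fun y => u * y)); apply: is_derive_eq; rewrite /GRing.scale/=; ring.
have dc : is_derive x (1:R) (fun y : R => cos (u * y)) (- sin (u * x) * u).
  by apply: (@is_derive1_comp _ cos (fun y => u * y)); apply: is_derive_eq; rewrite /GRing.scale/=; ring.
rewrite /primitive; apply: is_derive_eq.
rewrite /GRing.scale/=; field.
by rewrite dne0 Dne0.
Qed.

Lemma half_line (u : R) :
  (\int[mu]_(x in [set x | (0 <= x)%R]) (decay x * (1 + cos (u * x)))%:E
   = (D^-1 + D / (D ^+ 2 + u ^+ 2))%:E)%E.
Proof.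
rewrite -set_itvcy.
transitivity (\int[mu]_(x in `[0%R, +oo[) (expR (- (D * x)) * (1 + cos (u * x)))%:E)%E.
  apply: eq_integral.
  by move=> x; rewrite inE/= in_itv/= andbT => x0; rewrite /decay ger0_norm.
rewrite (@ge0_continuous_FTC2y _ (fun x => expR (- (D * x)) * (1 + cos (u * x))) (primitive u) 0 0).
- rewrite /primitive !mulr0 oppr0 expR0 sin0 cos0 mulr0 mul1r mulr1 -EFinB; congr EFin.
  by field; rewrite !gt_eqF// D2u2_gt0.
- move=> x _; rewrite mulr_ge0 ?expR_ge0//; have := cos_geN1 (u * x); lra.
- apply: continuous_subspaceT => x; apply: cvgM.
    apply: continuous_comp; last exact: continuous_expR.
    by apply: cvgN; apply: cvgM; [exact: cvg_cst|exact: cvg_id].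
  apply: cvgD; first exact: cvg_cst.
  apply: continuous_comp; last exact: continuous_cos.
  by apply: cvgM; [exact: cvg_cst|exact: cvg_id].
- pose c := D^-1 + (`|u| + D) / (D ^+ 2 + u ^+ 2).
  have lim0 : expR (- (D * x)) * c @[x --> +oo] --> 0.
    rewrite -[X in _ --> X](mul0r c); apply: cvgM; last exact: cvg_cst.
    have h : D * x @[x --> +oo] --> +oo.
      apply/cvgryPge => A; near=> x.
      by rewrite -ler_pdivrMl//; near: x; exact: nbhs_pinfty_ge.
    exact: (cvg_comp _ _ h (@cvgr_expR R)).
  apply: (@norm_cvg0 _ R^o); apply: (@squeeze_cvgr _ _ _ _ (fun=> 0) (fun x => expR (- (D * x)) * c)).
  + near=> x; rewrite normr_ge0/= /primitive normrM ger0_norm ?expR_ge0//.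
    rewrite ler_wpM2l ?expR_ge0// (le_trans (ler_normD _ _))// normrN ger0_norm ?invr_ge0 ?(ltW D_gt0)//.
    rewrite lerD2l normrM [X in _ * X]ger0_norm ?invr_ge0 ?(ltW (D2u2_gt0 _))//.
    rewrite ler_wpM2r ?invr_ge0 ?(ltW (D2u2_gt0 _))// (le_trans (ler_normB _ _))//.
    rewrite !normrM (gtr0_norm D_gt0) lerD//.
      rewrite ler_piMr// ler_norml; have := sin_geN1 (u * x); have := sin_le1 (u * x); lra.
    rewrite ler_piMr ?(ltW D_gt0)// ler_norml; have := cos_geN1 (u * x); have := cos_le1 (u * x); lra.
  + exact: cvg_cst.
  + exact: lim0.
- by move=> x _; have := is_derive_primitive u x.
- apply: cvg_at_right_filter; apply: differentiable_continuous; apply/derivable1_diffP.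
  by have := is_derive_primitive u 0.
- move=> x _; rewrite derive1E; have := is_derive_primitive u x => ?; exact: derive_val.
Unshelve. all: by end_near. Qed.

Lemma integral_decay1cos (u : R) :
  (\int[mu]_x (decay x * (1 + cos (u * x)))%:E = (2 / D + poisson u)%:E)%E.
Proof.
rewrite ge0_symfun_integralT.
- by rewrite half_line -EFinM /poisson; congr EFin; field; rewrite !gt_eqF// D2u2_gt0.
- by move=> x; rewrite mulr_ge0 ?(ltW (decay_gt0 _))//; have := cos_geN1 (u * x); lra.
- move=> x; apply: cvgM; first exact: continuous_decay.
  apply: cvgD; first exact: cvg_cst.
  apply: continuous_comp; last exact: continuous_cos.
  by apply: cvgM; [exact: cvg_cst|exact: cvg_id].
- by move=> x /=; rewrite mulrN cosN /decay normrN.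
Qed.

Lemma measurable_decay : measurable_fun setT decay.
Proof. by apply: continuous_measurable_fun; exact: continuous_decay. Qed.

Lemma integral_decay : (\int[mu]_x (decay x)%:E = (2 / D)%:E)%E.
Proof.
have := integral_decay1cos 0.
rewrite [X in X = _ -> _](_ : _ = \int[mu]_x (2%:E * (decay x)%:E))%E; last first.
  by apply: eq_integral => x _; rewrite mul0r cos0 -EFinM; congr EFin; ring.
rewrite ge0_integralZl_EFin//=; last 2 first.
- by move=> x _; rewrite lee_fin ltW// decay_gt0.
- by apply/measurable_EFinP; exact: measurable_decay.
move=> h; have {}h := congr1 (fun x => (2^-1%:E * x)%E) h.
rewrite muleA -EFinM mulVf// mul1e in h; rewrite h -EFinM /poisson; congr EFin.
by rewrite expr0n/=; field; rewrite gt_eqF.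
Qed.

Lemma L1_decay : L1 mu decay.
Proof.
apply: L1_ge0; [exact: measurable_decay|by move=> x; rewrite ltW// decay_gt0|].
by rewrite integral_decay ltry.
Qed.

Lemma L1_decay_cos u : L1 mu (fun x => decay x * cos (u * x)).
Proof.
apply: (@L1_mul_bounded _ _ _ _ _ _ 1); last exact: L1_decay.
- apply: continuous_measurable_fun => x; apply: continuous_comp; last exact: continuous_cos.
  by apply: cvgM; [exact: cvg_cst|exact: cvg_id].
- by move=> x; rewrite ler_norml cos_geN1 cos_le1.
Qed.

Lemma L1_decay_sin u : L1 mu (fun x => decay x * sin (u * x)).
Proof.
apply: (@L1_mul_bounded _ _ _ _ _ _ 1); last exact: L1_decay.
- apply: continuous_measurable_fun => x; apply: continuous_comp; last exact: continuous_sin.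
  by apply: cvgM; [exact: cvg_cst|exact: cvg_id].
- by move=> x; rewrite ler_norml sin_geN1 sin_le1.
Qed.

Lemma Rintegral_decay_cos u : \int[mu]_x (decay x * cos (u * x)) = poisson u.
Proof.
have := congr1 fine (integral_decay1cos u).
rewrite [LHS](_ : _ = \int[mu]_x (decay x + decay x * cos (u * x))); last first.
  by apply: eq_Rintegral => x _; rewrite mulrDr mulr1.
rewrite RintegralD//; [|exact: L1_decay|exact: L1_decay_cos].
by rewrite {1}/Rintegral integral_decay/=; lra.
Qed.

Lemma Rintegral_decay_sin u : \int[mu]_x (decay x * sin (u * x)) = 0.
Proof.
by apply: integral_odd; [exact: L1_decay_sin|move=> x; rewrite mulrN sinN mulrN /decay normrN].
Qed.

Lemma continuous_poisson : continuous poisson.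
Proof.
move=> x; apply: cvgM; first exact: cvg_cst.
apply: cvgV; first by rewrite gt_eqF// D2u2_gt0.
by apply: cvgD; [exact: cvg_cst|apply: cvgM; exact: cvg_id].
Qed.

Lemma measurable_poisson : measurable_fun setT poisson.
Proof. by apply: continuous_measurable_fun; exact: continuous_poisson. Qed.

Lemma integral_poisson (x : R) : (\int[mu]_y (poisson (x - y))%:E = (2 * pi)%:E)%E.
Proof.
have Dne0 : D != 0 by rewrite gt_eqF.
have lim (s : R) : atan ((n%:R + s) / D) @[n --> \oo] --> pi / 2.
  apply: (@cvg_comp _ _ _ (fun n => (n%:R + s) / D) atan _ (+oo) _ _ (cvgy_atan (R := R))).
  apply/cvgryPge => A; near=> n.
  rewrite ler_pdivlMr// -lerBlDr; near: n; exact: nbhs_infty_ger.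
have dF y : is_derive y (1:R) (fun z : R => 2 * atan ((z - x) / D)) (poisson (x - y)).
  have da : is_derive y (1:R) (fun z : R => atan ((z - x) / D)) ((1 + ((y - x) / D) ^+ 2)^-1 * D^-1).
    apply: (@is_derive1_comp _ atan (fun z => (z - x) / D)).
    by apply: is_derive_eq; rewrite /GRing.scale/=; ring.
  apply: is_derive_eq; rewrite /GRing.scale/= /poisson.
  have h : 1 + ((y - x) / D) ^+ 2 = (D ^+ 2 + (x - y) ^+ 2) / D ^+ 2 by field.
  by rewrite h; field; rewrite Dne0 gt_eqF// D2u2_gt0.
have -> : 2 * pi = pi - (- pi) :> R by ring.
apply: (integral_line_ge0_FTC _ _ dF).
- move=> y; apply: (@continuous_comp _ _ _ (fun y => x - y) poisson); last exact: continuous_poisson.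
  by apply: cvgB; [exact: cvg_cst|exact: cvg_id].
- by move=> y; exact: poisson_ge0.
- rewrite [X in _ --> X](_ : _ = 2 * (pi / 2)); last by field.
  by apply: cvgM; [exact: cvg_cst|exact: lim].
- rewrite [X in _ --> X](_ : _ = (- 2) * (pi / 2)); last by field.
  rewrite (_ : (fun _ => _) = (fun n : nat => (- 2) * atan ((n%:R + x) / D))); last first.
    by apply/funext => n; rewrite (_ : (- n%:R - x) / D = - ((n%:R + x) / D)) ?atanN; ring.
  by apply: cvgM; [exact: cvg_cst|exact: lim].
Unshelve. all: by end_near. Qed.

Lemma poissonN u : poisson (- u) = poisson u.
Proof. by rewrite /poisson sqrrN. Qed.

Lemma L1_poisson (x : R) : L1 mu (fun y => poisson (x - y)).
Proof.
apply: L1_ge0.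
- apply: continuous_measurable_fun => y; apply: (@continuous_comp _ _ _ (fun y => x - y) poisson); last exact: continuous_poisson.
  by apply: cvgB; [exact: cvg_cst|exact: cvg_id].
- by move=> y; exact: poisson_ge0.
- by rewrite integral_poisson ltry.
Qed.

End poisson.

(** * Trigonometric integrals on the plane *)
Section fatou_bound.
Context {R : realType} d (T : measurableType d) (m : {measure set T -> \bar R}).

(** Fatou's lemma in the form used to remove convergence factors. *)
Lemma fatou_le (u : nat -> T -> R) (f : T -> R) (c : \bar R) :
  (forall n, measurable_fun setT (u n)) -> (forall n x, 0 <= u n x) ->
  (forall x, u n x @[n --> \oo] --> f x) ->
  (forall n, (\int[m]_x (u n x)%:E <= c)%E) -> (\int[m]_x (f x)%:E <= c)%E.
Proof.
move=> mu u0 uf le_c.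
have fE x : limn_einf (fun n => (u n x)%:E) = (f x)%:E.
  apply: (cvg_limn_einf_sup _).1; apply: cvg_EFin; first exact: nearW.
  exact: uf.
under eq_integral do rewrite -fE.
apply: le_trans (@fatou _ _ _ m setT measurableT (fun n x => (u n x)%:E) _ _) _ => //.
- by move=> n; exact/measurable_EFinP.
- by move=> n x _; rewrite lee_fin.
rewrite limn_einf_lim; apply: lime_le; first exact: is_cvg_einfs.
apply: nearW => n; apply: le_trans (le_c n); apply: ereal_inf_lbound.
by exists n => /=.
Qed.
End fatou_bound.

Section kernels.
Context {R : realType}.
Local Notation leb := (@lebesgue_measure R).
Local Notation mu := (mu2 R).
Implicit Types (x y xi p : plane R) (g h : plane R -> R).

Lemma measurable_funX1 (f : R -> R) : measurable_fun setT f ->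
  measurable_fun setT (fun p : plane R => f p.1).
Proof. by move=> mf; exact: (measurableT_comp mf measurable_fst). Qed.

Lemma measurable_funX2 (f : R -> R) : measurable_fun setT f ->
  measurable_fun setT (fun p : plane R => f p.2).
Proof. by move=> mf; exact: (measurableT_comp mf measurable_snd). Qed.

Lemma integral_tensor (f g : R -> R) (a b : R) :
  measurable_fun setT f -> measurable_fun setT g ->
  (forall t, 0 <= f t) -> (forall t, 0 <= g t) ->
  (\int[leb]_x (f x)%:E = a%:E)%E -> (\int[leb]_x (g x)%:E = b%:E)%E ->
  (\int[mu]_p (f p.1 * g p.2)%:E = (a * b)%:E)%E.
Proof.
move=> mf mg f0 g0 fa gb.
rewrite (fubini_tonelli1 (fun p : plane R => (f p.1 * g p.2)%:E))/=; last 2 first.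
- by apply/measurable_EFinP; apply: measurable_funM; [exact: measurable_funX1|exact: measurable_funX2].
- by move=> p; rewrite lee_fin mulr_ge0.
transitivity (\int[leb]_x ((f x)%:E * b%:E))%E.
  apply: eq_integral => x _; rewrite /fubini_F/= -gb -ge0_integralZl//=.
  + exact/measurable_EFinP.
  + by move=> y _; rewrite lee_fin.
  + by rewrite lee_fin.
have b0 : (0 <= b%:E)%E by rewrite -gb; apply: integral_ge0 => y _; rewrite lee_fin.
rewrite ge0_integralZr//=.
- by rewrite fa EFinM.
- exact/measurable_EFinP.
- by move=> x _; rewrite lee_fin.
Qed.

Lemma L1_tensor (f g : R -> R) : L1 leb f -> L1 leb g ->
  L1 mu (fun p => f p.1 * g p.2).
Proof.
move=> hf hg; apply: (@integrable_prod_dominated R _ _ _ _ leb leb _ f g) => //.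
- by apply: measurable_funM; [exact: measurable_funX1 (L1_measurable hf)|exact: measurable_funX2 (L1_measurable hg)].
- by move=> x y /=; rewrite normrM.
Qed.

Lemma Rintegral_tensor (f g : R -> R) : L1 leb f -> L1 leb g ->
  \int[mu]_p (f p.1 * g p.2) = (\int[leb]_x f x) * (\int[leb]_x g x).
Proof.
move=> hf hg; rewrite -(Rintegral12 (L1_tensor hf hg))/=.
rewrite -[RHS]RintegralZr//; apply: eq_Rintegral => x _.
by rewrite RintegralZl.
Qed.

Definition dot x xi : R := x.1 * xi.1 + x.2 * xi.2.
Definition psub x y : plane R := (x.1 - y.1, x.2 - y.2).

Lemma measurable_dot : measurable_fun setT (fun p : plane R * plane R => dot p.1 p.2).
Proof.
apply: measurable_funD; apply: measurable_funM.
- exact: (measurableT_comp measurable_fst measurable_fst).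
- exact: (measurableT_comp measurable_fst measurable_snd).
- exact: (measurableT_comp measurable_snd measurable_fst).
- exact: (measurableT_comp measurable_snd measurable_snd).
Qed.

Lemma measurable_psub : measurable_fun setT (fun p : plane R * plane R => psub p.1 p.2).
Proof.
apply: measurable_fun_pair; apply: measurable_funB.
- exact: (measurableT_comp measurable_fst measurable_fst).
- exact: (measurableT_comp measurable_fst measurable_snd).
- exact: (measurableT_comp measurable_snd measurable_fst).
- exact: (measurableT_comp measurable_snd measurable_snd).
Qed.

Lemma measurable_cos : measurable_fun setT (@cos R).
Proof. by apply: continuous_measurable_fun; exact: continuous_cos. Qed.

Lemma measurable_sin : measurable_fun setT (@sin R).
Proof. by apply: continuous_measurable_fun; exact: continuous_sin. Qed.

Lemma measurable_cos_dot : measurable_fun setT (fun p : plane R * plane R => cos (dot p.1 p.2)).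
Proof. exact: (measurableT_comp measurable_cos measurable_dot). Qed.

Lemma measurable_sin_dot : measurable_fun setT (fun p : plane R * plane R => sin (dot p.1 p.2)).
Proof. exact: (measurableT_comp measurable_sin measurable_dot). Qed.

Lemma measurable_slice1 d (T : measurableType d) (f : plane R * plane R -> T) y :
  measurable_fun setT f -> measurable_fun setT (fun x => f (x, y)).
Proof. by move=> mf; apply: (measurableT_comp mf); exact: measurable_fun_pair. Qed.

Lemma measurable_slice2 d (T : measurableType d) (f : plane R * plane R -> T) x :
  measurable_fun setT f -> measurable_fun setT (fun y => f (x, y)).
Proof. by move=> mf; apply: (measurableT_comp mf); exact: measurable_fun_pair. Qed.

Lemma normr_cos_le1 (a : R) : `|cos a| <= 1.
Proof. by rewrite ler_norml cos_geN1 cos_le1. Qed.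

Lemma normr_sin_le1 (a : R) : `|sin a| <= 1.
Proof. by rewrite ler_norml sin_geN1 sin_le1. Qed.

(** Real and imaginary parts of the transform, up to sign. *)
Definition Fcos g xi : R := \int[mu]_x (g x * cos (dot x xi)).
Definition Fsin g xi : R := \int[mu]_x (g x * sin (dot x xi)).

Lemma L1_cos g xi : L1 mu g -> L1 mu (fun x => g x * cos (dot x xi)).
Proof.
move=> hg; apply: (@L1_mul_bounded _ _ _ _ _ _ 1) => //.
- exact: (measurable_slice1 xi measurable_cos_dot).
- by move=> x; exact: normr_cos_le1.
Qed.

Lemma L1_sin g xi : L1 mu g -> L1 mu (fun x => g x * sin (dot x xi)).
Proof.
move=> hg; apply: (@L1_mul_bounded _ _ _ _ _ _ 1) => //.
- exact: (measurable_slice1 xi measurable_sin_dot).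
- by move=> x; exact: normr_sin_le1.
Qed.

Lemma Fcos_le g xi : L1 mu g -> `|Fcos g xi| <= \int[mu]_x `|g x|.
Proof.
move=> hg; have hc := L1_cos xi hg.
apply: (le_trans (le_normr_Rintegral measurableT hc)).
apply: le_Rint; [exact: L1_norm|exact: L1_norm|].
by move=> x; rewrite normrM ler_piMr// normr_cos_le1.
Qed.

Lemma Fsin_le g xi : L1 mu g -> `|Fsin g xi| <= \int[mu]_x `|g x|.
Proof.
move=> hg; have hc := L1_sin xi hg.
apply: (le_trans (le_normr_Rintegral measurableT hc)).
apply: le_Rint; [exact: L1_norm|exact: L1_norm|].
by move=> x; rewrite normrM ler_piMr// normr_sin_le1.
Qed.

Section poisson_plane.
Variable D : R.
Hypothesis D_gt0 : 0 < D.

Definition decay2 xi : R := decay D xi.1 * decay D xi.2.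
Definition poisson2 (u : plane R) : R := poisson D u.1 * poisson D u.2.

Lemma decay2_gt0 xi : 0 < decay2 xi.
Proof. by rewrite mulr_gt0// decay_gt0. Qed.

Lemma decay2_le1 xi : decay2 xi <= 1.
Proof. by rewrite mulr_ile1 ?decay_le1// ltW// decay_gt0. Qed.

Lemma measurable_decay2 : measurable_fun setT decay2.
Proof.
by apply: measurable_funM; [apply: measurable_funX1|apply: measurable_funX2];
  exact: measurable_decay.
Qed.

Lemma L1_decay2 : L1 mu decay2.
Proof. by apply: L1_tensor; exact: L1_decay. Qed.

Lemma poisson2_ge0 u : 0 <= poisson2 u.
Proof. by rewrite mulr_ge0// poisson_ge0. Qed.

Lemma poisson2_le u : `|poisson2 u| <= (2 / D) ^+ 2.
Proof. by rewrite ger0_norm ?poisson2_ge0// expr2 ler_pM ?poisson_ge0 ?poisson_le. Qed.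

Lemma measurable_poisson2 : measurable_fun setT poisson2.
Proof.
by apply: measurable_funM; [apply: measurable_funX1|apply: measurable_funX2];
  exact: measurable_poisson.
Qed.

Lemma measurable_poisson2_sub :
  measurable_fun setT (fun p : plane R * plane R => poisson2 (psub p.1 p.2)).
Proof. exact: (measurableT_comp measurable_poisson2 measurable_psub). Qed.

Lemma measurable_poisson2_slice2 x : measurable_fun setT (fun y => poisson2 (psub x y)).
Proof. exact: (measurable_slice2 x measurable_poisson2_sub). Qed.

Lemma measurable_poisson2_slice1 y : measurable_fun setT (fun x => poisson2 (psub x y)).
Proof. exact: (measurable_slice1 y measurable_poisson2_sub). Qed.

Lemma integral_poisson2 x : (\int[mu]_y (poisson2 (psub x y))%:E = (4 * pi ^+ 2)%:E)%E.
Proof.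
rewrite (@integral_tensor (fun a => poisson D (x.1 - a)) (fun b => poisson D (x.2 - b))
  (2 * pi) (2 * pi)).
- by congr EFin; ring.
- exact: (L1_measurable (L1_poisson D_gt0 x.1)).
- exact: (L1_measurable (L1_poisson D_gt0 x.2)).
- by move=> a; exact: poisson_ge0.
- by move=> a; exact: poisson_ge0.
- exact: integral_poisson.
- exact: integral_poisson.
Qed.

Lemma poisson2C x y : poisson2 (psub x y) = poisson2 (psub y x).
Proof.
by rewrite /poisson2 /= -[in LHS]poissonN -[X in _ * X = _]poissonN !opprB.
Qed.

Lemma integral_poisson2' y : (\int[mu]_x (poisson2 (psub x y))%:E = (4 * pi ^+ 2)%:E)%E.
Proof. by rewrite -(integral_poisson2 y); apply: eq_integral => x _; rewrite poisson2C. Qed.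

Lemma L1_poisson2 x : L1 mu (fun y => poisson2 (psub x y)).
Proof.
apply: L1_ge0; last by rewrite integral_poisson2 ltry.
- exact: (measurable_slice2 x measurable_poisson2_sub).
- by move=> y; exact: poisson2_ge0.
Qed.

Lemma Rintegral_decay2_cos u : \int[mu]_xi (decay2 xi * cos (dot u xi)) = poisson2 u.
Proof.
transitivity (\int[mu]_xi ((decay D xi.1 * cos (u.1 * xi.1)) * (decay D xi.2 * cos (u.2 * xi.2))
    - (decay D xi.1 * sin (u.1 * xi.1)) * (decay D xi.2 * sin (u.2 * xi.2)))).
  by apply: eq_Rintegral => xi _; rewrite /decay2 /dot cosD; ring.
have Lc v := L1_decay_cos D_gt0 v; have Ls v := L1_decay_sin D_gt0 v.
rewrite RintegralB//; [|exact: (L1_tensor (Lc _) (Lc _))|exact: (L1_tensor (Ls _) (Ls _))].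
rewrite (Rintegral_tensor (Lc _) (Lc _)) (Rintegral_tensor (Ls _) (Ls _)).
by rewrite !Rintegral_decay_cos// !Rintegral_decay_sin// mulr0 subr0.
Qed.

(** Multiplying the transform by [decay2 D] amounts to convolving the function
    with the Poisson kernel: Fubini's theorem and
    [cos (a - b) = cos a * cos b + sin a * sin b]. *)
Lemma abel_means g x : L1 mu g ->
  \int[mu]_xi (decay2 xi * (cos (dot x xi) * Fcos g xi + sin (dot x xi) * Fsin g xi))
  = \int[mu]_y (g y * poisson2 (psub x y)).
Proof.
move=> hg.
pose k (p : plane R * plane R) := decay2 p.1 * (g p.2 * cos (dot (psub x p.2) p.1)).
have mk : measurable_fun setT k.
  apply: measurable_funM; first exact: (measurableT_comp measurable_decay2 measurable_fst).
  apply: measurable_funM; first exact: (measurableT_comp (L1_measurable hg) measurable_snd).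
  have mh : measurable_fun setT (fun p : plane R * plane R => (psub x p.2, p.1)).
    apply: measurable_fun_pair => //.
    by apply: (measurableT_comp (measurable_slice2 x measurable_psub)).
  exact: (measurableT_comp measurable_cos_dot mh).
have le_k xi y : `|k (xi, y)| <= `|decay2 xi| * `|g y|.
  by rewrite /k !normrM ler_wpM2l// ler_piMr// normr_cos_le1.
transitivity (\int[mu]_xi (\int[mu]_y k (xi, y))).
  apply: eq_Rintegral => xi _.
  have hc := L1_cos xi hg; have hs := L1_sin xi hg.
  rewrite /k/= /Fcos /Fsin RintegralZl//; last first.
    apply: (@L1_mul_bounded _ _ _ _ _ _ 1) => //.
    + exact: (measurableT_comp (measurable_slice1 xi measurable_cos_dot)
        (measurable_slice2 x measurable_psub)).
    + by move=> y; exact: normr_cos_le1.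
  congr (_ * _).
  rewrite -RintegralZl// -[X in _ + X]RintegralZl// -RintegralD//; [|exact: L1Z|exact: L1Z].
  apply: eq_Rintegral => y _.
  have -> : dot (psub x y) xi = dot x xi - dot y xi by rewrite /dot /psub/=; ring.
  by rewrite cosB; ring.
rewrite (Rintegral_plane_swap mk L1_decay2 hg le_k).
apply: eq_Rintegral => y _; rewrite /k/=.
rewrite -Rintegral_decay2_cos -RintegralZl//; last first.
  apply: (@L1_mul_bounded _ _ _ _ _ _ 1); last exact: L1_decay2.
  - exact: (measurable_slice2 (psub x y) measurable_cos_dot).
  - by move=> xi; exact: normr_cos_le1.
by apply: eq_Rintegral => xi _; ring.
Qed.

Lemma measurable_decay2V : measurable_fun setT (fun xi => (decay2 xi)^-1).
Proof.
have mV : measurable_fun setT (fun a : R => (decay D a)^-1).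
  apply: continuous_measurable_fun => a; apply: cvgV; first by rewrite gt_eqF// decay_gt0.
  exact: continuous_decay.
rewrite (_ : (fun _ => _) = fun xi : plane R => (decay D xi.1)^-1 * (decay D xi.2)^-1).
  by apply: measurable_funM; [exact: (measurable_funX1 mV)|exact: (measurable_funX2 mV)].
by apply/funext => xi; rewrite /decay2 invfM.
Qed.

(** Measurability of a parametric integral with a bounded kernel: the weight
    [decay2] makes the kernel integrable on the product and is divided out. *)
Lemma measurable_transform (c : R -> R) g : measurable_fun setT c ->
  (forall a, `|c a| <= 1) -> L1 mu g ->
  measurable_fun setT (fun xi => \int[mu]_x (g x * c (dot x xi))).
Proof.
move=> mc c1 hg.
have mk : measurable_fun setT (fun p : plane R * plane R =>
    decay2 p.1 * (g p.2 * c (dot p.2 p.1))).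
  apply: measurable_funM; first exact: (measurableT_comp measurable_decay2 measurable_fst).
  apply: measurable_funM; first exact: (measurableT_comp (L1_measurable hg) measurable_snd).
  have mh : measurable_fun setT (fun p : plane R * plane R => (p.2, p.1)).
    exact: measurable_fun_pair.
  exact: (measurableT_comp (measurableT_comp mc measurable_dot) mh).
have le_k xi y : `|decay2 xi * (g y * c (dot y xi))| <= `|decay2 xi| * `|g y|.
  by rewrite !normrM ler_wpM2l// ler_piMr.
have m1 := measurable_Rintegral_plane mk L1_decay2 hg le_k.
rewrite (_ : (fun xi => _) =
    fun xi => (decay2 xi)^-1 * (decay2 xi * \int[mu]_x (g x * c (dot x xi)))); last first.
  by apply/funext => xi; rewrite mulKf// gt_eqF// decay2_gt0.
apply: measurable_funM; first exact: measurable_decay2V.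
apply: eq_measurable_fun m1 => xi _ /=; rewrite RintegralZl//.
apply: (@L1_mul_bounded _ _ _ _ _ _ 1) => //.
exact: (measurable_slice1 xi (measurableT_comp mc measurable_dot)).
Qed.

End poisson_plane.

Lemma measurable_Fcos g : L1 mu g -> measurable_fun setT (Fcos g).
Proof.
by apply: (measurable_transform ltr01); [exact: measurable_cos|exact: normr_cos_le1].
Qed.

Lemma measurable_Fsin g : L1 mu g -> measurable_fun setT (Fsin g).
Proof.
by apply: (measurable_transform ltr01); [exact: measurable_sin|exact: normr_sin_le1].
Qed.

End kernels.

(** * Plancherel's inequality *)
Section plancherel.
Context {R : realType}.
Local Notation mu := (mu2 R).
Implicit Types (x y xi p : plane R) (g h : plane R -> R).

Lemma normr_le_sqr (a m : R) : `|a| <= m -> a ^+ 2 <= m ^+ 2.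
Proof.
by move=> am; rewrite -[leLHS]real_normK ?num_real// lerXn2r ?nnegrE// (le_trans _ am).
Qed.

Lemma sqrD_le (a b m : R) : `|a| <= m -> `|b| <= m -> `|a ^+ 2 + b ^+ 2| <= 2 * m ^+ 2.
Proof.
move=> am bm; rewrite ger0_norm ?addr_ge0 ?sqr_ge0// mulr_natl mulr2n lerD//;
exact: normr_le_sqr.
Qed.

Lemma cos_sin_le (t a b m : R) : `|a| <= m -> `|b| <= m ->
  `|cos t * a + sin t * b| <= 2 * m.
Proof.
move=> am bm; rewrite mulr_natl mulr2n (le_trans (ler_normD _ _))// lerD// normrM.
  by rewrite -[leRHS]mul1r ler_pM// normr_cos_le1.
by rewrite -[leRHS]mul1r ler_pM// normr_sin_le1.
Qed.

Section weighted.
Variables (D : R) (g : plane R -> R).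
Hypotheses (D0 : 0 < D) (hg : L1 mu g).

Let A x := \int[mu]_y (g y * poisson2 D (psub x y)).

Let m := \int[mu]_x `|g x|.

(** Its integral over space first gives the weighted squared modulus of the
    transform, and over frequencies first the quadratic form of the Poisson
    kernel. *)
Let kernel (p : plane R * plane R) : R := decay2 D p.1 * (g p.2 *
  (cos (dot p.2 p.1) * Fcos g p.1 + sin (dot p.2 p.1) * Fsin g p.1)).

Let m_ge0 : 0 <= m. Proof. exact: Rintegral_ge0. Qed.

Let cs_le y xi : `|cos (dot y xi) * Fcos g xi + sin (dot y xi) * Fsin g xi| <= 2 * m.
Proof. by apply: cos_sin_le; [exact: Fcos_le|exact: Fsin_le]. Qed.

Let le_kernel xi y : `|kernel (xi, y)| <= `|decay2 D xi| * `|2 * m * g y|.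
Proof.
rewrite /kernel/= normrM; apply: ler_wpM2l; first exact: normr_ge0.
rewrite normrM [leRHS]normrM [leRHS]mulrC; apply: ler_wpM2l; first exact: normr_ge0.
by rewrite [leRHS]ger0_norm ?cs_le// mulr_ge0.
Qed.

Let measurable_swap : measurable_fun setT (fun p : plane R * plane R => (p.2, p.1)).
Proof. exact: measurable_fun_pair. Qed.

Let measurable_kernel : measurable_fun setT kernel.
Proof.
apply: measurable_funM; first exact: (measurableT_comp (measurable_decay2 D) measurable_fst).
apply: measurable_funM; first exact: (measurableT_comp (L1_measurable hg) measurable_snd).
apply: measurable_funD; apply: measurable_funM.
- exact: (measurableT_comp measurable_cos_dot measurable_swap).
- exact: (measurableT_comp (measurable_Fcos hg) measurable_fst).
- exact: (measurableT_comp measurable_sin_dot measurable_swap).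
- exact: (measurableT_comp (measurable_Fsin hg) measurable_fst).
Qed.

Let L1_bound : L1 mu (fun y => 2 * m * g y). Proof. exact: L1Z. Qed.

Let kernel_frequency xi :
  \int[mu]_y kernel (xi, y) = decay2 D xi * (Fcos g xi ^+ 2 + Fsin g xi ^+ 2).
Proof.
have hc := L1_cos xi hg; have hs := L1_sin xi hg.
have hc' := L1Z (Fcos g xi) hc; have hs' := L1Z (Fsin g xi) hs.
rewrite [LHS](_ : _ = \int[mu]_y (decay2 D xi * (Fcos g xi * (g y * cos (dot y xi)) +
   Fsin g xi * (g y * sin (dot y xi))))); last first.
  by apply: eq_Rintegral => y _; rewrite /kernel/=; ring.
rewrite (RintZ _ (L1D hc' hs')) (RintD hc' hs') (RintZ _ hc) (RintZ _ hs).
by rewrite !expr2.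
Qed.

Let kernel_space y : \int[mu]_xi kernel (xi, y) = g y * A y.
Proof.
have hcs : L1 mu (fun xi => decay2 D xi *
    (cos (dot y xi) * Fcos g xi + sin (dot y xi) * Fsin g xi)).
  apply: (@L1_mul_bounded _ _ _ _ _ _ (2 * m)); last exact: L1_decay2.
  + exact: (measurable_funD
      (measurable_funM (measurable_slice2 y measurable_cos_dot) (measurable_Fcos hg))
      (measurable_funM (measurable_slice2 y measurable_sin_dot) (measurable_Fsin hg))).
  + by move=> xi; exact: cs_le.
rewrite /A -(abel_means D0 y hg) -(RintZ (g y) hcs).
by apply: eq_Rintegral => xi _; rewrite /kernel/=; ring.
Qed.

Lemma weighted_transform_poisson :
  \int[mu]_xi (decay2 D xi * (Fcos g xi ^+ 2 + Fsin g xi ^+ 2)) = \int[mu]_y (g y * A y).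
Proof.
have := Rintegral_plane_swap measurable_kernel (L1_decay2 D0) L1_bound le_kernel.
rewrite [X in X = _ -> _](_ : _ =
  \int[mu]_xi (decay2 D xi * (Fcos g xi ^+ 2 + Fsin g xi ^+ 2))); last first.
  by apply: eq_Rintegral => xi _; exact: kernel_frequency.
move=> ->; apply: eq_Rintegral => y _; exact: kernel_space.
Qed.

Lemma L1_weighted_transform :
  L1 mu (fun xi => decay2 D xi * (Fcos g xi ^+ 2 + Fsin g xi ^+ 2)).
Proof.
apply: (@L1_mul_bounded _ _ _ _ _ _ (2 * m ^+ 2)); last exact: L1_decay2.
- exact: (measurable_funD (measurable_sqr (measurable_Fcos hg))
    (measurable_sqr (measurable_Fsin hg))).
- by move=> xi; apply: sqrD_le; [exact: Fcos_le|exact: Fsin_le].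
Qed.

Lemma L1_poisson_form : L1 mu (fun y => g y * A y).
Proof.
have le_k' y xi : `|kernel (xi, y)| <= `|2 * m * g y| * `|decay2 D xi|.
  by rewrite [leRHS]mulrC; exact: le_kernel.
apply: (@le_L1 _ _ _ _ _ (fun y => (\int[mu]_xi decay2 D xi) * `|2 * m * g y|)).
- have := measurable_Rintegral_plane (measurableT_comp measurable_kernel measurable_swap)
    L1_bound (L1_decay2 D0) le_k'.
  by under eq_fun do rewrite /= kernel_space.
- move=> y; rewrite -kernel_space.
  have hk' := L1Z `|2 * m * g y| (L1_decay2 D0).
  have le_k2 xi : `|kernel (xi, y)| <= `|2 * m * g y| * decay2 D xi.
    by have := le_k' y xi; rewrite (ger0_norm (ltW (decay2_gt0 D xi))).
  have hk : L1 mu (fun xi => kernel (xi, y)).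
    exact: (le_L1 (measurable_slice1 y measurable_kernel) le_k2 hk').
  apply: (le_trans (le_normr_Rintegral measurableT hk)).
  rewrite mulrC -(RintZ _ (L1_decay2 D0)).
  exact: (le_Rint (L1_norm hk) hk' le_k2).
- exact: (L1Z _ (L1_norm L1_bound)).
Qed.

Hypothesis hg2 : square_integrable mu g.

Let mg : measurable_fun setT g. Proof. exact: L1_measurable hg. Qed.

Let sq1 (p : plane R * plane R) : R := g p.1 ^+ 2 / 2 * poisson2 D (psub p.1 p.2).
Let sq2 (p : plane R * plane R) : R := g p.2 ^+ 2 / 2 * poisson2 D (psub p.1 p.2).

Let half_ge0 y : 0 <= g y ^+ 2 / 2.
Proof. by rewrite mulr_ge0 ?sqr_ge0// invr_ge0. Qed.

Let sq1_ge0 (p : plane R * plane R) : 0 <= sq1 p.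
Proof. by rewrite mulr_ge0 ?half_ge0// poisson2_ge0. Qed.

Let sq2_ge0 (p : plane R * plane R) : 0 <= sq2 p.
Proof. by rewrite mulr_ge0 ?half_ge0// poisson2_ge0. Qed.

Let measurable_sq1 : measurable_fun setT sq1.
Proof.
apply: measurable_funM; last exact: measurable_poisson2_sub.
apply: measurable_funM; last exact: measurable_cst.
exact: (measurableT_comp (measurable_sqr mg) measurable_fst).
Qed.

Let measurable_sq2 : measurable_fun setT sq2.
Proof.
apply: measurable_funM; last exact: measurable_poisson2_sub.
apply: measurable_funM; last exact: measurable_cst.
exact: (measurableT_comp (measurable_sqr mg) measurable_snd).
Qed.

Let integral_sq1 x : (\int[mu]_y (sq1 (x, y))%:E = (2 * pi ^+ 2)%:E * (g x ^+ 2)%:E)%E.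
Proof.
rewrite /sq1/=; under eq_integral do rewrite EFinM.
rewrite ge0_integralZl_EFin//.
- by rewrite integral_poisson2// -!EFinM; congr EFin; field.
- by move=> y _; rewrite lee_fin poisson2_ge0.
- by apply/measurable_EFinP; exact: (measurable_poisson2_slice2 D0 x).
Qed.

Let integral_sq2 y : (\int[mu]_x (sq2 (x, y))%:E = (2 * pi ^+ 2)%:E * (g y ^+ 2)%:E)%E.
Proof.
rewrite /sq2/=; under eq_integral do rewrite EFinM.
rewrite ge0_integralZl_EFin//.
- by rewrite integral_poisson2'// -!EFinM; congr EFin; field.
- by move=> x _; rewrite lee_fin poisson2_ge0.
- by apply/measurable_EFinP; exact: (measurable_poisson2_slice1 D0 y).
Qed.

Let le_poisson_form :
  ((\int[mu]_y (g y * A y))%:E <= \int[mu]_x \int[mu]_y (sq1 (x, y) + sq2 (x, y))%:E)%E.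
Proof.
have dom0 (p : plane R * plane R) : 0 <= sq1 p + sq2 p by rewrite addr_ge0 ?sq1_ge0 ?sq2_ge0.
have mdom := measurable_funD measurable_sq1 measurable_sq2.
rewrite -(L1_EFin L1_poisson_form); apply: (@le_trans _ _ (\int[mu]_x (`|g x * A x|)%:E)%E).
  apply: le_integral; [exact: measurableT|exact: L1_poisson_form|exact: (L1_norm L1_poisson_form)|].
  by move=> x _; rewrite lee_fin ler_norm.
apply: ge0_le_integral.
- exact: measurableT.
- by move=> x _; rewrite lee_fin.
- by apply/measurable_EFinP; exact: L1_measurable (L1_norm L1_poisson_form).
- exact: (measurable_integral_plane mdom dom0).
move=> x _.
have hgP : L1 mu (fun y => g y * poisson2 D (psub x y)).
  apply: (@L1_mul_bounded _ _ _ _ _ _ ((2 / D) ^+ 2)); last exact: hg.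
    exact: (measurable_poisson2_slice2 D0 x).
  by move=> y; exact: poisson2_le.
rewrite /A -(RintZ (g x) hgP).
have hgP' := L1Z (g x) hgP.
apply: (@le_trans _ _ (\int[mu]_y `|g x * (g y * poisson2 D (psub x y))|)%:E%E).
  by rewrite lee_fin; exact: (le_normr_Rintegral measurableT hgP').
rewrite -(L1_EFin (L1_norm hgP')); apply: ge0_le_integral.
- exact: measurableT.
- by move=> y _; rewrite lee_fin.
- by apply/measurable_EFinP; exact: L1_measurable (L1_norm hgP').
- by apply/measurable_EFinP; exact: (measurable_slice2 x mdom).
- move=> y _; rewrite lee_fin /sq1 /sq2/= normrM normrM (ger0_norm (poisson2_ge0 D0 _)).
  rewrite mulrA -mulrDl ler_wpM2r ?poisson2_ge0//.
  rewrite -(real_normK (num_real (g x))) -(real_normK (num_real (g y))).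
  by have := sqr_ge0 (`|g x| - `|g y|); nra.
Qed.

(** By [|a * b| <= (a ^+ 2 + b ^+ 2) / 2] the quadratic form is at most the
    integral of [g ^+ 2] times the mass of the kernel. *)
Lemma poisson_form_le :
  ((\int[mu]_y (g y * A y))%:E <= (4 * pi ^+ 2)%:E * \int[mu]_x (g x ^+ 2)%:E)%E.
Proof.
apply: (le_trans le_poisson_form).
have m2 : measurable_fun setT (fun x => ((2 * pi ^+ 2)%:E * (g x ^+ 2)%:E)%E).
  by apply/measurable_EFinP; exact: (measurable_funM (measurable_cst _) (measurable_sqr mg)).
have tot : (\int[mu]_x ((2 * pi ^+ 2)%:E * (g x ^+ 2)%:E) =
    (2 * pi ^+ 2)%:E * \int[mu]_x (g x ^+ 2)%:E)%E.
  rewrite ge0_integralZl_EFin//.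
  - by move=> x _; rewrite lee_fin sqr_ge0.
  - by apply/measurable_EFinP; exact: measurable_sqr.
  - by rewrite mulr_ge0// sqr_ge0.
rewrite (_ : (\int[mu]_x \int[mu]_y (sq1 (x, y) + sq2 (x, y))%:E)%E =
  (\int[mu]_x ((2 * pi ^+ 2)%:E * (g x ^+ 2)%:E + \int[mu]_y (sq2 (x, y))%:E))%E); last first.
  apply: eq_integral => x _; under eq_integral do rewrite EFinD.
  rewrite ge0_integralD ?integral_sq1//.
  - by move=> y _; rewrite lee_fin sq1_ge0.
  - by apply/measurable_EFinP; exact: (measurable_slice2 x measurable_sq1).
  - by move=> y _; rewrite lee_fin sq2_ge0.
  - by apply/measurable_EFinP; exact: (measurable_slice2 x measurable_sq2).
rewrite ge0_integralD//.
- rewrite (integral_plane_swap measurable_sq2 sq2_ge0).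
  rewrite [X in (_ + X)%E](_ : _ = \int[mu]_x ((2 * pi ^+ 2)%:E * (g x ^+ 2)%:E))%E; last first.
    by apply: eq_integral => y _; exact: integral_sq2.
  rewrite tot (_ : (4 * pi ^+ 2)%:E = (2 * pi ^+ 2)%:E + (2 * pi ^+ 2)%:E :> \bar R)%E; last first.
    by rewrite -EFinD; congr EFin; ring.
  by rewrite ge0_muleDl// lee_fin mulr_ge0 ?sqr_ge0.
- by move=> x _; rewrite -EFinM lee_fin; apply: mulr_ge0; rewrite ?sqr_ge0// mulr_ge0 ?sqr_ge0.
- by move=> x _; apply: integral_ge0 => y _; rewrite lee_fin sq2_ge0.
- exact: (measurable_integral_plane measurable_sq2 sq2_ge0).
Qed.

Lemma plancherel_weighted :
  (\int[mu]_xi (decay2 D xi * (Fcos g xi ^+ 2 + Fsin g xi ^+ 2))%:E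
   <= (4 * pi ^+ 2)%:E * \int[mu]_x (g x ^+ 2)%:E)%E.
Proof.
by rewrite (L1_EFin L1_weighted_transform) weighted_transform_poisson; exact: poisson_form_le.
Qed.

End weighted.

Lemma decay_cvg (t : R) : decay n.+1%:R^-1 t @[n --> \oo] --> (1:R).
Proof.
have h : - (n.+1%:R^-1 * `|t|) @[n --> \oo] --> - (0 * `|t|).
  by apply: cvgN; apply: cvgM; [exact: cvg_harmonic|exact: cvg_cst].
rewrite mul0r oppr0 in h.
by have := cvg_comp _ _ h (@continuous_expR R 0); rewrite expR0.
Qed.

Lemma decay2_cvg xi : decay2 n.+1%:R^-1 xi @[n --> \oo] --> (1:R).
Proof. by rewrite -[X in _ --> X]mulr1; apply: cvgM; exact: decay_cvg. Qed.

(** Plancherel's inequality: the squared modulus of the transform, weighted by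
    [decay2 D], has integral the quadratic form of the Poisson kernel, whose
    mass is [4 * pi ^+ 2] for every [D]; Fatou's lemma removes the weight. *)
Lemma plancherel_le g : L1 mu g -> square_integrable mu g ->
  (\int[mu]_xi (Fcos g xi ^+ 2 + Fsin g xi ^+ 2)%:E
   <= (4 * pi ^+ 2)%:E * \int[mu]_x (g x ^+ 2)%:E)%E.
Proof.
move=> hg hg2.
have mF : measurable_fun setT (fun xi => Fcos g xi ^+ 2 + Fsin g xi ^+ 2).
  by apply: measurable_funD; apply: measurable_sqr; [exact: measurable_Fcos|exact: measurable_Fsin].
apply: (@fatou_le _ _ _ _
  (fun n xi => decay2 n.+1%:R^-1 xi * (Fcos g xi ^+ 2 + Fsin g xi ^+ 2))).
- by move=> n; apply: measurable_funM => //; exact: measurable_decay2.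
- by move=> n xi; rewrite mulr_ge0 ?addr_ge0 ?sqr_ge0// ltW// decay2_gt0.
- move=> xi; rewrite -[X in _ --> X]mul1r; apply: cvgM; last exact: cvg_cst.
  exact: decay2_cvg.
- by move=> n; apply: plancherel_weighted.
Qed.

End plancherel.

(** * The Fourier transform of square-integrable functions *)
Section fourier_theory.
Context {R : realType}.
Local Notation mu := (mu2 R).
Implicit Types (f g p : plane R -> R) (G H : plane R -> R * R).

Lemma sqmod_ge0 (z : R * R) : 0 <= sqmod z.
Proof. by rewrite addr_ge0 ?sqr_ge0. Qed.

Lemma sqmodD_le (a b : R * R) : sqmod (a + b) <= 2 * sqmod a + 2 * sqmod b.
Proof.
case: a b => [a1 a2] [b1 b2]; rewrite /sqmod/=.
by have := sqr_ge0 (a1 - b1); have := sqr_ge0 (a2 - b2); nra.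
Qed.

Lemma measurable_sqmod G : measurable_fun setT (fun xi => (G xi).1) ->
  measurable_fun setT (fun xi => (G xi).2) -> measurable_fun setT (fun xi => sqmod (G xi)).
Proof. by move=> m1 m2; exact: (measurable_funD (measurable_sqr m1) (measurable_sqr m2)). Qed.

Definition trunc n f : plane R -> R := f \_ (box n).

Lemma measurable_trunc n f : measurable_fun setT f -> measurable_fun setT (trunc n f).
Proof.
move=> mf; apply/(measurable_restrictT _ (measurable_box n)).
exact: measurable_funTS.
Qed.

Lemma trunc_le n f x : `|trunc n f x| <= `|f x|.
Proof. by rewrite /trunc patchE; case: ifP => _; rewrite ?normr0. Qed.

Lemma trunc_cvg f x : trunc n f x @[n --> \oo] --> f x.
Proof.
apply: cvg_near_cst; near=> n; rewrite /trunc patchE mem_set//.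
by near: n; exact: near_box.
Unshelve. all: by end_near. Qed.

Lemma square_integrable_trunc n f : L2 f -> square_integrable mu (trunc n f).
Proof.
move=> hf; apply: (le_square_integrable (measurable_trunc n hf.1) _ hf).
exact: trunc_le.
Qed.

(** The indicator function of a box is square-integrable. *)
Lemma L1_trunc n f : L2 f -> L1 mu (trunc n f).
Proof.
move=> hf; have hi : square_integrable mu (fun x => \1_(box n) x : R).
  split; first exact: (measurable_indic (measurable_box n)).
  rewrite (eq_integral (fun x => (\1_(box n) x)%:E)); last first.
    by move=> x _; rewrite indicE; case: (_ \in _); rewrite ?expr1n ?expr0n.
  rewrite integral_indic ?setIT//; [exact: box_finite|exact: measurable_box].
have := square_integrable_mul hf hi; apply: eq_integrable => //.
by move=> x _ /=; rewrite /trunc patchE indicE; case: ifP => _; rewrite ?mulr1 ?mulr0.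
Qed.

Lemma truncated_fourierE n f xi :
  truncated_fourier n f xi = (Fcos (trunc n f) xi, - Fsin (trunc n f) xi).
Proof.
rewrite /truncated_fourier /Fcos /Fsin; congr (_, - _); rewrite Rintegral_mkcond;
  apply: eq_Rintegral => x _; rewrite /trunc !patchE;
  by case: ifP => _; rewrite ?mul0r.
Qed.

Definition Fpair g xi : R * R := (Fcos g xi, - Fsin g xi).

Lemma sqmod_Fpair g xi : sqmod (Fpair g xi) = Fcos g xi ^+ 2 + Fsin g xi ^+ 2.
Proof. by rewrite /sqmod/= sqrrN. Qed.

Lemma measurable_Fpair g : L1 mu g ->
  measurable_fun setT (fun xi => (Fpair g xi).1) /\
  measurable_fun setT (fun xi => (Fpair g xi).2).
Proof.
move=> hg; split; first exact: measurable_Fcos.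
exact: (measurableT_comp (@oppr_measurable R setT) (measurable_Fsin hg)).
Qed.

Lemma measurable_truncated_fourier n f : L2 f ->
  measurable_fun setT (fun xi => (truncated_fourier n f xi).1) /\
  measurable_fun setT (fun xi => (truncated_fourier n f xi).2).
Proof.
move=> hf; have [h1 h2] := measurable_Fpair (L1_trunc n hf).
by split; [move: h1|move: h2]; apply: eq_measurable_fun => xi _; rewrite truncated_fourierE.
Qed.

Lemma FpairD f g (c : R) xi : L1 mu f -> L1 mu g ->
  Fpair (fun x => f x + c * g x) xi = Fpair f xi + (c * (Fpair g xi).1, c * (Fpair g xi).2).
Proof.
move=> hf hg; rewrite /Fpair /Fcos /Fsin.
have fc := L1_cos xi hf; have fs := L1_sin xi hf.
have gc := L1_cos xi hg; have gs := L1_sin xi hg.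
have -> : \int[mu]_x ((f x + c * g x) * cos (dot x xi)) =
    \int[mu]_x (f x * cos (dot x xi) + c * (g x * cos (dot x xi))).
  by apply: eq_Rintegral => x _; ring.
have -> : \int[mu]_x ((f x + c * g x) * sin (dot x xi)) =
    \int[mu]_x (f x * sin (dot x xi) + c * (g x * sin (dot x xi))).
  by apply: eq_Rintegral => x _; ring.
rewrite (RintD fc (L1Z c gc)) (RintD fs (L1Z c gs)) (RintZ _ gc) (RintZ _ gs).
by congr (_, _) => //=; ring.
Qed.

Lemma plancherel_sqmod g : L1 mu g -> square_integrable mu g ->
  (\int[mu]_xi (sqmod (Fpair g xi))%:E <= (4 * pi ^+ 2)%:E * \int[mu]_x (g x ^+ 2)%:E)%E.
Proof.
by move=> hg hg2; under eq_integral do rewrite sqmod_Fpair; exact: plancherel_le.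
Qed.

Lemma L2_Fpair g : L1 mu g -> square_integrable mu g ->
  L2 (fun xi => (Fpair g xi).1) /\ L2 (fun xi => (Fpair g xi).2).
Proof.
move=> hg hg2; have [m1 m2] := measurable_Fpair hg.
have foo : (\int[mu]_xi (sqmod (Fpair g xi))%:E < +oo)%E.
  apply: (le_lt_trans (plancherel_sqmod hg hg2)); apply: lte_mul_pinfty; last exact: hg2.2.
    by rewrite lee_fin mulr_ge0 ?sqr_ge0.
  exact: erefl.
have ms : measurable_fun setT (fun xi => (sqmod (Fpair g xi))%:E).
  by apply/measurable_EFinP; exact: measurable_sqmod.
split; split => //; apply: le_lt_trans foo; apply: ge0_le_integral.
- exact: measurableT.
- by move=> xi _; rewrite lee_fin sqr_ge0.
- by apply/measurable_EFinP; exact: (measurable_sqr m1).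
- exact: ms.
- by move=> xi _; rewrite lee_fin lerDl sqr_ge0.
- exact: measurableT.
- by move=> xi _; rewrite lee_fin sqr_ge0.
- by apply/measurable_EFinP; exact: (measurable_sqr m2).
- exact: ms.
- by move=> xi _; rewrite lee_fin lerDr sqr_ge0.
Qed.

(** On an integrable and square-integrable function the transform is given by
    the integral: what the truncation discards has a small transform by
    Plancherel's inequality. *)
Lemma is_fourier_Fpair g : L1 mu g -> square_integrable mu g -> is_fourier g (Fpair g).
Proof.
move=> hg hg2; have [l1 l2] := L2_Fpair hg hg2; split => //.
pose r n x := g x + (-1) * trunc n g x.
have hr n : L1 mu (r n) by apply: L1D => //; apply: L1Z; exact: L1_trunc.
have hr2 n : square_integrable mu (r n).
  by apply: square_integrableD => //; apply: square_integrableZ; exact: square_integrable_trunc.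
have bound n : (\int[mu]_xi (sqmod (truncated_fourier n g xi - Fpair g xi))%:E <=
    (4 * pi ^+ 2)%:E * \int[mu]_x (r n x ^+ 2)%:E)%E.
  apply: le_trans (plancherel_sqmod (hr n) (hr2 n)).
  rewrite le_eqVlt; apply/orP; left; apply/eqP; apply: eq_integral => xi _; congr EFin.
  rewrite truncated_fourierE (FpairD _ _ hg (L1_trunc n hg2)) /sqmod /=; ring.
have lim : \int[mu]_x (r n x ^+ 2) @[n --> \oo] --> \int[mu]_x (0:R).
  apply: (@cvg_Rint _ _ _ mu (fun n x => r n x ^+ 2) (fun=> 0) (fun x => g x ^+ 2)).
  - by move=> n; exact: (measurable_sqr (hr2 n).1).
  - move=> x; rewrite [X in _ --> X](_ : 0 = (g x + (-1) * g x) ^+ 2); last by ring.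
    by apply: cvgM; apply: cvgD; [exact: cvg_cst|apply: cvgM; [exact: cvg_cst|exact: trunc_cvg]|
      exact: cvg_cst|apply: cvgM; [exact: cvg_cst|exact: trunc_cvg]].
  - by have /square_integrableP[] := hg2.
  - move=> n x; rewrite ger0_norm ?sqr_ge0// /r /trunc patchE; case: ifP => _.
      by rewrite mulN1r subrr expr0n/= sqr_ge0.
    by rewrite mulr0 addr0.
rewrite Rintegral_cst// mul0r in lim.
apply: (@squeeze_cvge _ _ _ _ (fun=> 0%E) _ (fun n => (4 * pi ^+ 2)%:E * (\int[mu]_x (r n x ^+ 2))%:E)%E).
- apply: nearW => n; apply/andP; split.
    by apply: integral_ge0 => xi _; rewrite lee_fin sqmod_ge0.
  by have /square_integrableP[_ h] := hr2 n; rewrite -(L1_EFin h).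
- exact: cvg_cst.
- under eq_fun do rewrite -EFinM.
  apply: cvg_EFin; first exact: nearW.
  by rewrite -[X in _ --> X](mulr0 (4 * pi ^+ 2)); apply: cvgM; [exact: cvg_cst|exact: lim].
Qed.

Lemma is_fourierD f g (c : R) G H : L2 f -> L2 g -> is_fourier f G -> is_fourier g H ->
  is_fourier (fun x => f x + c * g x)
    (fun xi => G xi + (c * (H xi).1, c * (H xi).2)).
Proof.
move=> hf hg [G1 G2 Gc] [H1 H2 Hc]; split.
- exact: (square_integrableD G1 (square_integrableZ c H1)).
- exact: (square_integrableD G2 (square_integrableZ c H2)).
pose u n xi := truncated_fourier n f xi - G xi.
pose v n xi := truncated_fourier n g xi - H xi.
have [mu_ mv] : (forall n, measurable_fun setT (fun xi => sqmod (u n xi))) /\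
    (forall n, measurable_fun setT (fun xi => sqmod (v n xi))).
  split=> n; apply: measurable_sqmod.
  - exact: (measurable_funB (measurable_truncated_fourier n hf).1 G1.1).
  - exact: (measurable_funB (measurable_truncated_fourier n hf).2 G2.1).
  - exact: (measurable_funB (measurable_truncated_fourier n hg).1 H1.1).
  - exact: (measurable_funB (measurable_truncated_fourier n hg).2 H2.1).
have hfg : L2 (fun x => f x + c * g x) by exact: (square_integrableD hf (square_integrableZ c hg)).
pose w n xi := truncated_fourier n (fun x => f x + c * g x) xi -
   (G xi + (c * (H xi).1, c * (H xi).2)).
have wE n xi : w n xi = u n xi + (c * (v n xi).1, c * (v n xi).2).
  rewrite /w /u /v !truncated_fourierE.
  have := FpairD c xi (L1_trunc n hf) (L1_trunc n hg).
  rewrite (_ : (fun x => trunc n f x + c * trunc n g x) = trunc n (fun x => f x + c * g x)); last first.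
    by apply/funext => x; rewrite /trunc !patchE; case: ifP => _ //; rewrite mulr0 addr0.
  rewrite /Fpair => -[-> ->].
  by case: (G xi) (H xi) => [a1 a2] [b1 b2]; congr (_, _) => /=; ring.
have le_w n xi : sqmod (w n xi) <= 2 * sqmod (u n xi) + 2 * c ^+ 2 * sqmod (v n xi).
  rewrite wE (le_trans (sqmodD_le _ _))// lerD2l /sqmod/=.
  by rewrite le_eqVlt; apply/orP; left; apply/eqP; ring.
have mw n : measurable_fun setT (fun xi => sqmod (w n xi)).
  apply: measurable_sqmod.
  - exact: (measurable_funB (measurable_truncated_fourier n hfg).1
      (measurable_funD G1.1 (measurable_funM (measurable_cst c) H1.1))).
  - exact: (measurable_funB (measurable_truncated_fourier n hfg).2
      (measurable_funD G2.1 (measurable_funM (measurable_cst c) H2.1))).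
have le_int n : (\int[mu]_xi (sqmod (w n xi))%:E <=
    2%:E * \int[mu]_xi (sqmod (u n xi))%:E + (2 * c ^+ 2)%:E * \int[mu]_xi (sqmod (v n xi))%:E)%E.
  rewrite -ge0_integralZl_EFin//; last 2 first.
  - by move=> xi _; rewrite lee_fin sqmod_ge0.
  - by apply/measurable_EFinP.
  rewrite -ge0_integralZl_EFin//; last 3 first.
  - by move=> xi _; rewrite lee_fin sqmod_ge0.
  - by apply/measurable_EFinP.
  - by rewrite mulr_ge0// sqr_ge0.
  rewrite -ge0_integralD//; last 4 first.
  - by move=> xi _; rewrite -EFinM lee_fin mulr_ge0// sqmod_ge0.
  - by apply/measurable_EFinP; exact: (measurable_funM (measurable_cst _) (mu_ n)).
  - by move=> xi _; rewrite -EFinM lee_fin mulr_ge0 ?sqmod_ge0// mulr_ge0// sqr_ge0.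
  - by apply/measurable_EFinP; exact: (measurable_funM (measurable_cst _) (mv n)).
  apply: ge0_le_integral.
  - exact: measurableT.
  - by move=> xi _; rewrite lee_fin sqmod_ge0.
  - by apply/measurable_EFinP.
  - apply/measurable_EFinP; exact: (measurable_funD (measurable_funM (measurable_cst _) (mu_ n))
      (measurable_funM (measurable_cst _) (mv n))).
  - by move=> xi _; rewrite -!EFinM -EFinD lee_fin.
apply: (@squeeze_cvge _ _ _ _ (fun=> 0%E) _ (fun n =>
   2%:E * \int[mu]_xi (sqmod (u n xi))%:E + (2 * c ^+ 2)%:E * \int[mu]_xi (sqmod (v n xi))%:E)%E).
- apply: nearW => n; apply/andP; split; last exact: le_int.
  by apply: integral_ge0 => xi _; rewrite lee_fin sqmod_ge0.
- exact: cvg_cst.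
- rewrite -[X in _ --> X](adde0 0%E); apply: cvgeD => //.
    by rewrite -[X in _ --> X](mule0 2%:E); apply: cvgeZl.
  by rewrite -[X in _ --> X](mule0 (2 * c ^+ 2)%:E); apply: cvgeZl.
Qed.

(** Two transforms are mean-square limits of the same truncated transforms. *)
Lemma is_fourier_unique f G H : L2 f -> is_fourier f G -> is_fourier f H ->
  {ae mu, forall xi, G xi = H xi}.
Proof.
move=> hf [G1 G2 Gc] [H1 H2 Hc].
have mGH : measurable_fun setT (fun xi => sqmod (G xi - H xi)).
  by apply: measurable_sqmod; [exact: (measurable_funB G1.1 H1.1)|exact: (measurable_funB G2.1 H2.1)].
have GH0 : (\int[mu]_xi (sqmod (G xi - H xi))%:E = 0)%E.
  apply/eqP; rewrite eq_le integral_ge0 ?andbT; last by move=> xi _; rewrite lee_fin sqmod_ge0.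
  have lim : (2%:E * \int[mu]_xi (sqmod (truncated_fourier n f xi - G xi))%:E +
     2%:E * \int[mu]_xi (sqmod (truncated_fourier n f xi - H xi))%:E)%E @[n --> \oo] --> 0%E.
    rewrite -[X in _ --> X](adde0 0%E); apply: cvgeD => //;
      by rewrite -[X in _ --> X](mule0 2%:E); apply: cvgeZl.
  apply: (@cvge_to_ge _ _ _ _ _ _ _ lim); apply: nearW => n.
  have [m1 m2] := measurable_truncated_fourier n hf.
  have mA : measurable_fun setT (fun xi => sqmod (truncated_fourier n f xi - G xi)).
    by apply: measurable_sqmod; [exact: (measurable_funB m1 G1.1)|exact: (measurable_funB m2 G2.1)].
  have mB : measurable_fun setT (fun xi => sqmod (truncated_fourier n f xi - H xi)).
    by apply: measurable_sqmod; [exact: (measurable_funB m1 H1.1)|exact: (measurable_funB m2 H2.1)].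
  rewrite -ge0_integralZl_EFin//; last 2 first.
  - by move=> xi _; rewrite lee_fin sqmod_ge0.
  - by apply/measurable_EFinP.
  rewrite -ge0_integralZl_EFin//; last 2 first.
  - by move=> xi _; rewrite lee_fin sqmod_ge0.
  - by apply/measurable_EFinP.
  rewrite -ge0_integralD//; last 4 first.
  - by move=> xi _; rewrite -EFinM lee_fin mulr_ge0// sqmod_ge0.
  - by apply/measurable_EFinP; exact: (measurable_funM (measurable_cst _) mA).
  - by move=> xi _; rewrite -EFinM lee_fin mulr_ge0// sqmod_ge0.
  - by apply/measurable_EFinP; exact: (measurable_funM (measurable_cst _) mB).
  apply: ge0_le_integral.
  - exact: measurableT.
  - by move=> xi _; rewrite lee_fin sqmod_ge0.
  - by apply/measurable_EFinP.
  - apply/measurable_EFinP; exact: (measurable_funD (measurable_funM (measurable_cst _) mA)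
      (measurable_funM (measurable_cst _) mB)).
  - move=> xi _; rewrite -!EFinM -EFinD lee_fin.
    have -> : G xi - H xi = - (truncated_fourier n f xi - G xi) + (truncated_fourier n f xi - H xi).
      by rewrite opprB addrA subrK.
    by rewrite (le_trans (sqmodD_le _ _))// lerD2r /sqmod/= !sqrrN.
have := @ae_eq_integral_abs _ _ _ mu setT measurableT (fun xi => (sqmod (G xi - H xi))%:E).
move=> /(_ ((measurable_EFinP _ _).2 mGH))[+ _].
rewrite (eq_integral (fun xi => (sqmod (G xi - H xi))%:E)); last first.
  by move=> xi _; rewrite gee0_abs// lee_fin sqmod_ge0.
move=> /(_ GH0); apply: filterS => xi /(_ Logic.I) /= [].
rewrite /sqmod/= => /eqP; rewrite paddr_eq0 ?sqr_ge0// !sqrf_eq0 !subr_eq0.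
by case: (G xi) (H xi) => [a1 a2] [b1 b2] /= /andP[/eqP -> /eqP ->].
Qed.

Lemma fourierP f G : is_fourier f G -> is_fourier f (fourier f).
Proof. by move=> h; rewrite /fourier; apply: (@xgetPex _ (fun=> 0) [set g | is_fourier f g]); exists G. Qed.

(** [fourier f] is a choice among almost everywhere equal functions; integrals
    may be computed with any explicit transform. *)
Lemma integral_fourier f G (w : plane R -> R) : L2 f -> is_fourier f G ->
  measurable_fun setT w -> (forall xi, 0 <= w xi) ->
  (\int[mu]_xi (w xi * sqmod (fourier f xi))%:E = \int[mu]_xi (w xi * sqmod (G xi))%:E)%E.
Proof.
move=> hf hG mw w0; have hF := fourierP hG.
have meas H : is_fourier f H -> measurable_fun setT (fun xi => (w xi * sqmod (H xi))%:E).
  move=> [H1 H2 _]; apply/measurable_EFinP.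
  exact: (measurable_funM mw (measurable_sqmod H1.1 H2.1)).
apply: ge0_ae_eq_integral.
- exact: measurableT.
- exact: meas.
- exact: meas.
- by move=> xi _; rewrite lee_fin mulr_ge0 ?sqmod_ge0.
- by move=> xi _; rewrite lee_fin mulr_ge0 ?sqmod_ge0.
- by have := is_fourier_unique hf hF hG; apply: filterS => xi -> _.
Qed.

End fourier_theory.

(** * Fourier inversion *)
Section inversion.
Context {R : realType}.
Local Notation mu := (mu2 R).
Implicit Types (f g p : plane R -> R) (G H : plane R -> R * R) (x y : plane R).

(** The real part of the inverse Fourier transform. *)
Definition inverse_transform G x : R :=
  (4 * pi ^+ 2)^-1 * \int[mu]_xi ((G xi).1 * cos (dot x xi) - (G xi).2 * sin (dot x xi)).

Definition far_factor (r : R) : R := 1 + r^-1 ^+ 2.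

(** Away from the origin the kernel of small width [D] is [O(D)] times the kernel
    of width [1]. *)
Lemma poisson_far (D r u : R) : 0 < D -> 0 < r -> r <= `|u| ->
  poisson D u <= D * far_factor r * poisson 1 u.
Proof.
move=> D0 r0 ru.
have r2 : 1 <= r^-1 ^+ 2 * u ^+ 2.
  rewrite -exprMn -[leRHS]real_normK ?num_real// normrM ger0_norm ?invr_ge0 ?(ltW r0)//.
  by rewrite -[leLHS](expr1n _ 2) lerXn2r ?nnegrE ?mulr_ge0 ?invr_ge0 ?(ltW r0)// ler_pdivlMl// mulr1.
rewrite /poisson /far_factor expr1n mulr1 ler_pdivrMr ?D2u2_gt0//.
rewrite mulrA mulrAC ler_pdivlMr ?ltr_wpDr ?sqr_ge0//.
have sD : 0 <= r^-1 ^+ 2 * D ^+ 2 by rewrite mulr_ge0 ?sqr_ge0.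
have h : 1 + u ^+ 2 <= (1 + r^-1 ^+ 2) * (D ^+ 2 + u ^+ 2).
  by have := sqr_ge0 D; rewrite mulrDl mul1r mulrDr; lra.
have := ler_wpM2l (ltW (mulr_gt0 (ltr0Sn R 1) D0)) h.
by rewrite -!mulrA => /le_trans; apply; rewrite le_eqVlt; apply/orP; left; apply/eqP; ring.
Qed.

Definition far_kernel (D : R) (u : plane R) : R :=
  poisson 1 u.1 * poisson D u.2 + poisson D u.1 * poisson 1 u.2.

Lemma far_kernel_ge0 D u : 0 < D -> 0 <= far_kernel D u.
Proof.
by move=> D0; apply: addr_ge0; apply: mulr_ge0;
  solve [exact: (poisson_ge0 D0)|exact: (poisson_ge0 ltr01)].
Qed.

(** Away from the singularity the Poisson kernel of width [h ^+ 2] is of order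
    [h ^+ 2] in the mean, and its square is of order [h ^+ 2] as well: one factor
    is small and the other, at most of order [h ^- 2], integrates to a constant. *)
Lemma poisson2_far (h r : R) (u : plane R) : 0 < h -> 0 < r ->
  r <= `|u.1| \/ r <= `|u.2| ->
  poisson2 (h ^+ 2) u <= h ^+ 2 * far_factor r * far_kernel (h ^+ 2) u /\
  poisson2 (h ^+ 2) u ^+ 2 <= 4 * (h * far_factor r) ^+ 2 * far_kernel (h ^+ 2) u.
Proof.
move=> h0 r0; set D := h ^+ 2; have D0 : 0 < D by rewrite exprn_gt0.
set C := far_factor r; have C0 : 0 <= C by rewrite addr_ge0 ?sqr_ge0.
have p0 v : 0 <= poisson D v by exact: poisson_ge0.
have q0 (v : R) : 0 <= poisson 1 v by exact: poisson_ge0.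
have q2 (v : R) : poisson 1 v <= 2 by rewrite (le_trans (poisson_le _ v))// divr1.
have key (a b : R) : r <= `|a| ->
    poisson D a * poisson D b <= D * C * (poisson 1 a * poisson D b) /\
    (poisson D a * poisson D b) ^+ 2 <= 4 * (h * C) ^+ 2 * (poisson 1 a * poisson D b).
  move=> ra; have fa := poisson_far D0 r0 ra.
  have h1 : poisson D a * poisson D b <= D * C * (poisson 1 a * poisson D b).
    by rewrite mulrA ler_wpM2r.
  split => //.
  have pb := poisson_le D0 b.
  have h2 : poisson D a * poisson D b <= D * C * 2 * (2 / D).
    apply: ler_pM => //; apply: (le_trans fa); apply: ler_wpM2l; last exact: q2.
    by rewrite mulr_ge0// ltW.
  have -> : 4 * (h * C) ^+ 2 * (poisson 1 a * poisson D b) =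
      (D * C * 2 * (2 / D)) * (D * C * (poisson 1 a * poisson D b)).
    by rewrite /D; field; rewrite gt_eqF.
  by rewrite expr2 ler_pM// mulr_ge0.
have DC0 : 0 <= D * C by rewrite mulr_ge0// ltW.
have hC0 : 0 <= 4 * (h * C) ^+ 2 by rewrite mulr_ge0// sqr_ge0.
have K1 : poisson 1 u.1 * poisson D u.2 <= far_kernel D u by rewrite lerDl mulr_ge0.
have K2 : poisson 1 u.2 * poisson D u.1 <= far_kernel D u.
  by rewrite /far_kernel [leLHS]mulrC lerDr mulr_ge0.
case=> ru.
  have [k1 k2] := key u.1 u.2 ru; split.
    exact: (le_trans k1 (ler_wpM2l DC0 K1)).
  exact: (le_trans k2 (ler_wpM2l hC0 K1)).
have [k1 k2] := key u.2 u.1 ru; rewrite /poisson2 (mulrC (poisson D u.1)); split.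
  exact: (le_trans k1 (ler_wpM2l DC0 K2)).
exact: (le_trans k2 (ler_wpM2l hC0 K2)).
Qed.

Lemma L1_far_kernel D x : 0 < D -> L1 mu (fun y => far_kernel D (psub x y)).
Proof.
move=> D0; apply: L1D.
  exact: (L1_tensor (L1_poisson ltr01 x.1) (L1_poisson D0 x.2)).
exact: (L1_tensor (L1_poisson D0 x.1) (L1_poisson ltr01 x.2)).
Qed.

Lemma Rintegral_poisson D (a : R) : 0 < D -> \int[lebesgue_measure]_b poisson D (a - b) = 2 * pi.
Proof. by move=> D0; rewrite /Rintegral integral_poisson. Qed.

Lemma Rintegral_far_kernel D x : 0 < D ->
  \int[mu]_y far_kernel D (psub x y) = 8 * pi ^+ 2.
Proof.
move=> D0; have p1 a := L1_poisson (@ltr01 R) a; have pD a := L1_poisson D0 a.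
rewrite (RintD (L1_tensor (p1 x.1) (pD x.2)) (L1_tensor (pD x.1) (p1 x.2))).
rewrite (Rintegral_tensor (p1 x.1) (pD x.2)) (Rintegral_tensor (pD x.1) (p1 x.2)).
by rewrite !Rintegral_poisson//; ring.
Qed.

Lemma Rintegral_poisson2 D x : 0 < D -> \int[mu]_y poisson2 D (psub x y) = 4 * pi ^+ 2.
Proof. by move=> D0; rewrite /Rintegral integral_poisson2. Qed.

Lemma L1_mul_poisson2 D x f : 0 < D -> L2 f -> L1 mu (fun y => f y * poisson2 D (psub x y)).
Proof.
move=> D0 hf; apply: square_integrable_mul => //; apply/square_integrableP; split.
  exact: measurable_poisson2_slice2.
have := L1_mul_bounded (measurable_poisson2_slice2 D0 x) (fun y => poisson2_le D0 (psub x y))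
  (L1_poisson2 D0 x).
by apply: eq_integrable => // y _; rewrite /= expr2.
Qed.

Lemma continuous_plane f x (e : R) : {for x, continuous f} -> 0 < e ->
  exists2 r : R, 0 < r & forall y, `|x.1 - y.1| < r -> `|x.2 - y.2| < r -> `|f y - f x| <= e.
Proof.
move=> /cvgrPdist_le /(_ e) + e0 => /(_ e0) /nbhs_ballP[r /= r0 h].
by exists r => // y y1 y2; rewrite distrC; apply: h; split.
Qed.

(** Near [x] the function is close to [f x]; far from [x], the kernel is small
    both in mean and in mean square, and
    [|f| P <= h / 2 * f ^+ 2 + P ^+ 2 / (2 * h)] uses only that [f] is
    square-integrable. *)
Lemma poisson2_means_le f x (e r h : R) : L2 f -> 0 < r -> 0 < h -> 0 <= e ->
  (forall y, `|x.1 - y.1| < r -> `|x.2 - y.2| < r -> `|f y - f x| <= e) ->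
  `|\int[mu]_y (f y * poisson2 (h ^+ 2) (psub x y)) - 4 * pi ^+ 2 * f x| <=
  e * (4 * pi ^+ 2) + h * ((`|f x| * h * far_factor r + 2 * far_factor r ^+ 2) * (8 * pi ^+ 2)
     + 2^-1 * \int[mu]_y (f y ^+ 2)).
Proof.
move=> hf r0 h0 e0 fe; set D := h ^+ 2; have D0 : 0 < D by rewrite exprn_gt0.
set C := far_factor r; have C0 : 0 <= C by rewrite addr_ge0 ?sqr_ge0.
have hP := L1_poisson2 D0 x; have hfP := L1_mul_poisson2 x D0 hf.
have hK := L1_far_kernel x D0.
have /square_integrableP[mf hf2] := hf.
have -> : \int[mu]_y (f y * poisson2 D (psub x y)) - 4 * pi ^+ 2 * f x =
    \int[mu]_y (f y * poisson2 D (psub x y) - f x * poisson2 D (psub x y)).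
  by rewrite (RintB hfP (L1Z (f x) hP)) (RintZ _ hP) Rintegral_poisson2// [f x * _]mulrC.
rewrite -(Rintegral_poisson2 x D0).
set c := `|f x| * h * C + 2 * C ^+ 2.
have c0 : 0 <= c by rewrite addr_ge0 ?mulr_ge0 ?sqr_ge0// ltW.
have hd := L1B hfP (L1Z (f x) hP).
have hb1 := L1Z e hP; have hb2 := L1Z (h * c) hK; have hb3 := L1Z (h * 2^-1) hf2.
have hb := L1D hb1 (L1D hb2 hb3).
apply: (le_trans (le_normr_Rintegral measurableT hd)).
have -> : e * (\int[mu]_y poisson2 D (psub x y)) +
    h * (c * (8 * pi ^+ 2) + 2^-1 * \int[mu]_y (f y ^+ 2)) =
  \int[mu]_y (e * poisson2 D (psub x y) + (h * c * far_kernel D (psub x y) + h * 2^-1 * f y ^+ 2)).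
  rewrite (RintD hb1 (L1D hb2 hb3)) (RintD hb2 hb3) (RintZ _ hP) (RintZ _ hK) (RintZ _ hf2).
  by rewrite Rintegral_far_kernel//; ring.
apply: (le_Rint (L1_norm hd) hb) => y.
set P := poisson2 D (psub x y); set K := far_kernel D (psub x y).
have P0 : 0 <= P by exact: poisson2_ge0.
have K0 : 0 <= K by exact: far_kernel_ge0.
rewrite -mulrBl normrM (ger0_norm P0).
have f2 := sqr_ge0 (f y).
have tri : `|f y - f x| * P <= `|f y| * P + `|f x| * P.
  by rewrite -mulrDl ler_wpM2r// (le_trans (ler_normB _ _)).
have far_case : P <= D * C * K -> P ^+ 2 <= 4 * (h * C) ^+ 2 * K ->
    `|f y - f x| * P <= e * P + (h * c * K + h * 2^-1 * f y ^+ 2).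
  move=> far1 far2; apply: (le_trans tri).
  have a1 : `|f x| * P <= `|f x| * (D * C * K) by rewrite ler_wpM2l.
  have a2 : `|f y| * P <= h * 2^-1 * f y ^+ 2 + 2 * h * C ^+ 2 * K.
    have : 0 <= h * 2^-1 * (`|f y| - P / h) ^+ 2 by rewrite mulr_ge0 ?sqr_ge0// mulr_ge0// ltW.
    have -> : h * 2^-1 * (`|f y| - P / h) ^+ 2 =
        h * 2^-1 * f y ^+ 2 - `|f y| * P + (2 * h)^-1 * P ^+ 2.
      by rewrite sqrrB real_normK ?num_real//; field; rewrite gt_eqF.
    have : (2 * h)^-1 * P ^+ 2 <= 2 * h * C ^+ 2 * K.
      apply: (le_trans (ler_wpM2l _ far2)); first by rewrite invr_ge0 mulr_ge0// ltW.
      by rewrite le_eqVlt; apply/orP; left; apply/eqP; field; rewrite gt_eqF.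
    lra.
  have eP : 0 <= e * P by rewrite mulr_ge0.
  have -> : h * c * K = `|f x| * (D * C * K) + 2 * h * C ^+ 2 * K by rewrite /c /D; ring.
  lra.
case: (ltP `|x.1 - y.1| r) => y1; last first.
  by have [] := poisson2_far (u := psub x y) h0 r0 (or_introl y1); exact: far_case.
case: (ltP `|x.2 - y.2| r) => y2; last first.
  by have [] := poisson2_far (u := psub x y) h0 r0 (or_intror y2); exact: far_case.
have near_le : `|f y - f x| * P <= e * P by rewrite ler_wpM2r// fe.
have h1 : 0 <= h * c * K by rewrite mulr_ge0// mulr_ge0// ltW.
have h2 : 0 <= h * 2^-1 * f y ^+ 2 by rewrite mulr_ge0// mulr_ge0// ltW.
lra.
Qed.

Lemma poisson2_means_cvg f x : L2 f -> {for x, continuous f} ->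
  \int[mu]_y (f y * poisson2 (n.+1%:R^-1 ^+ 2) (psub x y)) @[n --> \oo] --> 4 * pi ^+ 2 * f x.
Proof.
move=> hf cf; apply/cvgrPdist_le => e e0.
have pi0 : 0 < 4 * pi ^+ 2 :> R by rewrite mulr_gt0// exprn_gt0// pi_gt0.
have e1 : 0 < e / 2 / (4 * pi ^+ 2) by rewrite !divr_gt0.
have [r r0 fe] := continuous_plane cf e1.
set C := (`|f x| * far_factor r + 2 * far_factor r ^+ 2) * (8 * pi ^+ 2)
     + 2^-1 * \int[mu]_y (f y ^+ 2).
have ff0 : 0 <= far_factor r by rewrite addr_ge0 ?sqr_ge0.
have C0 : 0 <= C.
  apply: addr_ge0; apply: mulr_ge0.
  - by rewrite addr_ge0// mulr_ge0// sqr_ge0.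
  - by rewrite mulr_ge0// sqr_ge0.
  - by rewrite invr_ge0.
  - by apply: Rintegral_ge0 => y _; rewrite sqr_ge0.
have lim : n.+1%:R^-1 * C @[n --> \oo] --> 0 * C.
  by apply: cvgM; [exact: cvg_harmonic|exact: cvg_cst].
rewrite mul0r in lim.
move/cvgrPdist_le : lim => /(_ _ (divr_gt0 e0 (ltr0Sn R 1))).
apply: filterS => n; rewrite sub0r normrN => hn; rewrite distrC.
have h0 : 0 < n.+1%:R^-1 :> R by rewrite invr_gt0.
have h1 : n.+1%:R^-1 <= 1 :> R by rewrite invf_le1// ler1n.
apply: (le_trans (poisson2_means_le hf r0 h0 (ltW e1) fe)).
rewrite divfK ?gt_eqF//; apply: (@le_trans _ _ (e / 2 + n.+1%:R^-1 * C)); last first.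
  by rewrite (le_trans (lerD (lexx _) (le_trans (ler_norm _) hn)))// -splitr.
apply: lerD; first exact: lexx.
apply: ler_wpM2l; first exact: ltW.
apply: lerD; last exact: lexx.
apply: ler_wpM2r; first by rewrite mulr_ge0// sqr_ge0.
apply: lerD; last exact: lexx.
by apply: ler_wpM2r => //; rewrite ler_piMr.
Qed.

(** Extension of [abel_means] from integrable to square-integrable functions.
    Both sides are continuous for the mean-square norm, on the left by
    Cauchy-Schwarz against [decay2 D], so that truncations suffice. *)
Lemma abel_means_fourier (D : R) f G x : 0 < D -> L2 f -> is_fourier f G ->
  \int[mu]_xi (decay2 D xi * ((G xi).1 * cos (dot x xi) - (G xi).2 * sin (dot x xi)))
  = \int[mu]_y (f y * poisson2 D (psub x y)).
Proof.
move=> D0 hf hG; have [G1 G2 Gc] := hG.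
pose T n := truncated_fourier n f.
pose I (H : plane R -> R * R) := \int[mu]_xi (decay2 D xi *
  ((H xi).1 * cos (dot x xi) - (H xi).2 * sin (dot x xi))).
have IT n : I (T n) = \int[mu]_y (trunc n f y * poisson2 D (psub x y)).
  rewrite -(abel_means D0 x (L1_trunc n hf)); apply: eq_Rintegral => xi _.
  by rewrite /T truncated_fourierE/=; ring.
have cvgR : I (T n) @[n --> \oo] --> \int[mu]_y (f y * poisson2 D (psub x y)).
  under eq_fun do rewrite IT.
  have hfP := L1_mul_poisson2 x D0 hf.
  apply: (@cvg_Rint _ _ _ mu _ _ (fun y => `|f y * poisson2 D (psub x y)|)).
  - by move=> n; exact: (measurable_funM (measurable_trunc n hf.1) (measurable_poisson2_slice2 D0 x)).
  - by move=> y; apply: cvgM; [exact: trunc_cvg|exact: cvg_cst].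
  - exact: L1_norm.
  - by move=> n y; rewrite !normrM ler_wpM2r// trunc_le.
apply: (cvg_unique _ _ cvgR) => //.
have hdec : L2 (decay2 D).
  apply/square_integrableP; split; first exact: measurable_decay2.
  apply: (le_L1 (measurable_sqr (measurable_decay2 D)) _ (L1_decay2 D0)) => xi.
  have d0 := ltW (decay2_gt0 D xi); have d1 := decay2_le1 D0 xi.
  by rewrite ger0_norm ?sqr_ge0// expr2 ler_piMr.
have mc : measurable_fun setT (fun xi => cos (dot x xi)) by exact: (measurable_slice2 x measurable_cos_dot).
have ms : measurable_fun setT (fun xi => sin (dot x xi)) by exact: (measurable_slice2 x measurable_sin_dot).
have hI (H : plane R -> R * R) : L2 (fun xi => (H xi).1) -> L2 (fun xi => (H xi).2) ->
    L1 mu (fun xi => decay2 D xi * ((H xi).1 * cos (dot x xi) - (H xi).2 * sin (dot x xi))).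
  move=> H1 H2; apply: square_integrable_mul => //.
  have b1 : L2 (fun xi => (H xi).1 * cos (dot x xi)).
    apply: (le_square_integrable (measurable_funM H1.1 mc) _ H1) => xi.
    by rewrite normrM ler_piMr// normr_cos_le1.
  have b2 : L2 (fun xi => (H xi).2 * sin (dot x xi)).
    apply: (le_square_integrable (measurable_funM H2.1 ms) _ H2) => xi.
    by rewrite normrM ler_piMr// normr_sin_le1.
  have := square_integrableD b1 (square_integrableZ (-1) b2).
  by under eq_fun do rewrite mulN1r.
have hT n : L2 (fun xi => (T n xi).1) /\ L2 (fun xi => (T n xi).2).
  have [t1 t2] := L2_Fpair (L1_trunc n hf) (square_integrable_trunc n hf).
  by split; [move: t1|move: t2]; rewrite /T; under [X in _ -> L2 X]eq_fun do rewrite truncated_fourierE.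
have hsq (H : plane R -> R * R) : L2 (fun xi => (H xi).1) -> L2 (fun xi => (H xi).2) ->
    L1 mu (fun xi => sqmod (H xi)).
  by move=> /square_integrableP[_ H1] /square_integrableP[_ H2]; exact: (L1D H1 H2).
pose d n xi := T n xi - G xi.
have hd n : L2 (fun xi => (d n xi).1) /\ L2 (fun xi => (d n xi).2).
  have [t1 t2] := hT n; split.
    have := square_integrableD t1 (square_integrableZ (-1) G1).
    by under eq_fun do rewrite mulN1r.
  have := square_integrableD t2 (square_integrableZ (-1) G2).
  by under eq_fun do rewrite mulN1r.
have Id n : I (T n) - I G = I (d n).
  rewrite /I -(RintB (hI _ (hT n).1 (hT n).2) (hI _ G1 G2)); apply: eq_Rintegral => xi _.
  by rewrite /d; case: (T n xi) (G xi) => [a1 a2] [b1 b2] /=; ring.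
have Ile n : `|I (d n)| ^+ 2 <= (\int[mu]_xi (decay2 D xi ^+ 2)) * (2 * \int[mu]_xi sqmod (d n xi)).
  have [d1 d2] := hd n.
  pose q xi := (d n xi).1 * cos (dot x xi) - (d n xi).2 * sin (dot x xi).
  have q2 xi : q xi ^+ 2 <= 2 * sqmod (d n xi).
    rewrite /q /sqmod; have := cos2Dsin2 (dot x xi).
    move: (cos _) (sin _) (d n xi).1 (d n xi).2 => a b u v ab.
    have -> : 2 * (u ^+ 2 + v ^+ 2) = 2 * ((u ^+ 2 + v ^+ 2) * (a ^+ 2 + b ^+ 2)) by rewrite ab mulr1.
    have := sqr_ge0 (u * b + v * a); have := sqr_ge0 (u * a - v * b); nra.
  have mq : measurable_fun setT q by exact: (measurable_funB (measurable_funM d1.1 mc) (measurable_funM d2.1 ms)).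
  have hs := hsq _ d1 d2.
  have hq : L2 q.
    apply/square_integrableP; split => //; apply: (le_L1 (measurable_sqr mq) _ (L1Z 2 hs)) => xi.
    by rewrite ger0_norm ?sqr_ge0.
  have /square_integrableP[_ hq2] := hq.
  have hdq := square_integrable_mul hdec hq.
  have cs := cauchy_schwarz hdec hq.
  apply: (@le_trans _ _ ((\int[mu]_xi `|decay2 D xi * q xi|) ^+ 2)).
    rewrite lerXn2r ?nnegrE ?normr_ge0//; last exact: (le_normr_Rintegral measurableT hdq).
    by apply: Rintegral_ge0 => xi _.
  apply: (le_trans cs); apply: ler_wpM2l; first by apply: Rintegral_ge0 => xi _; rewrite sqr_ge0.
  by rewrite -(RintZ 2 hs); exact: (le_Rint hq2 (L1Z 2 hs) q2).
have lim0 : \int[mu]_xi sqmod (d n xi) @[n --> \oo] --> 0.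
  apply: fine_cvg; exact: Gc.
set E := \int[mu]_xi (decay2 D xi ^+ 2) in Ile.
have limE : E * (2 * \int[mu]_xi sqmod (d n xi)) @[n --> \oo] --> E * (2 * 0).
  by apply: cvgM; [exact: cvg_cst|apply: cvgM; [exact: cvg_cst|exact: lim0]].
rewrite !mulr0 in limE.
apply/cvgrPdist_le => e e0.
move/cvgrPdist_le : limE => /(_ _ (exprn_gt0 2 e0)).
apply: filterS => n; rewrite sub0r normrN => hn; rewrite distrC -/(I G) Id.
rewrite -(@ler_pXn2r _ 2) ?nnegrE ?normr_ge0 ?(ltW e0)//.
by rewrite (le_trans (Ile n))// (le_trans (ler_norm _) hn).
Qed.

(** The Abel means of the transform tend to [f x] because the Poisson kernel
    concentrates at the origin, and to the inverse transform of [G] by dominated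
    convergence. *)
Lemma fourier_inversion f G x : L2 f -> {for x, continuous f} -> is_fourier f G ->
  L1 mu (fun xi => (G xi).1) -> L1 mu (fun xi => (G xi).2) ->
  f x = inverse_transform G x.
Proof.
move=> hf cf hG G1 G2.
have pi0 : 4 * pi ^+ 2 != 0 :> R by rewrite mulf_neq0// expf_neq0// gt_eqF// pi_gt0.
apply: (mulfI pi0); rewrite /inverse_transform mulVKf//.
have lim := poisson2_means_cvg hf cf.
apply: (cvg_unique _ lim) => //.
have hh n : 0 < n.+1%:R^-1 ^+ 2 :> R by rewrite exprn_gt0// invr_gt0.
have e : (fun n => \int[mu]_y (f y * poisson2 (n.+1%:R^-1 ^+ 2) (psub x y))) =
    (fun n => \int[mu]_xi (decay2 (n.+1%:R^-1 ^+ 2) xi *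
      ((G xi).1 * cos (dot x xi) - (G xi).2 * sin (dot x xi)))).
  by apply/funext => n; rewrite (abel_means_fourier x (hh n) hf hG).
rewrite /= e {e}.
have mc : measurable_fun setT (fun xi => cos (dot x xi)) by exact: (measurable_slice2 x measurable_cos_dot).
have ms : measurable_fun setT (fun xi => sin (dot x xi)) by exact: (measurable_slice2 x measurable_sin_dot).
have hc := L1_mul_bounded mc (fun xi => normr_cos_le1 (dot x xi)) G1.
have hs := L1_mul_bounded ms (fun xi => normr_sin_le1 (dot x xi)) G2.
have hcs := L1B hc hs.
apply: (@cvg_Rint _ _ _ mu _ _ (fun xi => `|(G xi).1 * cos (dot x xi) - (G xi).2 * sin (dot x xi)|)).
- by move=> n; exact: (measurable_funM (measurable_decay2 _) (L1_measurable hcs)).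
- move=> xi; rewrite -[X in _ --> X]mul1r; apply: cvgM; last exact: cvg_cst.
  have dl t : decay (n.+1%:R^-1 ^+ 2) t @[n --> \oo] --> (1:R).
    have h : - (n.+1%:R^-1 ^+ 2 * `|t|) @[n --> \oo] --> - (0 * 0 * `|t|).
      apply: cvgN; apply: cvgM; last exact: cvg_cst.
      by apply: cvgM; exact: cvg_harmonic.
    rewrite !mul0r oppr0 in h.
    by have := cvg_comp _ _ h (@continuous_expR R 0); rewrite expR0.
  by rewrite -[X in _ --> X]mulr1; apply: cvgM; exact: dl.
- exact: (L1_norm hcs).
- move=> n xi; rewrite normrM ler_piMl// ger0_norm ?(ltW (decay2_gt0 _ _))//.
  exact: decay2_le1.
Qed.

End inversion.

(** * Functions with bounded derivatives in the scaled variables *)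
Section regularity.
Context {R : realType}.
Local Notation mu := (mu2 R).
Implicit Types (f g : plane R -> R) (p : plane R) (b : bool) (k : nat).

(** Both variables are treated at once: [true] stands for the first one and
    [false] for the second one. *)
Definition slice b f p : R -> R := if b then fun x => f (x, p.2) else fun y => f (p.1, y).
Definition coord b p : R := if b then p.1 else p.2.
Definition shift b p (t : R) : plane R := if b then (t, p.2) else (p.1, t).

Lemma sliceE b f p t : slice b f p t = f (shift b p t).
Proof. by case: b. Qed.

Lemma shift_coord b p : shift b p (coord b p) = p.
Proof. by case: b p => -[]. Qed.

Lemma slice_coord b f p : slice b f p (coord b p) = f p.
Proof. by rewrite sliceE shift_coord. Qed.

Lemma slice_shift b f p t : slice b f (shift b p t) = slice b f p.
Proof. by case: b. Qed.

Lemma coord_shift b p t : coord b (shift b p t) = t.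
Proof. by case: b. Qed.

Definition partial_derivable b f := forall p, derivable (slice b f p) (coord b p) 1.

Lemma partial_derivable_slice b f p t : partial_derivable b f -> derivable (slice b f p) t 1.
Proof. by move=> /(_ (shift b p t)); rewrite slice_shift coord_shift. Qed.

Variable s : R.

Definition scale b : R := if b then 1 else s.

(** The derivatives [dx] and [s * dy]: with [s ^+ 2 = eps] these are the two
    derivations that the norms of [H^s_eps] count. *)
Definition sder b f p : R := scale b * derive1 (slice b f p) (coord b p).

Lemma sder_dx f : sder true f = dx f.
Proof. by apply/funext => p; rewrite /sder /dx/= mul1r. Qed.

Lemma sder_dy f : sder false f = fun p => s * dy f p.
Proof. by apply/funext => p; rewrite /sder /dy/=. Qed.

Lemma sderE b f p (l : R) : is_derive (coord b p) (1:R) (slice b f p) l ->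
  sder b f p = scale b * l.
Proof. by move=> h; rewrite /sder derive1E derive_val. Qed.

Lemma is_derive_slice b f p t : partial_derivable b f ->
  is_derive t (1:R) (slice b f p) (derive1 (slice b f p) t).
Proof.
move=> h; have h' := @partial_derivable_slice b f p t h.
by rewrite derive1E; exact: DeriveDef.
Qed.

Lemma partial_derivableD b f g : partial_derivable b f -> partial_derivable b g ->
  partial_derivable b (fun p => f p + g p).
Proof.
move=> hf hg p; have := derivableD (hf p) (hg p).
by rewrite /slice; case: b {hf hg}.
Qed.

Lemma partial_derivableM b f g : partial_derivable b f -> partial_derivable b g ->
  partial_derivable b (fun p => f p * g p).
Proof.
move=> hf hg p; have := derivableM (hf p) (hg p).
by rewrite /slice; case: b {hf hg}.
Qed.

Lemma partial_derivable_cst b (c : R) : partial_derivable b (fun=> c).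
Proof. by move=> p; rewrite /slice; case: b; exact: derivable_cst. Qed.

Lemma partial_derivableZ b (c : R) f : partial_derivable b f ->
  partial_derivable b (fun p => c * f p).
Proof. by move=> hf; apply: partial_derivableM => //; exact: partial_derivable_cst. Qed.

Lemma sderD b f g : partial_derivable b f -> partial_derivable b g ->
  sder b (fun p => f p + g p) = fun p => sder b f p + sder b g p.
Proof.
move=> hf hg; apply/funext => p.
have df := is_derive_slice p (coord b p) hf; have dg := is_derive_slice p (coord b p) hg.
rewrite /sder -mulrDr; apply: sderE.
have -> : slice b (fun p => f p + g p) p = slice b f p \+ slice b g p.
  by apply/funext => t; rewrite /= !sliceE.
by apply: is_derive_eq.
Qed.

Lemma sderM b f g : partial_derivable b f -> partial_derivable b g ->
  sder b (fun p => f p * g p) = fun p => sder b f p * g p + f p * sder b g p.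
Proof.
move=> hf hg; apply/funext => p.
have df := is_derive_slice p (coord b p) hf; have dg := is_derive_slice p (coord b p) hg.
have d : is_derive (coord b p) (1:R) (slice b (fun p => f p * g p) p)
    (derive1 (slice b f p) (coord b p) * g p + f p * derive1 (slice b g p) (coord b p)).
  have -> : slice b (fun p => f p * g p) p = slice b f p * slice b g p.
    by apply/funext => t; rewrite fctE !sliceE.
  apply: is_derive_eq.
  by rewrite /GRing.scale/= !slice_coord; ring.
by rewrite (sderE d) /sder; ring.
Qed.

Lemma sder_cst b (c : R) : sder b (fun=> c) = fun=> 0.
Proof.
apply/funext => p; rewrite -[RHS](mulr0 (scale b)); apply: sderE.
have -> : slice b (fun=> c) p = cst c by apply/funext => t; rewrite sliceE.
exact: is_derive_cst.
Qed.

Lemma sderZ b (c : R) f : partial_derivable b f ->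
  sder b (fun p => c * f p) = fun p => c * sder b f p.
Proof.
move=> hf; rewrite sderM//; last exact: partial_derivable_cst.
by apply/funext => p; rewrite sder_cst mul0r add0r.
Qed.

(** Bounds in the supremum norm and in the norm of order zero of [H^s_eps]. *)
Definition bounded2 (B : R) f := [/\ measurable_fun setT f, forall p, `|f p| <= B &
  (\int[mu]_p (f p ^+ 2)%:E <= (B ^+ 2 * s)%:E)%E].

(** The same constant bounds all derivatives, in any order of derivation. *)
Fixpoint smooth k (B : R) f : Prop :=
  bounded2 B f /\
  if k is k'.+1 then forall b, partial_derivable b f /\ smooth k' B (sder b f) else True.

(** The transform of an integrable function is given by an integral, which can be
    integrated by parts. *)
Fixpoint integrable_derivatives k f : Prop :=
  L1 mu f /\ if k is k'.+1 then forall b, integrable_derivatives k' (sder b f) else True.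

Lemma smooth_bounded2 k B f : smooth k B f -> bounded2 B f.
Proof. by case: k => [|k] []. Qed.

Lemma smooth_measurable k B f : smooth k B f -> measurable_fun setT f.
Proof. by move/smooth_bounded2 => []. Qed.

Lemma smooth_le k B f p : smooth k B f -> `|f p| <= B.
Proof. by move/smooth_bounded2 => []. Qed.

Lemma smooth_ge0 k B f : smooth k B f -> 0 <= B.
Proof. by move/(@smooth_le _ _ _ (0, 0)); exact: le_trans. Qed.

Lemma smooth_L2 k B f : smooth k B f -> L2 f.
Proof. by move/smooth_bounded2 => [mf _ h]; split => //; exact: (le_lt_trans h (ltry _)). Qed.

Lemma smooth_derivable k B f b : smooth k.+1 B f -> partial_derivable b f.
Proof. by case=> _ /(_ b) []. Qed.

Lemma smooth_sder k B f b : smooth k.+1 B f -> smooth k B (sder b f).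
Proof. by case=> _ /(_ b) []. Qed.

Lemma smoothS k B f : smooth k.+1 B f -> smooth k B f.
Proof.
elim: k f => [|k IH] f [bf df]; split => // b.
by have [h1 h2] := df b; split => //; exact: IH.
Qed.

Lemma smooth_leq k k' B f : (k' <= k)%N -> smooth k B f -> smooth k' B f.
Proof.
move=> /subnK <-; elim: (k - k')%N => [//|n IH] h; apply: IH.
by apply: smoothS; rewrite -addSn.
Qed.

Hypothesis s_ge0 : 0 <= s.

Lemma bounded2W B B' f : B <= B' -> bounded2 B f -> bounded2 B' f.
Proof.
move=> BB' [mf fB f2].
have B0 : 0 <= B by apply: (le_trans _ (fB (0, 0))).
split => //; first by move=> p; exact: (le_trans (fB p)).
by rewrite (le_trans f2)// lee_fin ler_wpM2r// lerXn2r ?nnegrE// (le_trans B0).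
Qed.

Lemma smoothW k B B' f : B <= B' -> smooth k B f -> smooth k B' f.
Proof.
move=> BB'; elim: k f => [|k IH] f [bf df]; (split; first exact: bounded2W bf); first by [].
move=> b; have [h1 h2] := df b; split => //; exact: IH.
Qed.

Lemma bounded2D B C f g : bounded2 B f -> bounded2 C g ->
  bounded2 (2 * (B + C)) (fun p => f p + g p).
Proof.
move=> [mf fB f2] [mg gC g2].
have B0 : 0 <= B by apply: (le_trans _ (fB (0, 0))).
have C0 : 0 <= C by apply: (le_trans _ (gC (0, 0))).
split; first exact: measurable_funD.
  move=> p; rewrite (le_trans (ler_normD _ _))// (le_trans (lerD (fB p) (gC p)))//; lra.
have m2 := measurable_sqr mf; have n2 := measurable_sqr mg.
apply: (@le_trans _ _ (\int[mu]_p ((2 * f p ^+ 2)%:E + (2 * g p ^+ 2)%:E))%E).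
  apply: ge0_le_integral.
  - exact: measurableT.
  - by move=> p _; rewrite lee_fin sqr_ge0.
  - by apply/measurable_EFinP; exact: (measurable_sqr (measurable_funD mf mg)).
  - by apply/measurable_EFinP; exact: (measurable_funD (measurable_funM (measurable_cst _) m2)
      (measurable_funM (measurable_cst _) n2)).
  - by move=> p _; rewrite -EFinD lee_fin; have := sqr_ge0 (f p - g p); nra.
rewrite ge0_integralD; last 5 first.
- exact: measurableT.
- by move=> p _; rewrite lee_fin mulr_ge0// sqr_ge0.
- by apply/measurable_EFinP; exact: (measurable_funM (measurable_cst _) m2).
- by move=> p _; rewrite lee_fin mulr_ge0// sqr_ge0.
- by apply/measurable_EFinP; exact: (measurable_funM (measurable_cst _) n2).
under eq_integral do rewrite EFinM.
under [X in (_ + X)%E]eq_integral do rewrite EFinM.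
rewrite ge0_integralZl_EFin//; last 2 first.
- by move=> p _; rewrite lee_fin sqr_ge0.
- by apply/measurable_EFinP.
rewrite ge0_integralZl_EFin//; last 2 first.
- by move=> p _; rewrite lee_fin sqr_ge0.
- by apply/measurable_EFinP.
apply: (@le_trans _ _ (2%:E * (B ^+ 2 * s)%:E + 2%:E * (C ^+ 2 * s)%:E)%E).
  by apply: leeD; apply: lee_wpmul2l => //; rewrite lee_fin.
rewrite -!EFinM -EFinD lee_fin !mulrA -mulrDl ler_wpM2r//.
have := mulr_ge0 B0 C0; have := sqr_ge0 B; have := sqr_ge0 C; nra.
Qed.

Lemma bounded2Z B (c : R) f : bounded2 B f -> bounded2 (`|c| * B) (fun p => c * f p).
Proof.
move=> [mf fB f2]; split; first exact: measurable_funM.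
  by move=> p; rewrite normrM ler_wpM2l.
under eq_integral do rewrite exprMn EFinM.
rewrite ge0_integralZl_EFin ?sqr_ge0//; last 2 first.
- by move=> p _; rewrite lee_fin sqr_ge0.
- by apply/measurable_EFinP; exact: measurable_sqr.
rewrite exprMn real_normK ?num_real// -mulrA [leRHS]EFinM.
by apply: lee_wpmul2l => //; rewrite lee_fin sqr_ge0.
Qed.

Lemma bounded2M B C f g : bounded2 B f -> bounded2 C g ->
  bounded2 (B * C) (fun p => f p * g p).
Proof.
move=> [mf fB f2] [mg gC g2].
have C0 : 0 <= C by apply: (le_trans _ (gC (0, 0))).
split; first exact: measurable_funM.
  by move=> p; rewrite normrM ler_pM.
apply: (@le_trans _ _ (\int[mu]_p ((C ^+ 2)%:E * (f p ^+ 2)%:E))%E).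
  apply: ge0_le_integral.
  - exact: measurableT.
  - by move=> p _; rewrite lee_fin sqr_ge0.
  - by apply/measurable_EFinP; exact: (measurable_sqr (measurable_funM mf mg)).
  - by apply/measurable_EFinP; exact: (measurable_funM (measurable_cst _) (measurable_sqr mf)).
  - move=> p _; rewrite -EFinM lee_fin exprMn mulrC ler_wpM2r ?sqr_ge0//.
    by rewrite -[leLHS]real_normK ?num_real// lerXn2r ?nnegrE.
rewrite ge0_integralZl_EFin ?sqr_ge0//; last 2 first.
- by move=> p _; rewrite lee_fin sqr_ge0.
- by apply/measurable_EFinP; exact: measurable_sqr.
rewrite exprMn mulrAC mulrC [leRHS]EFinM.
by apply: lee_wpmul2l => //; rewrite lee_fin sqr_ge0.
Qed.

Lemma smoothD k B C f g : smooth k B f -> smooth k C g ->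
  smooth k (2 * (B + C)) (fun p => f p + g p).
Proof.
elim: k f g => [|k IH] f g [bf df] [bg dg]; split; try exact: bounded2D; first by [].
move=> b; have [f1 f2] := df b; have [g1 g2] := dg b; split.
  exact: partial_derivableD.
by rewrite sderD//; exact: IH.
Qed.

Lemma smoothZ k B (c : R) f : smooth k B f -> smooth k (`|c| * B) (fun p => c * f p).
Proof.
elim: k f => [|k IH] f [bf df]; split; try exact: bounded2Z; first by [].
move=> b; have [f1 f2] := df b; split; first exact: partial_derivableZ.
by rewrite sderZ//; exact: IH.
Qed.

(** Leibniz' rule doubles the number of terms at each derivation, and each sum
    costs another factor [2]. *)
Lemma smoothM k B C f g : smooth k B f -> smooth k C g ->
  smooth k (4 ^+ k * (B * C)) (fun p => f p * g p).
Proof.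
elim: k f g => [|k IH] f g hf hg.
  by case: hf hg => bf _ [bg _]; split => //; rewrite expr0 mul1r; exact: bounded2M.
have B0 := smooth_ge0 hf; have C0 := smooth_ge0 hg.
have [bf df] := hf; have [bg dg] := hg.
split.
  apply: bounded2W (bounded2M bf bg).
  by rewrite -[leLHS]mul1r ler_wpM2r ?mulr_ge0// exprn_ege1// ler1n.
move=> b; have [f1 f2] := df b; have [g1 g2] := dg b; split.
  exact: partial_derivableM.
rewrite sderM//; have := smoothD (IH _ _ f2 (smoothS hg)) (IH _ _ (smoothS hf) g2).
by apply: smoothW; rewrite le_eqVlt; apply/orP; left; apply/eqP; rewrite exprS; ring.
Qed.

Lemma integrable_derivatives_L1 k f : integrable_derivatives k f -> L1 mu f.
Proof. by case: k => [|k] []. Qed.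

Lemma integrable_derivatives_sder k f b :
  integrable_derivatives k.+1 f -> integrable_derivatives k (sder b f).
Proof. by case=> _ /(_ b). Qed.

Lemma integrable_derivativesD k B C f g : smooth k B f -> smooth k C g ->
  integrable_derivatives k f -> integrable_derivatives k g ->
  integrable_derivatives k (fun p => f p + g p).
Proof.
elim: k f g => [|k IH] f g hf hg [if1 if2] [ig1 ig2]; split; try exact: L1D; first by [].
move=> b; rewrite sderD; [|exact: smooth_derivable hf|exact: smooth_derivable hg].
by apply: IH; [exact: smooth_sder|exact: smooth_sder|exact: if2|exact: ig2].
Qed.

Lemma integrable_derivativesZ k B (c : R) f : smooth k B f ->
  integrable_derivatives k f -> integrable_derivatives k (fun p => c * f p).
Proof.
elim: k f => [|k IH] f hf [if1 if2]; split; try exact: L1Z; first by [].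
move=> b; rewrite sderZ; last exact: smooth_derivable hf.
by apply: IH; [exact: smooth_sder|exact: if2].
Qed.

(** Products of square-integrable functions are integrable. *)
Lemma integrable_derivativesM k B C f g : smooth k B f -> smooth k C g ->
  integrable_derivatives k (fun p => f p * g p).
Proof.
elim: k f g => [|k IH] f g hf hg; split;
  try exact: (square_integrable_mul (smooth_L2 hf) (smooth_L2 hg)); first by [].
move=> b; rewrite sderM; [|exact: smooth_derivable hf|exact: smooth_derivable hg].
have f1 := smooth_sder b hf; have g1 := smooth_sder b hg.
apply: integrable_derivativesD; [exact: smoothM f1 (smoothS hg)|exact: smoothM (smoothS hf) g1| |].
- exact: IH f1 (smoothS hg).
- exact: IH (smoothS hf) g1.
Qed.

Lemma smooth0 k : smooth k 0 (fun=> 0).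
Proof.
have b0 : bounded2 0 (fun=> 0).
  split; first exact: measurable_cst.
    by move=> p; rewrite normr0.
  by under eq_integral do rewrite expr0n/=; rewrite integral0 expr0n/= mul0r.
elim: k => [|k IH]; split => // b; split; first exact: partial_derivable_cst.
by rewrite sder_cst.
Qed.

Lemma integrable_derivatives0 k : integrable_derivatives k (fun=> 0).
Proof.
have l0 : L1 mu (fun=> 0) by exact: integrable0.
by elim: k => [|k IH]; split => // b; rewrite sder_cst.
Qed.

End regularity.

(** * From decay of the transform to bounded derivatives *)
Section spectral.
Context {R : realType}.
Local Notation mu := (mu2 R).
Implicit Types (p x xi : plane R) (G : plane R -> R * R) (b : bool) (k : nat).
Variable s : R.
Hypothesis s_gt0 : 0 < s.

Definition weight xi : R := 1 + xi.1 ^+ 2 + (s * xi.2) ^+ 2.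

Lemma weight_ge1 xi : 1 <= weight xi.
Proof. by rewrite /weight -addrA lerDl addr_ge0 ?sqr_ge0. Qed.

Lemma weight_gt0 xi : 0 < weight xi.
Proof. exact: lt_le_trans ltr01 (weight_ge1 xi). Qed.

Lemma measurable_fst_plane : measurable_fun setT (fun xi : plane R => xi.1).
Proof. exact: measurable_fst. Qed.

Lemma measurable_snd_plane : measurable_fun setT (fun xi : plane R => xi.2).
Proof. exact: measurable_snd. Qed.

Lemma measurable_weight : measurable_fun setT weight.
Proof.
apply: measurable_funD; first apply: measurable_funD; first exact: measurable_cst.
  exact: (measurable_sqr measurable_fst_plane).
exact: (measurable_sqr (measurable_funM (measurable_cst s) measurable_snd_plane)).
Qed.

Lemma measurable_weightX k : measurable_fun setT (fun xi => weight xi ^+ k).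
Proof. exact: (measurable_funX k measurable_weight). Qed.

(** The factor [s] on the right accounts for the factor [eps^(-1/2)] of the norms of
    [H^s_eps]. *)
Definition spectral k (M : R) G := [/\ measurable_fun setT (fun xi => (G xi).1),
  measurable_fun setT (fun xi => (G xi).2) &
  (\int[mu]_xi (weight xi ^+ k * sqmod (G xi))%:E <= (M ^+ 2 * s)%:E)%E].

Lemma spectral_measurable k M G : spectral k M G ->
  measurable_fun setT (fun xi => weight xi ^+ k * sqmod (G xi)).
Proof.
by move=> [m1 m2 _]; exact: (measurable_funM (measurable_weightX k) (measurable_sqmod m1 m2)).
Qed.

Lemma spectral_le k k' M G G' : spectral k M G ->
  measurable_fun setT (fun xi => (G' xi).1) -> measurable_fun setT (fun xi => (G' xi).2) ->
  (forall xi, weight xi ^+ k' * sqmod (G' xi) <= weight xi ^+ k * sqmod (G xi)) ->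
  spectral k' M G'.
Proof.
move=> hG m1 m2 le_G; split => //; have [_ _ h] := hG.
apply: le_trans h; apply: ge0_le_integral.
- exact: measurableT.
- by move=> xi _; rewrite lee_fin mulr_ge0 ?sqmod_ge0// exprn_ge0// ltW// weight_gt0.
- by apply/measurable_EFinP; exact: (measurable_funM (measurable_weightX k') (measurable_sqmod m1 m2)).
- by apply/measurable_EFinP; exact: (spectral_measurable hG).
- by move=> xi _; rewrite lee_fin.
Qed.

Lemma spectral_leq k k' M G : (k' <= k)%N -> spectral k M G -> spectral k' M G.
Proof.
move=> kk hG; have [m1 m2 _] := hG; apply: (spectral_le hG) => // xi.
by rewrite ler_wpM2r ?sqmod_ge0// ler_weXn2l// weight_ge1.
Qed.

Lemma spectral_L1 k M G : spectral k M G -> L1 mu (fun xi => weight xi ^+ k * sqmod (G xi)).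
Proof.
move=> hG; have [_ _ h] := hG; apply: L1_ge0.
- exact: (spectral_measurable hG).
- by move=> xi; rewrite mulr_ge0 ?sqmod_ge0// exprn_ge0// ltW// weight_gt0.
- exact: (le_lt_trans h (ltry _)).
Qed.

Lemma spectral_L2 k M G (q : plane R -> R) : spectral k.*2 M G -> measurable_fun setT q ->
  (forall xi, q xi ^+ 2 <= sqmod (G xi)) -> L2 (fun xi => weight xi ^+ k * q xi).
Proof.
move=> hG mq le_q.
have m := measurable_funM (measurable_weightX k) mq.
apply/square_integrableP; split => //.
apply: (le_L1 (measurable_sqr m) _ (spectral_L1 hG)) => xi.
rewrite ger0_norm ?sqr_ge0// exprMn -exprM muln2 ler_wpM2l//.
by rewrite exprn_ge0// ltW// weight_gt0.
Qed.

Lemma le_sqmod1 (z : R * R) : z.1 ^+ 2 <= sqmod z.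
Proof. by rewrite lerDl sqr_ge0. Qed.

Lemma le_sqmod2 (z : R * R) : z.2 ^+ 2 <= sqmod z.
Proof. by rewrite lerDr sqr_ge0. Qed.

Let D := s^-1.
Let D_gt0 : 0 < D. Proof. by rewrite invr_gt0. Qed.

(** The square of the inverse weight is dominated by a product of two Poisson
    kernels, of widths [1] and [s^-1]. *)
Let weight_tensor xi : weight xi ^- 2 <= (2^-1 * poisson 1 xi.1) * ((2 * s)^-1 * poisson D xi.2).
Proof.
have h : 0 < (1 + xi.1 ^+ 2) * (1 + (s * xi.2) ^+ 2).
  by rewrite mulr_gt0// ltr_wpDr ?sqr_ge0.
have -> : (2^-1 * poisson 1 xi.1) * ((2 * s)^-1 * poisson D xi.2) =
    ((1 + xi.1 ^+ 2) * (1 + (s * xi.2) ^+ 2))^-1.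
  have d1 : 1 + xi.1 ^+ 2 != 0 by rewrite gt_eqF// ltr_wpDr ?sqr_ge0.
  have d2 : 1 + (s * xi.2) ^+ 2 != 0 by rewrite gt_eqF// ltr_wpDr ?sqr_ge0.
  rewrite /poisson /D expr1n.
  have -> : s^-1 ^+ 2 + xi.2 ^+ 2 = (1 + (s * xi.2) ^+ 2) / s ^+ 2 by field; rewrite gt_eqF.
  by field; rewrite d1 d2 gt_eqF.
rewrite lef_pV2 ?posrE ?exprn_gt0 ?weight_gt0//.
have := sqr_ge0 xi.1; have := sqr_ge0 (s * xi.2); rewrite /weight; nra.
Qed.

Let L1_tensor1 : L1 mu (fun xi => (2^-1 * poisson 1 xi.1) * ((2 * s)^-1 * poisson D xi.2)).
Proof.
have h (C : R) : 0 < C -> L1 lebesgue_measure (poisson C).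
  move=> C0; have := L1_poisson C0 0; apply: eq_integrable => // u _ /=.
  by rewrite sub0r poissonN.
exact: (L1_tensor (L1Z 2^-1 (h 1 ltr01)) (L1Z (2 * s)^-1 (h D D_gt0))).
Qed.

Lemma measurable_weightV k : measurable_fun setT (fun xi => weight xi ^- k).
Proof.
have mr : measurable_fun setT (fun r : R => (1 + r ^+ 2)^-1).
  apply: continuous_measurable_fun => r.
  apply: cvgV; first by rewrite gt_eqF// ltr_wpDr ?sqr_ge0.
  by apply: cvgD; [exact: cvg_cst|apply: cvgM; exact: cvg_id].
have mn : measurable_fun setT (fun xi : plane R => Num.sqrt (xi.1 ^+ 2 + (s * xi.2) ^+ 2)).
  apply: measurableT_comp; first by apply: continuous_measurable_fun; exact: sqrt_continuous.
  apply: measurable_funD; first exact: (measurable_sqr measurable_fst_plane).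
  exact: (measurable_sqr (measurable_funM (measurable_cst s) measurable_snd_plane)).
have := measurable_funX k (measurableT_comp mr mn).
congr measurable_fun; apply/funext => xi /=.
by rewrite sqr_sqrtr ?addr_ge0 ?sqr_ge0// addrA exprVn.
Qed.

Lemma L2_weightV : L2 (fun xi => weight xi ^- 1).
Proof.
apply/square_integrableP; split; first exact: measurable_weightV.
apply: (le_L1 (measurable_sqr (measurable_weightV 1)) _ L1_tensor1) => xi.
by rewrite ger0_norm ?sqr_ge0// expr1 exprVn weight_tensor.
Qed.

Lemma Rintegral_weightV : \int[mu]_xi ((weight xi ^- 1) ^+ 2) <= pi ^+ 2 / s.
Proof.
have h (C : R) : 0 < C -> L1 lebesgue_measure (poisson C) /\
    \int[lebesgue_measure]_u poisson C u = 2 * pi.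
  move=> C0; rewrite -(Rintegral_poisson 0 C0); split.
    by have := L1_poisson C0 0; apply: eq_integrable => // u _ /=; rewrite sub0r poissonN.
  by apply: eq_Rintegral => u _; rewrite sub0r poissonN.
have [p1 e1] := h 1 ltr01; have [pD eD] := h D D_gt0.
have /square_integrableP[_ hw] := L2_weightV.
have := le_Rint hw L1_tensor1.
rewrite (Rintegral_tensor (L1Z 2^-1 p1) (L1Z (2 * s)^-1 pD)) (RintZ _ p1) (RintZ _ pD) e1 eD.
have -> : 2^-1 * (2 * pi) * ((2 * s)^-1 * (2 * pi)) = pi ^+ 2 / s :> R.
  by field; rewrite gt_eqF.
by apply => xi; rewrite expr1 exprVn weight_tensor.
Qed.

(** Cauchy-Schwarz against the integrable weight: two orders of regularity
    control the integral of the transform, uniformly in [s]. *)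
Lemma spectral_integrable M G (q : plane R -> R) : spectral 2 M G -> measurable_fun setT q ->
  (forall xi, q xi ^+ 2 <= sqmod (G xi)) ->
  L1 mu q /\ (\int[mu]_xi `|q xi|) ^+ 2 <= pi ^+ 2 * M ^+ 2.
Proof.
move=> hG mq le_q; have hq := @spectral_L2 1 _ _ _ hG mq le_q.
have hw := L2_weightV.
have qE xi : weight xi ^- 1 * (weight xi ^+ 1 * q xi) = q xi.
  by rewrite !expr1 mulKf// gt_eqF// weight_gt0.
split.
  by have := square_integrable_mul hw hq; under eq_fun do rewrite qE.
have := cauchy_schwarz hw hq; under eq_Rintegral do rewrite qE.
move/le_trans; apply.
have /square_integrableP[_ hq2] := hq.
have -> : pi ^+ 2 * M ^+ 2 = (pi ^+ 2 / s) * (M ^+ 2 * s) by field; rewrite gt_eqF.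
apply: ler_pM; first by apply: Rintegral_ge0 => xi _; rewrite sqr_ge0.
- by apply: Rintegral_ge0 => xi _; rewrite sqr_ge0.
- exact: Rintegral_weightV.
rewrite -lee_fin -(L1_EFin hq2); have [_ _ h] := hG; apply: le_trans h.
apply: ge0_le_integral.
- exact: measurableT.
- by move=> xi _; rewrite lee_fin sqr_ge0.
- by apply/measurable_EFinP; exact: L1_measurable hq2.
- by apply/measurable_EFinP; exact: (spectral_measurable hG).
- by move=> xi _; rewrite lee_fin exprMn expr1 ler_wpM2l ?sqr_ge0.
Qed.

Lemma spectral_L1_1 M G : spectral 2 M G -> L1 mu (fun xi => (G xi).1).
Proof.
by move=> hG; have [m1 _ _] := hG; have [] := spectral_integrable hG m1 (fun xi => le_sqmod1 _).
Qed.

Lemma spectral_L1_2 M G : spectral 2 M G -> L1 mu (fun xi => (G xi).2).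
Proof.
by move=> hG; have [_ m2 _] := hG; have [] := spectral_integrable hG m2 (fun xi => le_sqmod2 _).
Qed.

Lemma dotC x xi : dot x xi = dot xi x.
Proof. by rewrite /dot; ring. Qed.

Lemma inverse_transformE G x :
  L1 mu (fun xi => (G xi).1) -> L1 mu (fun xi => (G xi).2) ->
  inverse_transform G x = (4 * pi ^+ 2)^-1 *
    (Fcos (fun xi => (G xi).1) x - Fsin (fun xi => (G xi).2) x).
Proof.
move=> h1 h2; rewrite /inverse_transform /Fcos /Fsin -(RintB (L1_cos x h1) (L1_sin x h2)).
by congr (_ * _); apply: eq_Rintegral => xi _; rewrite dotC.
Qed.

Lemma measurable_cos_slice x : measurable_fun setT (fun xi => cos (dot x xi)).
Proof. exact: (measurable_slice2 x measurable_cos_dot). Qed.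

Lemma measurable_sin_slice x : measurable_fun setT (fun xi => sin (dot x xi)).
Proof. exact: (measurable_slice2 x measurable_sin_dot). Qed.

Lemma pi2_ge1 : 1 <= pi ^+ 2 :> R.
Proof. by rewrite expr_ge1 ?pi_ge0// (le_trans _ (pi_ge2 R))// ler1n. Qed.

Lemma inverse_transform_le M G x : 0 <= M -> spectral 2 M G -> `|inverse_transform G x| <= M.
Proof.
move=> M0 hG; have [m1 m2 _] := hG.
pose q xi := (G xi).1 * cos (dot x xi) - (G xi).2 * sin (dot x xi).
have mq : measurable_fun setT q.
  exact: (measurable_funB (measurable_funM m1 (measurable_cos_slice x))
    (measurable_funM m2 (measurable_sin_slice x))).
have le_q xi : q xi ^+ 2 <= sqmod (G xi).
  rewrite /q /sqmod; have := cos2Dsin2 (dot x xi).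
  move: (cos _) (sin _) (G xi).1 (G xi).2 => a b u v ab.
  have -> : u ^+ 2 + v ^+ 2 = (u ^+ 2 + v ^+ 2) * (a ^+ 2 + b ^+ 2) by rewrite ab mulr1.
  by have := sqr_ge0 (u * b + v * a); nra.
have [hq q2] := spectral_integrable hG mq le_q.
have le1 : `|\int[mu]_xi q xi| <= pi * M.
  have piM : 0 <= pi * M by rewrite mulr_ge0// pi_ge0.
  rewrite -(@ler_pXn2r _ 2) ?nnegrE ?normr_ge0//.
  rewrite exprMn; apply: le_trans q2; rewrite lerXn2r ?nnegrE ?normr_ge0//.
    by apply: Rintegral_ge0 => xi _.
  exact: (le_normr_Rintegral measurableT hq).
have c0 : 0 < 4 * pi ^+ 2 :> R by rewrite mulr_gt0// exprn_gt0// pi_gt0.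
rewrite /inverse_transform -/q normrM ger0_norm ?invr_ge0 ?(ltW c0)//.
rewrite ler_pdivrMl//; apply: (le_trans le1); apply: ler_wpM2r => //.
by have := pi_ge2 R; nra.
Qed.

Lemma inverse_transform_L2 M G : spectral 2 M G ->
  measurable_fun setT (inverse_transform G) /\
  (\int[mu]_x (inverse_transform G x ^+ 2)%:E <= (M ^+ 2 * s)%:E)%E.
Proof.
move=> hG; have h1 := spectral_L1_1 hG; have h2 := spectral_L1_2 hG.
have [m1 m2 _] := hG.
have hG0 := spectral_leq (isT : (0 <= 2)%N) hG.
have l1 := @spectral_L2 0 _ _ _ hG0 m1 (fun xi => le_sqmod1 _).
have l2 := @spectral_L2 0 _ _ _ hG0 m2 (fun xi => le_sqmod2 _).
have {}l1 : square_integrable mu (fun xi => (G xi).1).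
  by move: l1; under [X in L2 X -> _]eq_fun do rewrite expr0 mul1r.
have {}l2 : square_integrable mu (fun xi => (G xi).2).
  by move: l2; under [X in L2 X -> _]eq_fun do rewrite expr0 mul1r.
have E : inverse_transform G = fun x => (4 * pi ^+ 2)^-1 *
    (Fcos (fun xi => (G xi).1) x - Fsin (fun xi => (G xi).2) x).
  by apply/funext => x; rewrite inverse_transformE.
have mc1 := measurable_Fcos h1; have ms1 := measurable_Fsin h1.
have mc2 := measurable_Fcos h2; have ms2 := measurable_Fsin h2.
have mi : measurable_fun setT (inverse_transform G).
  by rewrite E; exact: (measurable_funM (measurable_cst _) (measurable_funB mc1 ms2)).
split => //.
have P1 := plancherel_le h1 l1; have P2 := plancherel_le h2 l2.
set c : R := 4 * pi ^+ 2 in P1 P2.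
have c0 : 0 < c by rewrite mulr_gt0// exprn_gt0// pi_gt0.
have c2 : 2 <= c by have := pi2_ge1; rewrite /c; lra.
pose A x := Fcos (fun xi => (G xi).1) x ^+ 2 + Fsin (fun xi => (G xi).1) x ^+ 2.
pose B x := Fcos (fun xi => (G xi).2) x ^+ 2 + Fsin (fun xi => (G xi).2) x ^+ 2.
have mA : measurable_fun setT A by exact: (measurable_funD (measurable_sqr mc1) (measurable_sqr ms1)).
have mB : measurable_fun setT B by exact: (measurable_funD (measurable_sqr mc2) (measurable_sqr ms2)).
have A0 x : 0 <= A x by rewrite addr_ge0 ?sqr_ge0.
have B0 x : 0 <= B x by rewrite addr_ge0 ?sqr_ge0.
apply: (@le_trans _ _ (\int[mu]_x ((2 / c ^+ 2)%:E * (A x + B x)%:E))%E).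
  apply: ge0_le_integral.
  - exact: measurableT.
  - by move=> x _; rewrite lee_fin sqr_ge0.
  - by apply/measurable_EFinP; exact: measurable_sqr.
  - by apply/measurable_EFinP; exact: (measurable_funM (measurable_cst _) (measurable_funD mA mB)).
  - move=> x _; rewrite -EFinM lee_fin E exprMn exprVn -/c [2 / _]mulrC -mulrA.
    apply: ler_wpM2l; first by rewrite invr_ge0 sqr_ge0.
    rewrite /A /B; move: (Fcos _ x) (Fsin _ x) (Fcos _ x) (Fsin _ x) => u v w t.
    have := sqr_ge0 (w + t); have := sqr_ge0 u; have := sqr_ge0 v; nra.
rewrite ge0_integralZl_EFin; last 4 first.
- exact: measurableT.
- by move=> x _; rewrite lee_fin addr_ge0.
- by apply/measurable_EFinP; exact: (measurable_funD mA mB).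
- by rewrite mulr_ge0// invr_ge0 sqr_ge0.
under eq_integral do rewrite EFinD.
rewrite ge0_integralD; last 5 first.
- exact: measurableT.
- by move=> x _; rewrite lee_fin.
- by apply/measurable_EFinP.
- by move=> x _; rewrite lee_fin.
- by apply/measurable_EFinP.
have mg1 : measurable_fun setT (fun xi => ((G xi).1 ^+ 2)%:E) by apply/measurable_EFinP; exact: measurable_sqr.
have mg2 : measurable_fun setT (fun xi => ((G xi).2 ^+ 2)%:E) by apply/measurable_EFinP; exact: measurable_sqr.
apply: (@le_trans _ _ ((2 / c ^+ 2)%:E * (c%:E * \int[mu]_xi (sqmod (G xi))%:E))%E).
  apply: lee_wpmul2l; first by rewrite lee_fin mulr_ge0// invr_ge0 sqr_ge0.
  have -> : (\int[mu]_xi (sqmod (G xi))%:E =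
      \int[mu]_xi ((G xi).1 ^+ 2)%:E + \int[mu]_xi ((G xi).2 ^+ 2)%:E)%E.
    rewrite -ge0_integralD//.
    - by move=> xi _; rewrite lee_fin sqr_ge0.
    - by move=> xi _; rewrite lee_fin sqr_ge0.
  rewrite ge0_muleDr; last 2 first.
  - by apply: integral_ge0 => xi _; rewrite lee_fin sqr_ge0.
  - by apply: integral_ge0 => xi _; rewrite lee_fin sqr_ge0.
  exact: leeD.
rewrite muleA -EFinM (_ : 2 / c ^+ 2 * c = 2 / c); last by field; rewrite gt_eqF.
have [_ _ h0] := hG0.
have c1 : ((2 / c)%:E <= 1%:E)%E by rewrite lee_fin ler_pdivrMr// mul1r.
apply: le_trans h0; under [leRHS]eq_integral do rewrite expr0 mul1r.
rewrite -[leRHS]mul1e; apply: lee_wpmul2r => //.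
by apply: integral_ge0 => xi _; rewrite lee_fin sqmod_ge0.
Qed.

Lemma spectral_bounded2 M G : 0 <= M -> spectral 2 M G -> bounded2 s M (inverse_transform G).
Proof.
move=> M0 hG; have [m h] := inverse_transform_L2 hG; split => // x.
exact: inverse_transform_le.
Qed.

(** The Fourier multiplier [i * scale b * xi_b] of the derivation [sder s b]. *)
Definition symbol b G xi : R * R :=
  (- (scale s b * coord b xi * (G xi).2), scale s b * coord b xi * (G xi).1).

Lemma measurable_symbol b G : measurable_fun setT (fun xi => (G xi).1) ->
  measurable_fun setT (fun xi => (G xi).2) ->
  measurable_fun setT (fun xi => (symbol b G xi).1) /\
  measurable_fun setT (fun xi => (symbol b G xi).2).
Proof.
move=> m1 m2.
have mb : measurable_fun setT (fun xi : plane R => scale s b * coord b xi).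
  by apply: measurable_funM; [exact: measurable_cst|case: b; [exact: measurable_fst|exact: measurable_snd]].
split; last exact: (measurable_funM mb m1).
exact: (measurableT_comp (@oppr_measurable R setT) (measurable_funM mb m2)).
Qed.

Lemma sqmod_symbol b G xi :
  sqmod (symbol b G xi) = (scale s b * coord b xi) ^+ 2 * sqmod (G xi).
Proof. by rewrite /sqmod /symbol/=; ring. Qed.

Lemma coord_le_weight b xi : (scale s b * coord b xi) ^+ 2 <= weight xi.
Proof.
have := sqr_ge0 xi.1; have := sqr_ge0 (s * xi.2).
by case: b; rewrite /weight /scale /coord ?mul1r; lra.
Qed.

Lemma spectral_symbol b k M G : spectral k.+1 M G -> spectral k M (symbol b G).
Proof.
move=> hG; have [m1 m2 _] := hG; have [n1 n2] := measurable_symbol b m1 m2.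
apply: (spectral_le hG) => // xi.
rewrite sqmod_symbol [weight _ ^+ _.+1]exprSr mulrA ler_wpM2r ?sqmod_ge0// ler_wpM2l ?coord_le_weight//.
by rewrite exprn_ge0// ltW// weight_gt0.
Qed.

Lemma scale_gt0 b : 0 < scale s b.
Proof. by case: b. Qed.

Lemma dot_shift b p (t : R) xi :
  dot (shift b p t) xi = t * coord b xi + dot (shift b p 0) xi.
Proof. by case: b; rewrite /dot/=; ring. Qed.

(** Differentiation under the integral sign; the third order of decay makes the
    symbol of the derivative integrable. *)
Lemma is_derive_inverse_transform b M G p t : spectral 3 M G ->
  is_derive t (1:R) (slice b (inverse_transform G) p)
    ((scale s b)^-1 * inverse_transform (symbol b G) (shift b p t)).
Proof.
move=> hG; have [m1 m2 _] := hG.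
have hG2 := spectral_leq (isT : (2 <= 3)%N) hG.
have hS := spectral_symbol b hG.
have g1 := spectral_L1_1 hG2; have g2 := spectral_L1_2 hG2.
have s1 := spectral_L1_1 hS; have s2 := spectral_L1_2 hS.
pose f (r : R) xi := (G xi).1 * cos (dot (shift b p r) xi) - (G xi).2 * sin (dot (shift b p r) xi).
pose f' (r : R) xi := (scale s b)^-1 * ((symbol b G xi).1 * cos (dot (shift b p r) xi)
  - (symbol b G xi).2 * sin (dot (shift b p r) xi)).
pose bd xi := (scale s b)^-1 * (`|(symbol b G xi).1| + `|(symbol b G xi).2|).
have sb0 := scale_gt0 b.
have df r xi : is_derive r (1:R) (f^~ xi) (f' r xi).
  have dd : is_derive r (1:R) (fun u : R => dot (shift b p u) xi) (coord b xi).
    rewrite (_ : (fun u : R => _) = (fun u => u * coord b xi + dot (shift b p 0) xi)).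
      by apply: is_derive_eq; rewrite /GRing.scale/=; ring.
    by apply/funext => u; rewrite dot_shift.
  have dc : is_derive r (1:R) (fun u : R => cos (dot (shift b p u) xi))
      (- sin (dot (shift b p r) xi) * coord b xi).
    by apply: (@is_derive1_comp _ cos (fun u => dot (shift b p u) xi)).
  have ds : is_derive r (1:R) (fun u : R => sin (dot (shift b p u) xi))
      (cos (dot (shift b p r) xi) * coord b xi).
    by apply: (@is_derive1_comp _ sin (fun u => dot (shift b p u) xi)).
  rewrite /f; apply: is_derive_eq.
  rewrite /f' /symbol /GRing.scale/=; field; rewrite gt_eqF//.
have d1 r xi : partial1of2 f r xi = f' r xi.
  by rewrite partial1of2E; have d := df r xi; rewrite derive_val.
have fint r : L1 mu (f r).
  apply: L1B.
    exact: (L1_mul_bounded (measurable_cos_slice _) (fun xi => normr_cos_le1 _) g1).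
  exact: (L1_mul_bounded (measurable_sin_slice _) (fun xi => normr_sin_le1 _) g2).
have bdint : L1 mu bd by apply: L1Z; exact: (L1D (L1_norm s1) (L1_norm s2)).
have bd0 xi : 0 <= bd xi by rewrite mulr_ge0 ?addr_ge0// invr_ge0 ltW.
have f'_le r xi : `|f' r xi| <= bd xi.
  rewrite /f' /bd normrM ger0_norm ?invr_ge0 ?(ltW sb0)// ler_wpM2l ?invr_ge0 ?(ltW sb0)//.
  rewrite (le_trans (ler_normB _ _))// !normrM lerD// ler_piMr//.
    exact: normr_cos_le1.
  exact: normr_sin_le1.
have tI : `]t - 1, t + 1[%classic t by rewrite /= in_itv/=; lra.
have der := @derivable_under_integral _ _ _ mu f setT measurableT t (t - 1) (t + 1) tI
  (fun r _ => fint r) (fun r xi _ _ => @ex_derive _ _ _ _ _ _ _ (df r xi)) bd bd0 bdint.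
have dif := @differentiation_under_integral _ _ _ mu f setT measurableT t (t - 1) (t + 1) tI
  (fun r _ => fint r) (fun r xi _ _ => @ex_derive _ _ _ _ _ _ _ (df r xi)) bd bd0 bdint.
have le1 : forall (r : R) xi, `]t - 1, t + 1[%classic r -> [set: plane R] xi ->
    `|partial1of2 f r xi| <= bd xi by move=> r xi _ _; rewrite d1.
have {}der := der le1; have {}dif := dif le1.
have dF : is_derive t (1:R) (fun r => \int[mu]_xi f r xi) (\int[mu]_xi f' t xi).
  apply: DeriveDef => //; rewrite -derive1E dif.
  by apply: eq_Rintegral => xi _; exact: d1.
have sliceE' : slice b (inverse_transform G) p = fun r => (4 * pi ^+ 2)^-1 * \int[mu]_xi f r xi.
  by apply/funext => r; rewrite sliceE.
rewrite sliceE'; apply: is_derive_eq; rewrite /GRing.scale/=.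
have hS' : L1 mu (fun xi => (symbol b G xi).1 * cos (dot (shift b p t) xi)
  - (symbol b G xi).2 * sin (dot (shift b p t) xi)).
  apply: L1B.
    exact: (L1_mul_bounded (measurable_cos_slice _) (fun xi => normr_cos_le1 _) s1).
  exact: (L1_mul_bounded (measurable_sin_slice _) (fun xi => normr_sin_le1 _) s2).
by rewrite /f' (RintZ _ hS') /inverse_transform; ring.
Qed.

Lemma sder_inverse_transform b M G : spectral 3 M G ->
  partial_derivable b (inverse_transform G) /\
  sder s b (inverse_transform G) = inverse_transform (symbol b G).
Proof.
move=> hG; split.
  by move=> p; have := is_derive_inverse_transform b p (coord b p) hG.
apply/funext => p; have d := is_derive_inverse_transform b p (coord b p) hG.
by rewrite (sderE s d) mulrA mulfV ?gt_eqF ?scale_gt0// mul1r shift_coord.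
Qed.

Lemma spectral_smooth k M G : 0 <= M -> spectral k.+2 M G ->
  smooth s k M (inverse_transform G).
Proof.
move=> M0; elim: k G => [|k IH] G hG.
  by split => //; exact: spectral_bounded2.
split; first by apply: spectral_bounded2 => //; exact: spectral_leq hG.
move=> b; have [d e] := sder_inverse_transform b (spectral_leq (isT : (3 <= k.+3)%N) hG).
by split => //; rewrite e; apply: IH; exact: spectral_symbol.
Qed.

End spectral.

(** * From bounded derivatives to decay of the transform *)
Section integral_of_derivative.
Context {R : realType}.
Local Notation leb := (@lebesgue_measure R).
Local Notation mu := (mu2 R).
Implicit Types (f g : plane R -> R) (p xi : plane R) (b : bool) (k : nat).

(** A cutoff that tends to [1] as [h] tends to [0], with a derivative bounded by
    [h]. *)
Definition cutoff (h x : R) : R := (1 + (h * x) ^+ 2)^-1.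

Definition cutoff' (h x : R) : R := - (2 * h * (h * x)) * cutoff h x ^+ 2.

Lemma cutoff_den (h x : R) : 0 < 1 + (h * x) ^+ 2.
Proof. by rewrite ltr_wpDr ?sqr_ge0. Qed.

Lemma is_derive_cutoff (h x : R) : is_derive x (1:R) (cutoff h) (cutoff' h x).
Proof.
have dd : is_derive x (1:R) (fun y : R => 1 + (h * y) ^+ 2) (2 * h * (h * x)).
  by apply: is_derive_eq; rewrite /GRing.scale/=; ring.
have d0 : 1 + (h * x) ^+ 2 != 0 by rewrite gt_eqF// cutoff_den.
have := @is_deriveV _ (fun y : R => 1 + (h * y) ^+ 2) x _ 1 d0 dd.
rewrite (_ : - _ *: _ = cutoff' h x)//.
by rewrite /cutoff' /cutoff /GRing.scale/=; field.
Qed.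

Lemma cutoff_ge0 h x : 0 <= cutoff h x.
Proof. by rewrite invr_ge0 ltW// cutoff_den. Qed.

Lemma cutoff_le1 h x : cutoff h x <= 1.
Proof. by rewrite invf_le1 ?cutoff_den// lerDl sqr_ge0. Qed.

Lemma cutoff'_le h x : 0 <= h -> `|cutoff' h x| <= h.
Proof.
move=> h0; rewrite /cutoff' normrM normrN [X in _ * X]ger0_norm ?sqr_ge0//.
have -> : 2 * h * (h * x) = h * (2 * (h * x)) by ring.
rewrite normrM ger0_norm// -mulrA ler_piMr//.
have den := cutoff_den h x; have c1 := cutoff_le1 h x; have c0 := cutoff_ge0 h x.
have a1 : `|2 * (h * x)| * cutoff h x <= 1.
  rewrite /cutoff ler_pdivrMr// mul1r ler_norml; apply/andP; split.
    by have := sqr_ge0 (1 + h * x); nra.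
  by have := sqr_ge0 (1 - h * x); nra.
have m0 : 0 <= `|2 * (h * x)| * cutoff h x by exact: mulr_ge0.
by rewrite expr2 [leLHS]mulrA; exact: (mulr_ile1 m0 c0 a1 c1).
Qed.

Lemma continuous_cutoff h : continuous (cutoff h).
Proof.
by move=> x; apply: differentiable_continuous; apply/derivable1_diffP; have := is_derive_cutoff h x.
Qed.

Lemma continuous_cutoff' h : continuous (cutoff' h).
Proof.
move=> x; apply: cvgM; last by apply: cvgM; exact: continuous_cutoff.
by apply: cvgN; apply: cvgM; [exact: cvg_cst|apply: cvgM; [exact: cvg_cst|exact: cvg_id]].
Qed.

Lemma cutoff_cvg0 h (u : nat -> R) : 0 < h -> (forall m, `|u m| = m%:R) ->
  cutoff h (u m) @[m --> \oo] --> 0.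
Proof.
move=> h0 um; pose C := 2 + h ^- 2.
have lim : C * m.+1%:R^-1 @[m --> \oo] --> C * 0.
  by apply: cvgM; [exact: cvg_cst|exact: cvg_harmonic].
rewrite mulr0 in lim; apply: (squeeze_cvgr _ (cvg_cst 0) lim); apply: nearW => m.
rewrite cutoff_ge0/= /cutoff -ler_pdivrMr ?invr_gt0 ?ltr0Sn// invrK.
rewrite mulrC ler_pdivrMr ?cutoff_den// exprMn -[u m ^+ 2]real_normK ?num_real// um.
have m0 : 0 <= m%:R :> R by [].
rewrite /C -natr1; set t := m%:R in m0 *.
have -> : (2 + h ^- 2) * (1 + h ^+ 2 * t ^+ 2) = 2 + t ^+ 2 + h ^- 2 + 2 * (h ^+ 2 * t ^+ 2).
  by field; rewrite gt_eqF.
have : 0 <= h ^- 2 by rewrite invr_ge0 sqr_ge0.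
have : 0 <= h ^+ 2 * t ^+ 2 by rewrite mulr_ge0 ?sqr_ge0.
have := sqr_ge0 (t - 1); nra.
Qed.

(** The integral of [(f * cutoff h)'] vanishes because [f] is bounded and the
    cutoff tends to [0] at infinity; then [h] tends to [0]. *)
Lemma integral_line_derivative (f f' : R -> R) (B : R) : continuous f' ->
  (forall x, is_derive x (1:R) f (f' x)) -> (forall x, `|f x| <= B) ->
  L1 leb f -> L1 leb f' -> \int[leb]_x f' x = 0.
Proof.
move=> cf' df fB hf hf'.
have cf : continuous f.
  by move=> x; apply: differentiable_continuous; apply/derivable1_diffP; have := df x.
have mc h : measurable_fun setT (cutoff h).
  by apply: continuous_measurable_fun; exact: continuous_cutoff.
have mc' h : measurable_fun setT (cutoff' h).
  by apply: continuous_measurable_fun; exact: continuous_cutoff'.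
have h1 h : L1 leb (fun x => f' x * cutoff h x).
  apply: (@L1_mul_bounded _ _ _ _ _ _ 1); [exact: mc| |exact: hf'].
  by move=> x; rewrite ger0_norm ?cutoff_ge0// cutoff_le1.
have h2 h : 0 <= h -> L1 leb (fun x => f x * cutoff' h x).
  move=> h0; apply: (@L1_mul_bounded _ _ _ _ _ _ h); [exact: mc'| |exact: hf].
  by move=> x; exact: cutoff'_le.
have byparts h : 0 < h -> \int[leb]_x (f' x * cutoff h x) = - \int[leb]_x (f x * cutoff' h x).
  move=> h0; have h2h := h2 h (ltW h0).
  have dfc x : is_derive x (1:R) (fun x => f x * cutoff h x) (f' x * cutoff h x + f x * cutoff' h x).
    have d1 := df x; have d2 := is_derive_cutoff h x.
    by apply: is_derive_eq; rewrite /GRing.scale/=; ring.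
  have cfc : continuous (fun x => f' x * cutoff h x + f x * cutoff' h x).
    move=> x; apply: cvgD; apply: cvgM.
    - exact: cf'.
    - exact: continuous_cutoff.
    - exact: cf.
    - exact: continuous_cutoff'.
  have lim (u : nat -> R) : (forall m, `|u m| = m%:R) -> f (u m) * cutoff h (u m) @[m --> \oo] --> 0.
    move=> um; apply: norm_cvg0.
    have l : B * cutoff h (u m) @[m --> \oo] --> B * 0.
      by apply: cvgM; [exact: cvg_cst|exact: cutoff_cvg0].
    rewrite mulr0 in l; apply: (squeeze_cvgr _ (cvg_cst 0) l); apply: nearW => m.
    by rewrite normr_ge0/= normrM [X in _ * X]ger0_norm ?cutoff_ge0// ler_wpM2r ?cutoff_ge0.
  have := Rintegral_line_FTC cfc (L1D (h1 h) h2h) dfc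
    (lim (fun m => m%:R) (fun m => normr_nat _ _)) (lim (fun m => - m%:R) _).
  rewrite subrr (RintD (h1 h) h2h) => /(_ _)/eqP; rewrite addr_eq0 => H; apply/eqP; apply: H.
  by move=> m; rewrite normrN normr_nat.
pose h n : R := n.+1%:R^-1.
have h_gt0 n : 0 < h n by rewrite invr_gt0.
have lim1 : \int[leb]_x (f' x * cutoff (h n) x) @[n --> \oo] --> \int[leb]_x f' x.
  apply: (@cvg_Rint _ _ _ leb _ _ (fun x => `|f' x|)).
  - by move=> n; exact: L1_measurable (h1 (h n)).
  - move=> x; rewrite -[X in _ --> X]mulr1; apply: cvgM; first exact: cvg_cst.
    have l : 1 + (h n * x) ^+ 2 @[n --> \oo] --> 1 + (0 * x) * (0 * x).
      apply: cvgD; first exact: cvg_cst.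
      by apply: cvgM; apply: cvgM; [exact: cvg_harmonic|exact: cvg_cst|exact: cvg_harmonic|exact: cvg_cst].
    rewrite mul0r mulr0 addr0 in l; rewrite -[X in _ --> X]invr1.
    by apply: cvgV => //; rewrite oner_eq0.
  - exact: (L1_norm hf').
  - by move=> n x; rewrite normrM ler_piMr// ger0_norm ?cutoff_ge0 ?cutoff_le1.
have lim2 : \int[leb]_x (f' x * cutoff (h n) x) @[n --> \oo] --> 0.
  apply: norm_cvg0; pose m := \int[leb]_x `|f x|.
  have l : h n * m @[n --> \oo] --> 0 * m by apply: cvgM; [exact: cvg_harmonic|exact: cvg_cst].
  rewrite mul0r in l; apply: (squeeze_cvgr _ (cvg_cst 0) l); apply: nearW => n.
  rewrite normr_ge0/= byparts// normrN.
  have h2n := h2 _ (ltW (h_gt0 n)).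
  apply: (le_trans (le_normr_Rintegral measurableT h2n)).
  rewrite -(RintZ _ (L1_norm hf)); apply: (le_Rint (L1_norm h2n) (L1Z _ (L1_norm hf))) => x.
  by rewrite normrM mulrC ler_wpM2r// cutoff'_le// ltW.
exact: (cvg_unique _ lim1 lim2).
Qed.

Lemma Rintegral_ae0_slice b f : L1 mu f ->
  {ae leb, forall t : measurableTypeR R, forall p, coord (~~ b) p = t ->
     \int[leb]_r slice b f p r = 0} ->
  \int[mu]_p f p = 0.
Proof.
move=> hf; case: b => /= h0.
  rewrite -(Rintegral21 hf) /Rintegral (ae_eq_integral (cst 0%E))//.
  - by rewrite integral_cst// mul0e.
  - apply/measurable_EFinP; apply: measurableT_comp; first exact: fine_measurable.
    exact: (measurable_fubini_G hf).
  - by apply: filterS h0 => t /(_ (0, t) erefl) h _; congr EFin; exact: h.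
rewrite -(Rintegral12 hf) /Rintegral (ae_eq_integral (cst 0%E))//.
- by rewrite integral_cst// mul0e.
- apply/measurable_EFinP; apply: measurableT_comp; first exact: fine_measurable.
  exact: (measurable_fubini_F hf).
- by apply: filterS h0 => t /(_ (t, 0) erefl) h _; congr EFin; exact: h.
Qed.

Lemma ae_L1_slice b f : L1 mu f ->
  {ae leb, forall t : measurableTypeR R, forall p, coord (~~ b) p = t -> L1 leb (slice b f p)}.
Proof.
move=> hf; case: b => /=.
  by have := ae_integrable2 hf; apply: filterS => t + p pt; rewrite -pt.
by have := ae_integrable1 hf; apply: filterS => t + p pt; rewrite -pt.
Qed.

Lemma integral_derivative b f f' (B : R) :
  (forall p, is_derive (coord b p) (1:R) (slice b f p) (f' p)) ->
  (forall p, continuous (slice b f' p)) -> (forall p, `|f p| <= B) ->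
  L1 mu f -> L1 mu f' -> \int[mu]_p f' p = 0.
Proof.
move=> df cf' fB hf hf'; apply: (@Rintegral_ae0_slice b) => //.
have := ae_L1_slice b hf; have := ae_L1_slice b hf'.
apply: filterS2 => t h1 h2 p pt.
apply: (@integral_line_derivative (slice b f p) _ B).
- exact: cf'.
- by move=> r; have := df (shift b p r); rewrite coord_shift slice_shift sliceE.
- by move=> r; rewrite sliceE.
- exact: h2.
- exact: h1.
Qed.

Variable s : R.

Lemma is_derive_dot b p xi :
  is_derive (coord b p) (1:R) (fun t => dot (shift b p t) xi) (coord b xi).
Proof.
rewrite (_ : (fun t : R => _) = (fun t => t * coord b xi + dot (shift b p 0) xi)).
  by apply: is_derive_eq; rewrite /GRing.scale/=; ring.
by apply/funext => t; rewrite dot_shift.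
Qed.

Lemma continuous_slice b f : partial_derivable b f -> forall p, continuous (slice b f p).
Proof.
move=> df p t; apply: differentiable_continuous; apply/derivable1_diffP.
exact: partial_derivable_slice.
Qed.

Lemma continuous_dot b p xi : continuous (fun t => dot (shift b p t) xi).
Proof.
move=> t; apply: differentiable_continuous; apply/derivable1_diffP.
by have := is_derive_dot b (shift b p t) xi; rewrite coord_shift; case: b.
Qed.

(** Integration by parts against the exponentials. *)
Lemma Fpair_sder b f (B : R) xi : partial_derivable b f -> partial_derivable b (sder s b f) ->
  scale s b != 0 -> (forall p, `|f p| <= B) -> L1 mu f -> L1 mu (sder s b f) ->
  Fcos (sder s b f) xi = scale s b * coord b xi * Fsin f xi /\
  Fsin (sder s b f) xi = - (scale s b * coord b xi * Fcos f xi).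
Proof.
move=> df ddf sb0 fB hf hdf; set c := scale s b in sb0 *; set w := coord b xi.
pose g p := c^-1 * sder s b f p.
have hg : L1 mu g by exact: L1Z.
have dg p : is_derive (coord b p) (1:R) (slice b f p) (g p).
  have := is_derive_slice p (coord b p) df.
  by rewrite /g /sder mulrA mulVf// mul1r.
have cg p : continuous (slice b g p).
  move=> t; rewrite (_ : slice b g p = fun t => c^-1 * slice b (sder s b f) p t).
    by apply: cvgM; [exact: cvg_cst|exact: (continuous_slice ddf)].
  by apply/funext => r; rewrite !sliceE.
have hc := L1_cos xi hf; have hs := L1_sin xi hf.
have hgc := L1_cos xi hg; have hgs := L1_sin xi hg.
have ccos p : continuous (slice b (fun q => cos (dot q xi)) p).
  move=> t; rewrite (_ : slice b _ p = cos \o (fun t => dot (shift b p t) xi)).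
    by apply: continuous_comp; [exact: continuous_dot|exact: continuous_cos].
  by apply/funext => r; rewrite sliceE.
have csin p : continuous (slice b (fun q => sin (dot q xi)) p).
  move=> t; rewrite (_ : slice b _ p = sin \o (fun t => dot (shift b p t) xi)).
    by apply: continuous_comp; [exact: continuous_dot|exact: continuous_sin].
  by apply/funext => r; rewrite sliceE.
have e1 : \int[mu]_p (g p * cos (dot p xi) + (- w) * (f p * sin (dot p xi))) = 0.
  apply: (@integral_derivative b (fun p => f p * cos (dot p xi)) _ B).
  - move=> p; have d0 := dg p; have dd := is_derive_dot b p xi.
    have dc : is_derive (coord b p) (1:R) (fun t => cos (dot (shift b p t) xi))
        (- sin (dot (shift b p (coord b p)) xi) * w).
      exact: (@is_derive1_comp _ cos (fun t => dot (shift b p t) xi)).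
    rewrite (_ : slice b _ p = slice b f p * (fun t => cos (dot (shift b p t) xi))).
      by apply: is_derive_eq; rewrite /GRing.scale/= slice_coord shift_coord; ring.
    by apply/funext => t; rewrite fctE !sliceE.
  - move=> p t; rewrite (_ : slice b _ p = fun t => slice b g p t * slice b (fun q => cos (dot q xi)) p t
        + (- w) * (slice b f p t * slice b (fun q => sin (dot q xi)) p t)).
      apply: cvgD; first by apply: cvgM; [exact: cg|exact: ccos].
      apply: cvgM; first exact: cvg_cst.
      by apply: cvgM; [exact: (continuous_slice df)|exact: csin].
    by apply/funext => r; rewrite !sliceE.
  - by move=> p; rewrite normrM (le_trans (ler_piMr _ (normr_cos_le1 _))).
  - exact: hc.
  - exact: (L1D hgc (L1Z _ hs)).
have e2 : \int[mu]_p (g p * sin (dot p xi) + w * (f p * cos (dot p xi))) = 0.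
  apply: (@integral_derivative b (fun p => f p * sin (dot p xi)) _ B).
  - move=> p; have d0 := dg p; have dd := is_derive_dot b p xi.
    have dc : is_derive (coord b p) (1:R) (fun t => sin (dot (shift b p t) xi))
        (cos (dot (shift b p (coord b p)) xi) * w).
      exact: (@is_derive1_comp _ sin (fun t => dot (shift b p t) xi)).
    rewrite (_ : slice b _ p = slice b f p * (fun t => sin (dot (shift b p t) xi))).
      by apply: is_derive_eq; rewrite /GRing.scale/= slice_coord shift_coord; ring.
    by apply/funext => t; rewrite fctE !sliceE.
  - move=> p t; rewrite (_ : slice b _ p = fun t => slice b g p t * slice b (fun q => sin (dot q xi)) p t
        + w * (slice b f p t * slice b (fun q => cos (dot q xi)) p t)).
      apply: cvgD; first by apply: cvgM; [exact: cg|exact: csin].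
      apply: cvgM; first exact: cvg_cst.
      by apply: cvgM; [exact: (continuous_slice df)|exact: ccos].
    by apply/funext => r; rewrite !sliceE.
  - by move=> p; rewrite normrM (le_trans (ler_piMr _ (normr_sin_le1 _))).
  - exact: hs.
  - exact: (L1D hgs (L1Z _ hc)).
rewrite (RintD hgc (L1Z _ hs)) (RintZ _ hs) in e1.
rewrite (RintD hgs (L1Z _ hc)) (RintZ _ hc) in e2.
have gE p : sder s b f p = c * g p by rewrite /g mulVKf.
rewrite /Fcos /Fsin; split.
- transitivity (\int[mu]_p (c * (g p * cos (dot p xi)))).
    by apply: eq_Rintegral => p _; rewrite gE -mulrA.
  by rewrite (RintZ _ hgc); move/eqP: e1; rewrite addr_eq0 => /eqP ->; ring.
- transitivity (\int[mu]_p (c * (g p * sin (dot p xi)))).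
    by apply: eq_Rintegral => p _; rewrite gE -mulrA.
  by rewrite (RintZ _ hgs); move/eqP: e2; rewrite addr_eq0 => /eqP ->; ring.
Qed.

Hypothesis s_gt0 : 0 < s.

Lemma sqmod_Fpair_sder b k f B xi : smooth s k.+2 B f -> integrable_derivatives s k.+2 f ->
  sqmod (Fpair (sder s b f) xi) = (scale s b * coord b xi) ^+ 2 * sqmod (Fpair f xi).
Proof.
move=> hf hi.
have [e1 e2] := Fpair_sder xi (smooth_derivable (b := b) hf) (smooth_derivable (b := b) (smooth_sder b hf))
  (lt0r_neq0 (scale_gt0 s_gt0 b)) (fun p => smooth_le p hf) (integrable_derivatives_L1 hi)
  (integrable_derivatives_L1 (integrable_derivatives_sder b hi)).
by rewrite !sqmod_Fpair e1 e2; ring.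
Qed.

(** Plancherel's inequality for the [k]-th derivative. *)
Lemma frequency_moment b k f B : smooth s k.+1 B f -> integrable_derivatives s k.+1 f ->
  (\int[mu]_xi ((scale s b * coord b xi) ^+ k.*2 * sqmod (Fpair f xi))%:E <=
   (4 * pi ^+ 2 * (B ^+ 2 * s))%:E)%E.
Proof.
elim: k f => [|k IH] f hf hi.
  under eq_integral do rewrite expr0 mul1r.
  apply: (le_trans (plancherel_sqmod (integrable_derivatives_L1 hi) (smooth_L2 hf))).
  rewrite [leRHS]EFinM; apply: lee_wpmul2l.
    by rewrite lee_fin mulr_ge0// sqr_ge0.
  by have [] := smooth_bounded2 hf.
have := IH _ (smooth_sder b hf) (integrable_derivatives_sder b hi).
apply: le_trans; rewrite le_eqVlt; apply/orP; left; apply/eqP.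
apply: eq_integral => xi _; congr EFin.
by rewrite (sqmod_Fpair_sder b xi hf hi) doubleS !exprS expr0; ring.
Qed.

Lemma weightX_le k xi : weight s xi ^+ k <=
  3 ^+ k * (1 + (scale s true * coord true xi) ^+ k.*2 + (scale s false * coord false xi) ^+ k.*2).
Proof.
rewrite /weight /scale /coord mul1r -mul2n !exprM.
set a := xi.1 ^+ 2; set c := (s * xi.2) ^+ 2.
have a0 : 0 <= a by exact: sqr_ge0.
have c0 : 0 <= c by exact: sqr_ge0.
have le_m (m : R) : 0 <= m -> 1 + a + c <= 3 * m -> (1 + a + c) ^+ k <= 3 ^+ k * m ^+ k.
  by move=> m0 h; rewrite -exprMn lerXn2r ?nnegrE ?mulr_ge0// !addr_ge0.
have ak : 0 <= a ^+ k by exact: exprn_ge0.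
have ck : 0 <= c ^+ k by exact: exprn_ge0.
have [h1|h1] := leP (a) 1; have [h2|h2] := leP c 1.
- apply: (le_trans (le_m 1 ler01 _)); first lra.
  by rewrite expr1n ler_wpM2l ?exprn_ge0//; lra.
- apply: (le_trans (le_m c c0 _)); first lra.
  by rewrite ler_wpM2l ?exprn_ge0//; lra.
- apply: (le_trans (le_m a a0 _)); first lra.
  by rewrite ler_wpM2l ?exprn_ge0//; lra.
- have [ac|ac] := leP a c.
    apply: (le_trans (le_m c c0 _)); first lra.
    by rewrite ler_wpM2l ?exprn_ge0//; lra.
  apply: (le_trans (le_m a a0 _)); first lra.
  by rewrite ler_wpM2l ?exprn_ge0//; lra.
Qed.

Definition spectral_cst k : R := 3 ^+ k * (12 * pi ^+ 2).

Lemma spectral_cst_ge1 k : 1 <= spectral_cst k.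
Proof.
have h1 : 1 <= 3 ^+ k :> R by rewrite exprn_ege1// ler1n.
have h2 : 1 <= 12 * pi ^+ 2 :> R by have := pi2_ge1 (R := R); lra.
by rewrite /spectral_cst -[leLHS]mulr1 ler_pM.
Qed.

(** The weight is controlled by the pure powers of the two frequencies. *)
Lemma smooth_spectral k f B : smooth s k.+1 B f -> integrable_derivatives s k.+1 f ->
  spectral s k (spectral_cst k * B) (Fpair f).
Proof.
move=> hf hi; have hL := integrable_derivatives_L1 hi.
have [m1 m2] := measurable_Fpair hL; split => //.
have msq := measurable_sqmod m1 m2.
pose T b xi := (scale s b * coord b xi) ^+ k.*2 * sqmod (Fpair f xi).
have mT b : measurable_fun setT (T b).
  apply: measurable_funM => //; apply: (measurable_funX k.*2).
  apply: measurable_funM; first exact: measurable_cst.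
  by case: b; [exact: measurable_fst|exact: measurable_snd].
have T0 b xi : 0 <= T b xi by rewrite mulr_ge0 ?sqmod_ge0// -mul2n exprM exprn_ge0// sqr_ge0.
have s0 xi : 0 <= sqmod (Fpair f xi) by exact: sqmod_ge0.
apply: (@le_trans _ _ ((3 ^+ k)%:E * \int[mu]_xi ((sqmod (Fpair f xi))%:E + (T true xi)%:E + (T false xi)%:E))%E).
  rewrite -ge0_integralZl_EFin; last 4 first.
  - exact: measurableT.
  - by move=> xi _; rewrite -!EFinD lee_fin addr_ge0 ?T0// addr_ge0 ?T0.
  - by apply/measurable_EFinP; exact: (measurable_funD (measurable_funD msq (mT true)) (mT false)).
  - exact: exprn_ge0.
  apply: ge0_le_integral.
  - exact: measurableT.
  - by move=> xi _; rewrite lee_fin mulr_ge0// exprn_ge0// ltW// weight_gt0.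
  - by apply/measurable_EFinP; exact: (measurable_funM (measurable_weightX s k) msq).
  - apply/measurable_EFinP; exact: (measurable_funM (measurable_cst _)
      (measurable_funD (measurable_funD msq (mT true)) (mT false))).
  - move=> xi _; rewrite -!EFinD -EFinM lee_fin /T.
    apply: (le_trans (ler_wpM2r (s0 xi) (weightX_le k xi))).
    by rewrite le_eqVlt; apply/orP; left; apply/eqP; ring.
have D1 : (\int[mu]_xi (sqmod (Fpair f xi))%:E <= (4 * pi ^+ 2 * (B ^+ 2 * s))%:E)%E.
  apply: (le_trans (plancherel_sqmod hL (smooth_L2 hf))).
  rewrite [leRHS]EFinM; apply: lee_wpmul2l; first by rewrite lee_fin mulr_ge0// sqr_ge0.
  by have [] := smooth_bounded2 hf.
rewrite ge0_integralD; last 5 first.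
- exact: measurableT.
- by move=> xi _; rewrite -EFinD lee_fin addr_ge0.
- by apply/measurable_EFinP; exact: (measurable_funD msq (mT true)).
- by move=> xi _; rewrite lee_fin.
- by apply/measurable_EFinP.
rewrite ge0_integralD; last 5 first.
- exact: measurableT.
- by move=> xi _; rewrite lee_fin.
- by apply/measurable_EFinP.
- by move=> xi _; rewrite lee_fin.
- by apply/measurable_EFinP.
apply: (@le_trans _ _ ((3 ^+ k)%:E * ((4 * pi ^+ 2 * (B ^+ 2 * s))%:E + (4 * pi ^+ 2 * (B ^+ 2 * s))%:E
   + (4 * pi ^+ 2 * (B ^+ 2 * s))%:E))%E).
  apply: lee_wpmul2l; first by rewrite lee_fin exprn_ge0.
  by apply: leeD; [apply: leeD => //|]; exact: frequency_moment.
rewrite -!EFinD -EFinM lee_fin.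
have -> : 3 ^+ k * (4 * pi ^+ 2 * (B ^+ 2 * s) + 4 * pi ^+ 2 * (B ^+ 2 * s) + 4 * pi ^+ 2 * (B ^+ 2 * s))
   = spectral_cst k * (B ^+ 2 * s) by rewrite /spectral_cst; ring.
have -> : (spectral_cst k * B) ^+ 2 * s = spectral_cst k ^+ 2 * (B ^+ 2 * s) by ring.
apply: ler_wpM2r; first by rewrite mulr_ge0 ?sqr_ge0// ltW.
by have c1 := spectral_cst_ge1 k; rewrite expr2 ler_peMr//; lra.
Qed.

End integral_of_derivative.

(** * Sobolev norms *)
Section sobolev_norms.
Context {R : realType}.
Local Notation mu := (mu2 R).
Implicit Types (f g : plane R -> R) (p xi : plane R) (G : plane R -> R * R) (k : nat).
Variable s : R.
Hypotheses (s_gt0 : 0 < s) (s_le1 : s <= 1).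

Definition frequency xi : R := xi.1 ^+ 2 + s ^+ 2 * xi.2 ^+ 2.

Lemma frequency_ge0 xi : 0 <= frequency xi.
Proof. by rewrite addr_ge0 ?sqr_ge0// mulr_ge0// sqr_ge0. Qed.

Lemma weightE xi : weight s xi = 1 + frequency xi.
Proof. by rewrite /weight /frequency exprMn addrA. Qed.

Lemma measurable_frequency : measurable_fun setT frequency.
Proof.
apply: measurable_funD; first exact: (measurable_sqr (measurable_fst_plane (R := R))).
exact: (measurable_funM (measurable_cst _) (measurable_sqr (measurable_snd_plane (R := R)))).
Qed.

Lemma measurable_bracket : measurable_fun setT (fun xi : plane R => 1 + xi.1 ^+ 2 + xi.2 ^+ 2).
Proof.
apply: measurable_funD; last exact: (measurable_sqr (measurable_snd_plane (R := R))).
apply: measurable_funD; first exact: measurable_cst.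
exact: (measurable_sqr (measurable_fst_plane (R := R))).
Qed.

Lemma bracket_ge1 xi : 1 <= 1 + xi.1 ^+ 2 + xi.2 ^+ 2.
Proof. by rewrite -addrA lerDl addr_ge0 ?sqr_ge0. Qed.

Lemma frequency_powR_le sigma k xi : 0 <= sigma <= k%:R ->
  frequency xi `^ sigma <= weight s xi ^+ k.
Proof.
move=> /andP[s0 sk]; have w1 := weight_ge1 s xi.
apply: (@le_trans _ _ (weight s xi `^ sigma)).
  apply: ge0_ler_powR => //; rewrite ?nnegrE ?frequency_ge0 ?(le_trans ler01 w1)//.
  by rewrite weightE lerDr.
by rewrite -powR_mulrn ?(le_trans ler01 w1)// ler_powR.
Qed.

Lemma sqrt_scale : (s ^+ 2) `^ (- 2^-1) = s^-1.
Proof. by rewrite powRN powR12_sqrt ?sqr_ge0// sqrtr_sqr gtr0_norm. Qed.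

Lemma Hnorm2E sigma f : Hnorm2 (s ^+ 2) sigma f =
  ((s^-1)%:E * \int[mu]_xi (frequency xi `^ sigma * sqmod (fourier f xi))%:E)%E.
Proof. by rewrite /Hnorm2 sqrt_scale. Qed.

Lemma Hnorm2_ge0 sigma f : (0 <= Hnorm2 (s ^+ 2) sigma f)%E.
Proof.
rewrite Hnorm2E mule_ge0//; first by rewrite lee_fin invr_ge0 ltW.
by apply: integral_ge0 => xi _; rewrite lee_fin mulr_ge0 ?powR_ge0 ?sqmod_ge0.
Qed.

Lemma spectral_Hnorm2 k M G sigma f : L2 f -> is_fourier f G -> spectral s k M G ->
  0 <= sigma <= k%:R -> (Hnorm2 (s ^+ 2) sigma f <= (M ^+ 2)%:E)%E.
Proof.
move=> hf hG sp sk.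
have mw : measurable_fun setT (fun xi => frequency xi `^ sigma).
  exact: (measurableT_comp (measurable_powR sigma) measurable_frequency).
rewrite Hnorm2E (integral_fourier hf hG mw (fun xi => powR_ge0 _ _)).
have [m1 m2 h] := sp.
have -> : (M ^+ 2)%:E = ((s^-1)%:E * (M ^+ 2 * s)%:E)%E.
  by rewrite -EFinM; congr EFin; field; rewrite gt_eqF.
apply: lee_wpmul2l; first by rewrite lee_fin invr_ge0 ltW.
apply: le_trans h; apply: ge0_le_integral.
- exact: measurableT.
- by move=> xi _; rewrite lee_fin mulr_ge0 ?powR_ge0 ?sqmod_ge0.
- by apply/measurable_EFinP; exact: (measurable_funM mw (measurable_sqmod m1 m2)).
- by apply/measurable_EFinP; exact: (spectral_measurable sp).
- by move=> xi _; rewrite lee_fin ler_wpM2r ?sqmod_ge0 ?frequency_powR_le.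
Qed.

Lemma bracket_powR_le sigma k xi : 0 <= sigma <= k%:R ->
  (1 + xi.1 ^+ 2 + xi.2 ^+ 2) `^ sigma <= (s ^- 2) ^+ k * weight s xi ^+ k.
Proof.
move=> /andP[s0 sk]; have b1 := bracket_ge1 xi.
apply: (@le_trans _ _ ((1 + xi.1 ^+ 2 + xi.2 ^+ 2) ^+ k)).
  by rewrite -(powR_mulrn k (le_trans ler01 b1)) ler_powR.
rewrite -exprMn; apply: lerXn2r.
- by rewrite nnegrE (le_trans ler01 b1).
- by rewrite nnegrE mulr_ge0// ?invr_ge0 ?sqr_ge0// ltW// weight_gt0.
rewrite -ler_pdivrMl ?invr_gt0 ?exprn_gt0// invrK /weight exprMn !mulrDr mulr1.
have s2 : s ^+ 2 <= 1 by rewrite expr_le1// ltW.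
by rewrite lerD2r lerD// ler_piMl// sqr_ge0.
Qed.

Lemma spectral_Hs k M G sigma f : L2 f -> is_fourier f G -> spectral s k M G ->
  0 <= sigma <= k%:R -> Hs sigma f.
Proof.
move=> hf hG sp sk; split => //; first exact: fourierP hG.
have mw : measurable_fun setT (fun xi : plane R => (1 + xi.1 ^+ 2 + xi.2 ^+ 2) `^ sigma).
  exact: (measurableT_comp (measurable_powR sigma) measurable_bracket).
rewrite (integral_fourier hf hG mw (fun xi => powR_ge0 _ _)).
have [m1 m2 h] := sp.
apply: (@le_lt_trans _ _ (((s ^- 2) ^+ k)%:E * (M ^+ 2 * s)%:E)%E); last by rewrite -EFinM ltry.
apply: (@le_trans _ _ (((s ^- 2) ^+ k)%:E * \int[mu]_xi (weight s xi ^+ k * sqmod (G xi))%:E)%E); last first.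
  by apply: lee_wpmul2l => //; rewrite lee_fin exprn_ge0// invr_ge0 sqr_ge0.
rewrite -ge0_integralZl_EFin; last 4 first.
- exact: measurableT.
- by move=> xi _; rewrite lee_fin mulr_ge0 ?sqmod_ge0// exprn_ge0// ltW// weight_gt0.
- by apply/measurable_EFinP; exact: (spectral_measurable sp).
- by rewrite exprn_ge0// invr_ge0 sqr_ge0.
apply: ge0_le_integral.
- exact: measurableT.
- by move=> xi _; rewrite lee_fin mulr_ge0 ?powR_ge0 ?sqmod_ge0.
- by apply/measurable_EFinP; exact: (measurable_funM mw (measurable_sqmod m1 m2)).
- by apply/measurable_EFinP; exact: (measurable_funM (measurable_cst _) (spectral_measurable sp)).
- by move=> xi _; rewrite -EFinM lee_fin mulrA ler_wpM2r ?sqmod_ge0 ?bracket_powR_le.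
Qed.

Lemma Hs_le sigma sigma' f : sigma' <= sigma -> Hs sigma f -> Hs sigma' f.
Proof.
move=> ss [hf hF h]; split => //; apply: le_lt_trans h.
have [F1 F2 _] := hF; have msq := measurable_sqmod F1.1 F2.1.
have mw t : measurable_fun setT (fun xi : plane R => (1 + xi.1 ^+ 2 + xi.2 ^+ 2) `^ t).
  exact: (measurableT_comp (measurable_powR t) measurable_bracket).
apply: ge0_le_integral.
- exact: measurableT.
- by move=> xi _; rewrite lee_fin mulr_ge0 ?powR_ge0 ?sqmod_ge0.
- by apply/measurable_EFinP; exact: (measurable_funM (mw _) msq).
- by apply/measurable_EFinP; exact: (measurable_funM (mw _) msq).
- by move=> xi _; rewrite lee_fin ler_wpM2r ?sqmod_ge0// ler_powR// bracket_ge1.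
Qed.

Lemma sqmod_combination_le (w c : R) (z z' : R * R) : 0 <= w ->
  w * sqmod (z + (c * z'.1, c * z'.2)) <= 2 * (w * sqmod z) + 2 * c ^+ 2 * (w * sqmod z').
Proof.
move=> w0; have := ler_wpM2l w0 (sqmodD_le z (c * z'.1, c * z'.2)).
move/le_trans; apply; rewrite le_eqVlt; apply/orP; left; apply/eqP.
by rewrite /sqmod/=; ring.
Qed.

Lemma integral_sqmod_combination_le (w : plane R -> R) (c : R) G (H : plane R -> R * R) :
  measurable_fun setT w -> (forall xi, 0 <= w xi) ->
  measurable_fun setT (fun xi => (G xi).1) -> measurable_fun setT (fun xi => (G xi).2) ->
  measurable_fun setT (fun xi => (H xi).1) -> measurable_fun setT (fun xi => (H xi).2) ->
  (\int[mu]_xi (w xi * sqmod (G xi + (c * (H xi).1, c * (H xi).2)))%:E <=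
   2%:E * \int[mu]_xi (w xi * sqmod (G xi))%:E +
   (2 * c ^+ 2)%:E * \int[mu]_xi (w xi * sqmod (H xi))%:E)%E.
Proof.
move=> mw w0 G1 G2 H1 H2.
have mG := measurable_funM mw (measurable_sqmod G1 G2).
have mH := measurable_funM mw (measurable_sqmod H1 H2).
have mE := measurable_funM mw (measurable_sqmod
  (G := fun xi => G xi + (c * (H xi).1, c * (H xi).2))
  (measurable_funD G1 (measurable_funM (measurable_cst c) H1))
  (measurable_funD G2 (measurable_funM (measurable_cst c) H2))).
have c0 : 0 <= 2 * c ^+ 2 by rewrite mulr_ge0// sqr_ge0.
rewrite -ge0_integralZl_EFin; last 4 first.
- exact: measurableT.
- by move=> xi _; rewrite lee_fin mulr_ge0 ?sqmod_ge0.
- by apply/measurable_EFinP; exact: mG.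
- by [].
rewrite -ge0_integralZl_EFin; last 4 first.
- exact: measurableT.
- by move=> xi _; rewrite lee_fin mulr_ge0 ?sqmod_ge0.
- by apply/measurable_EFinP; exact: mH.
- exact: c0.
rewrite -ge0_integralD; last 5 first.
- exact: measurableT.
- by move=> xi _; rewrite -EFinM lee_fin mulr_ge0// mulr_ge0 ?sqmod_ge0.
- by apply/measurable_EFinP; exact: (measurable_funM (measurable_cst _) mG).
- by move=> xi _; rewrite -EFinM lee_fin; apply: (mulr_ge0 c0); rewrite mulr_ge0 ?sqmod_ge0.
- by apply/measurable_EFinP; exact: (measurable_funM (measurable_cst _) mH).
apply: ge0_le_integral.
- exact: measurableT.
- by move=> xi _; rewrite lee_fin mulr_ge0 ?sqmod_ge0.
- by apply/measurable_EFinP; exact: mE.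
- apply/measurable_EFinP; exact: (measurable_funD (measurable_funM (measurable_cst _) mG)
   (measurable_funM (measurable_cst _) mH)).
- by move=> xi _; rewrite -!EFinM -EFinD lee_fin; exact: sqmod_combination_le.
Qed.

Lemma HsD (sigma c : R) f g : Hs sigma f -> Hs sigma g -> Hs sigma (fun p => f p + c * g p).
Proof.
move=> [hf hF hF2] [hg hH hH2].
have hfg : L2 (fun p => f p + c * g p) by exact: (square_integrableD hf (square_integrableZ c hg)).
have hFH := is_fourierD c hf hg hF hH.
split; [exact: hfg|exact: fourierP hFH|].
have mw : measurable_fun setT (fun xi : plane R => (1 + xi.1 ^+ 2 + xi.2 ^+ 2) `^ sigma).
  exact: (measurableT_comp (measurable_powR sigma) measurable_bracket).
rewrite (integral_fourier hfg hFH mw (fun xi => powR_ge0 _ _)).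
have [F1 F2 _] := hF; have [H1 H2 _] := hH.
apply: (le_lt_trans (integral_sqmod_combination_le c mw (fun xi => powR_ge0 _ _)
  F1.1 F2.1 H1.1 H2.1)).
have c0 : 0 <= 2 * c ^+ 2 by rewrite mulr_ge0// sqr_ge0.
apply: lte_add_pinfty.
  by apply: lte_mul_pinfty; [rewrite lee_fin|rewrite fin_numElt ltNyr ltry|exact: hF2].
by apply: lte_mul_pinfty; [rewrite lee_fin|rewrite fin_numElt ltNyr ltry|exact: hH2].
Qed.

Lemma Hnorm2D (sigma c : R) f g : Hs sigma f -> Hs sigma g ->
  (Hnorm2 (s ^+ 2) sigma (fun p => f p + c * g p)%R <=
   2%:E * Hnorm2 (s ^+ 2) sigma f + (2 * c ^+ 2)%:E * Hnorm2 (s ^+ 2) sigma g)%E.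
Proof.
move=> [hf hF _] [hg hG _].
have hfg : L2 (fun p => f p + c * g p) by exact: (square_integrableD hf (square_integrableZ c hg)).
have hFG := is_fourierD c hf hg hF hG.
have mw : measurable_fun setT (fun xi => frequency xi `^ sigma).
  exact: (measurableT_comp (measurable_powR sigma) measurable_frequency).
rewrite Hnorm2E (integral_fourier hfg hFG mw (fun xi => powR_ge0 _ _)) !Hnorm2E.
have [F1 F2 _] := hF; have [G1 G2 _] := hG.
have h := integral_sqmod_combination_le c mw (fun xi => powR_ge0 _ _) F1.1 F2.1 G1.1 G2.1.
have s0 : (0 <= (s^-1)%:E)%E by rewrite lee_fin invr_ge0 ltW.
apply: (le_trans (lee_wpmul2l s0 h)).
have pos H : (0 <= \int[mu]_xi (frequency xi `^ sigma * sqmod (H xi))%:E)%E.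
  by apply: integral_ge0 => xi _; rewrite lee_fin mulr_ge0 ?sqmod_ge0 ?powR_ge0.
have c0 : 0 <= 2 * c ^+ 2 by rewrite mulr_ge0// sqr_ge0.
rewrite ge0_muleDr; last 2 first.
- exact: (mule_ge0 _ (pos _)).
- by apply: (mule_ge0 _ (pos _)); rewrite lee_fin.
have swap (a b k X Y : \bar R) : (k * (a * X) + k * (b * Y) = a * (k * X) + b * (k * Y))%E.
  by rewrite (muleCA k a) (muleCA k b).
by rewrite -swap.
Qed.

(** The norms of order [0] and [k] control all the intermediate ones. *)
Lemma weightX_le_frequency k xi : weight s xi ^+ k <= 2 ^+ k * (1 + frequency xi ^+ k).
Proof.
rewrite weightE; have q0 := frequency_ge0 xi; set q := frequency xi in q0 *.
have qk : 0 <= q ^+ k by exact: exprn_ge0.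
have two : 0 <= 2 ^+ k :> R by exact: exprn_ge0.
have [q1|q1] := leP q 1.
  apply: (@le_trans _ _ (2 ^+ k)).
    have q2 : 1 + q <= 2 by lra.
    by apply: (lerXn2r _ _ _ q2); rewrite nnegrE// addr_ge0.
  by rewrite ler_peMr// lerDl.
apply: (@le_trans _ _ (2 ^+ k * q ^+ k)).
  have q2 : 1 + q <= 2 * q by lra.
  by rewrite -exprMn; apply: (lerXn2r _ _ _ q2); rewrite nnegrE; [rewrite addr_ge0|rewrite mulr_ge0].
by rewrite ler_wpM2l// lerDr.
Qed.

Lemma Hnorm2_spectral k M f : is_fourier f (fourier f) ->
  (Hnorm2 (s ^+ 2) 0 f <= (M ^+ 2)%:E)%E -> (Hnorm2 (s ^+ 2) k%:R f <= (M ^+ 2)%:E)%E ->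
  spectral s k (2 ^+ k.+1 * M) (fourier f).
Proof.
move=> [F1 F2 _]; rewrite !Hnorm2E => h0 hk; split; [exact: F1.1|exact: F2.1|].
have msq := measurable_sqmod F1.1 F2.1.
have unscale (X : \bar R) : ((s^-1)%:E * X <= (M ^+ 2)%:E)%E -> (X <= (M ^+ 2 * s)%:E)%E.
  move=> h; have s0 : (0 <= s%:E)%E by rewrite lee_fin ltW.
  have := lee_wpmul2l s0 h.
  by rewrite muleA -!EFinM mulfV ?gt_eqF// mul1e mulrC.
have {}h0 : (\int[mu]_xi (sqmod (fourier f xi))%:E <= (M ^+ 2 * s)%:E)%E.
  by apply: unscale; move: h0; under eq_integral do rewrite powRr0 mul1r.
have {}hk : (\int[mu]_xi (frequency xi ^+ k * sqmod (fourier f xi))%:E <= (M ^+ 2 * s)%:E)%E.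
  apply: unscale; move: hk; congr (_ * _ <= _)%E; apply: eq_integral => xi _.
  by rewrite powR_mulrn ?frequency_ge0.
have mq : measurable_fun setT (fun xi => frequency xi ^+ k * sqmod (fourier f xi)).
  exact: (measurable_funM (measurable_funX k measurable_frequency) msq).
have q0 xi : 0 <= frequency xi ^+ k * sqmod (fourier f xi).
  by rewrite mulr_ge0 ?sqmod_ge0// exprn_ge0// frequency_ge0.
apply: (@le_trans _ _ ((2 ^+ k)%:E * \int[mu]_xi ((sqmod (fourier f xi))%:E +
   (frequency xi ^+ k * sqmod (fourier f xi))%:E))%E).
  rewrite -ge0_integralZl_EFin; last 4 first.
  - exact: measurableT.
  - by move=> xi _; rewrite -EFinD lee_fin addr_ge0 ?sqmod_ge0.
  - by apply/measurable_EFinP; exact: (measurable_funD msq mq).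
  - exact: exprn_ge0.
  apply: ge0_le_integral.
  - exact: measurableT.
  - by move=> xi _; rewrite lee_fin mulr_ge0 ?sqmod_ge0// exprn_ge0// ltW// weight_gt0.
  - by apply/measurable_EFinP; exact: (measurable_funM (measurable_weightX s k) msq).
  - by apply/measurable_EFinP; exact: (measurable_funM (measurable_cst _) (measurable_funD msq mq)).
  - move=> xi _; rewrite -EFinD -EFinM lee_fin.
    apply: (le_trans (ler_wpM2r (sqmod_ge0 _) (weightX_le_frequency k xi))).
    by rewrite le_eqVlt; apply/orP; left; apply/eqP; ring.
rewrite ge0_integralD; last 5 first.
- exact: measurableT.
- by move=> xi _; rewrite lee_fin sqmod_ge0.
- by apply/measurable_EFinP; exact: msq.
- by move=> xi _; rewrite lee_fin.
- by apply/measurable_EFinP; exact: mq.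
apply: (@le_trans _ _ ((2 ^+ k)%:E * ((M ^+ 2 * s)%:E + (M ^+ 2 * s)%:E))%E).
  by apply: lee_wpmul2l; [rewrite lee_fin exprn_ge0|exact: leeD].
rewrite -EFinD -EFinM lee_fin.
have -> : 2 ^+ k * (M ^+ 2 * s + M ^+ 2 * s) = 2 ^+ k.+1 * (M ^+ 2 * s) by rewrite [2 ^+ k.+1]exprS; ring.
have -> : (2 ^+ k.+1 * M) ^+ 2 * s = (2 ^+ k.+1) ^+ 2 * (M ^+ 2 * s) by ring.
apply: ler_wpM2r; first by rewrite mulr_ge0 ?sqr_ge0// ltW.
by rewrite expr2 ler_peMr ?exprn_ge0// exprn_ege1// ler1n.
Qed.

Lemma Hs_spectral k sigma f : k%:R <= sigma -> Hs sigma f ->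
  exists2 M, 0 <= M & spectral s k M (fourier f).
Proof.
move=> ks hf; have [l2 hF h] := Hs_le ks hf; have [F1 F2 _] := hF.
have msq := measurable_sqmod F1.1 F2.1.
have le_h : (\int[mu]_xi (weight s xi ^+ k * sqmod (fourier f xi))%:E <=
   \int[mu]_xi ((1 + xi.1 ^+ 2 + xi.2 ^+ 2) `^ k%:R * sqmod (fourier f xi))%:E)%E.
  apply: ge0_le_integral.
  - exact: measurableT.
  - by move=> xi _; rewrite lee_fin mulr_ge0 ?sqmod_ge0// exprn_ge0// ltW// weight_gt0.
  - by apply/measurable_EFinP; exact: (measurable_funM (measurable_weightX s k) msq).
  - apply/measurable_EFinP; apply: measurable_funM => //.
    exact: (measurableT_comp (measurable_powR k%:R) measurable_bracket).
  - move=> xi _; have b1 := bracket_ge1 xi; rewrite lee_fin ler_wpM2r ?sqmod_ge0//.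
    rewrite powR_mulrn ?(le_trans ler01 b1)// lerXn2r ?nnegrE ?(le_trans ler01 b1)//.
      by rewrite ltW// weight_gt0.
    rewrite /weight lerD2l exprMn ler_piMl ?sqr_ge0// expr_le1// ltW//.
set X := (\int[mu]_xi ((1 + xi.1 ^+ 2 + xi.2 ^+ 2) `^ k%:R * sqmod (fourier f xi))%:E)%E in h le_h.
have X0 : (0 <= X)%E.
  by apply: integral_ge0 => xi _; rewrite lee_fin mulr_ge0 ?powR_ge0 ?sqmod_ge0.
have Xfin : X \is a fin_num by rewrite ge0_fin_numE.
have x0 : 0 <= fine X by exact: fine_ge0.
exists (fine X / s + 1); first by rewrite addr_ge0// divr_ge0// ltW.
split; [exact: F1.1|exact: F2.1|]; apply: (le_trans le_h).
rewrite -(fineK Xfin) lee_fin; set y := fine X in x0 *.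
rewrite -ler_pdivrMr//; have : 0 <= y / s by rewrite divr_ge0// ltW.
by move: (y / s) => z z0; nra.
Qed.

Lemma continuous_Hs_inverse sigma f : 2 <= sigma -> Hs sigma f -> continuous f ->
  f = inverse_transform (fourier f).
Proof.
move=> h2 hf cf; have [M _ sp] := @Hs_spectral 2 sigma f h2 hf.
have [l2 hF _] := hf; apply/funext => p; apply: fourier_inversion.
- exact: l2.
- exact: cf.
- exact: hF.
- exact: (spectral_L1_1 s_gt0 sp).
- exact: (spectral_L1_2 s_gt0 sp).
Qed.

(** The estimate of Sobolev's embedding theorem, uniform in [s]: two orders of
    regularity are lost. *)
Lemma Hs_smooth k sigma M f : k.+2%:R <= sigma -> 0 <= M -> Hs sigma f -> continuous f ->
  (Hnorm2 (s ^+ 2) 0 f <= (M ^+ 2)%:E)%E ->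
  (Hnorm2 (s ^+ 2) k.+2%:R f <= (M ^+ 2)%:E)%E ->
  smooth s k (2 ^+ k.+3 * M) f.
Proof.
move=> ks M0 hf cf h0 hk; have [_ hF _] := hf.
have h2 : 2 <= sigma by apply: le_trans ks; rewrite ler_nat.
rewrite (continuous_Hs_inverse h2 hf cf); apply: spectral_smooth => //.
  by rewrite mulr_ge0// exprn_ge0.
exact: Hnorm2_spectral.
Qed.

Lemma smooth_Hnorm2 k B f sigma : smooth s k.+1 B f -> integrable_derivatives s k.+1 f ->
  0 <= sigma <= k%:R -> (Hnorm2 (s ^+ 2) sigma f <= ((spectral_cst k * B) ^+ 2)%:E)%E.
Proof.
move=> hf hi; have hL := integrable_derivatives_L1 hi; have h2 := smooth_L2 hf.
exact: (spectral_Hnorm2 h2 (is_fourier_Fpair hL h2) (smooth_spectral s_gt0 hf hi)).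
Qed.

Lemma smooth_Hs k B f sigma : smooth s k.+1 B f -> integrable_derivatives s k.+1 f ->
  0 <= sigma <= k%:R -> Hs sigma f.
Proof.
move=> hf hi; have hL := integrable_derivatives_L1 hi; have h2 := smooth_L2 hf.
exact: (spectral_Hs h2 (is_fourier_Fpair hL h2) (smooth_spectral s_gt0 hf hi)).
Qed.

End sobolev_norms.

(** * The operator [1 - lam \partial_x^2] *)
Section resolvent.
Context {R : realType}.
Local Notation mu := (mu2 R).
Implicit Types (f w : plane R -> R) (p xi : plane R) (G : plane R -> R * R) (b : bool) (k : nat).

(** The function [expR (x / l) * (B - h x)] is nondecreasing, and it tends to [0]
    at minus infinity because [h] is bounded. *)
Lemma first_order_le_pos (h h' : R -> R) (l B M : R) : 0 < l ->
  (forall x, is_derive x (1:R) h (h' x)) -> (forall x, `|h x| <= M) ->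
  (forall x, h x + l * h' x <= B) -> forall x, h x <= B.
Proof.
move=> l0 dh hM hB x; rewrite leNgt; apply/negP => Bx.
set d := h x - B; have d0 : 0 < d by rewrite subr_gt0.
have M0 : 0 <= M by apply: le_trans (hM x).
pose K := M + `|B|; have K0 : 0 <= K by rewrite addr_ge0.
(* Going back by [l * t] makes [expR t], larger than [1 + t], exceed [K / d]. *)
pose t := K / d; have t0 : 0 <= t by rewrite divr_ge0// ltW.
pose g y := expR (y / l) * (B - h y).
have dg y : is_derive y (1:R) g (expR (y / l) / l * (B - (h y + l * h' y))).
  have de : is_derive y (1:R) (fun z : R => expR (z / l)) (expR (y / l) * l^-1).
    have dl : is_derive y (1:R) (fun z : R => z / l) l^-1.
      by apply: is_derive_eq; rewrite /GRing.scale/=; ring.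
    exact: (@is_derive1_comp _ (@expR R) (fun z => z / l)).
  have dh' := dh y; rewrite /g; apply: is_derive_eq; rewrite /GRing.scale/=.
  by field; rewrite gt_eqF.
have cg : continuous g.
  by move=> y; apply: differentiable_continuous; apply/derivable1_diffP; have := dg y.
have lt0 : 0 <= l * t by rewrite mulr_ge0// ltW.
have mono : g (x - l * t) <= g x.
  apply: (@ger0_derive1_ndecr _ g (x - l * t) x) => //; last by rewrite lerBlDr lerDl.
  - move=> y _; have dgy := dg y; rewrite derive1E derive_val.
    by rewrite mulr_ge0 ?subr_ge0// divr_ge0 ?ltW// expR_gt0.
  - exact: continuous_subspaceT.
move: mono; rewrite /g (_ : (x - l * t) / l = x / l - t); last by field; rewrite gt_eqF.
rewrite expRD expRN -mulrA ler_pM2l ?expR_gt0// -[leRHS]opprB -/d => mono.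
have e1 := expR_ge1Dx t; have e0 := expR_gt0 t.
have {}mono : B - h (x - l * t) <= - d * expR t.
  by rewrite -ler_pdivrMr// mulrC.
have low : - K <= B - h (x - l * t).
  have := hM (x - l * t); rewrite ler_norml => /andP[_ up].
  have := ler_norm (- B); rewrite normrN => nB; rewrite /K; lra.
have : d * (1 + t) <= d * expR t by rewrite ler_pM2l.
rewrite mulNr in mono; rewrite mulrDr mulr1 /t mulrCA mulfV ?gt_eqF// mulr1; move: (d * expR t) mono => u; lra.
Qed.

Lemma first_order_le (h h' : R -> R) (l B M : R) :
  (forall x, is_derive x (1:R) h (h' x)) -> (forall x, `|h x| <= M) ->
  (forall x, h x + l * h' x <= B) -> forall x, h x <= B.
Proof.
move=> dh hM hB; have [l0|l0|l0] := ltgtP l 0; last 2 first.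
- exact: (first_order_le_pos l0 dh hM hB).
- by move=> x; have := hB x; rewrite l0 mul0r addr0.
move=> x; rewrite -[x]opprK.
have l0' : 0 < - l by rewrite oppr_gt0.
apply: (@first_order_le_pos (fun y => h (- y)) (fun y => - h' (- y)) (- l) B M l0').
- move=> y; have dn : is_derive y (1:R) (fun z : R => - z) (- 1) by apply: is_derive_eq.
  have dhy := dh (- y).
  by rewrite -mulrN1; exact: (@is_derive1_comp _ h (fun z => - z)).
- by move=> y; exact: hM.
- by move=> y; rewrite mulrNN; exact: hB.
Qed.

(** [1 - l ^+ 2 d^2/dx^2] is the product of [1 - l d/dx] and [1 + l d/dx]. *)
Lemma second_order_le (h h1 h2 : R -> R) (l B M M1 : R) :
  (forall x, is_derive x (1:R) h (h1 x)) -> (forall x, is_derive x (1:R) h1 (h2 x)) ->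
  (forall x, `|h x| <= M) -> (forall x, `|h1 x| <= M1) ->
  (forall x, h x - l ^+ 2 * h2 x <= B) -> forall x, h x <= B.
Proof.
move=> dh dh1 hM h1M hB; apply: (first_order_le (h' := h1) (l := l) (M := M)) => //.
apply: (@first_order_le (fun x => h x + l * h1 x) (fun x => h1 x + l * h2 x) (- l) B (M + `|l| * M1)).
- by move=> x; rewrite (le_trans (ler_normD _ _))// lerD// normrM ler_wpM2l.
- move=> x; have := hB x; apply: le_trans; rewrite le_eqVlt; apply/orP; left; apply/eqP; ring.
Qed.

Variable s : R.
Hypothesis s_gt0 : 0 < s.

Lemma resolvent_le (lam A B : R) f p : 0 <= lam -> smooth s 2 A f ->
  (forall p, `|f p - lam * sder s true (sder s true f) p| <= B) -> `|f p| <= B.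
Proof.
move=> lam0 hf hB; have hf1 := smooth_sder true hf.
have d1 q : is_derive (coord true q) (1:R) (slice true f q) (sder s true f q).
  by rewrite /sder mul1r; exact: (is_derive_slice q (coord true q) (smooth_derivable (b := true) hf)).
have d2 q : is_derive (coord true q) (1:R) (slice true (sder s true f) q) (sder s true (sder s true f) q).
  rewrite {2}/sder mul1r.
  exact: (is_derive_slice q (coord true q) (smooth_derivable (b := true) hf1)).
have lE : lam = Num.sqrt lam ^+ 2 by rewrite sqr_sqrtr.
rewrite ler_norml; apply/andP; split.
  rewrite lerNl; suff : forall x, - slice true f p x <= B by move/(_ p.1); case: (p).
  apply: (@second_order_le (fun x => - slice true f p x) (fun x => - slice true (sder s true f) p x)
    (fun x => - slice true (sder s true (sder s true f)) p x) (Num.sqrt lam) B A A).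
  - by move=> x; have h := d1 (x, p.2); apply: is_deriveN.
  - by move=> x; have h := d2 (x, p.2); apply: is_deriveN.
  - by move=> x; rewrite normrN; exact: smooth_le hf.
  - by move=> x; rewrite normrN; exact: smooth_le hf1.
  - move=> x; rewrite -lE; have := hB (x, p.2); rewrite ler_norml => /andP[h _] /=; lra.
suff : forall x, slice true f p x <= B by move/(_ p.1); case: (p).
apply: (@second_order_le (slice true f p) (slice true (sder s true f) p)
    (slice true (sder s true (sder s true f)) p) (Num.sqrt lam) B A A).
- by move=> x; exact: (d1 (x, p.2)).
- by move=> x; exact: (d2 (x, p.2)).
- by move=> x; exact: smooth_le hf.
- by move=> x; exact: smooth_le hf1.
- move=> x; rewrite -lE; have := hB (x, p.2); rewrite ler_norml => /andP[_ h] /=; lra.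
Qed.

(** Since [f * d^2 f/dx^2] integrates to minus the integral of the square of
    [df/dx], adding [- lam * d^2/dx^2] increases the [L^2] norm. *)
Lemma resolvent_L2 (lam A : R) f : 0 <= lam -> smooth s 3 A f ->
  (\int[mu]_p (f p ^+ 2)%:E <=
   \int[mu]_p ((f p - lam * sder s true (sder s true f) p) ^+ 2)%:E)%E.
Proof.
move=> lam0 hf; have hf1 := smooth_sder true hf; have hf2 := smooth_sder true hf1.
set f1 := sder s true f in hf1 hf2 *; set f2 := sder s true f1 in hf2 *.
have l0 := smooth_L2 hf; have l1 := smooth_L2 hf1; have l2 := smooth_L2 hf2.
have [m0 q0] := (square_integrableP mu f).1 l0.
have [m1 q1] := (square_integrableP mu f1).1 l1.
have [m2 q2] := (square_integrableP mu f2).1 l2.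
have q02 := square_integrable_mul l0 l2.
have parts : \int[mu]_p (f1 p ^+ 2 + f p * f2 p) = 0.
  apply: (@integral_derivative R true (fun p => f p * f1 p) _ (A * A)).
  - move=> p; have d := is_derive_slice p (coord true p) (smooth_derivable (b := true) hf).
    have d1 := is_derive_slice p (coord true p) (smooth_derivable (b := true) hf1).
    have -> : slice true (fun p => f p * f1 p) p = slice true f p * slice true f1 p by [].
    apply: is_derive_eq; rewrite /f2 /f1 /sder /GRing.scale/= !mul1r; case: p {d d1} => x y /=.
    by ring.
  - move=> p; have c0 := @continuous_slice R true _ (smooth_derivable (b := true) hf) p.
    have c1 := @continuous_slice R true _ (smooth_derivable (b := true) hf1) p.
    have c2 := @continuous_slice R true _ (smooth_derivable (b := true) hf2) p.
    by move=> t; apply: cvgD; apply: cvgM; [exact: c1|exact: c1|exact: c0|exact: c2].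
  - by move=> p; rewrite normrM ler_pM//; [exact: smooth_le hf|exact: smooth_le hf1].
  - exact: square_integrable_mul l0 l1.
  - exact: L1D q1 q02.
have mf2 : measurable_fun setT (fun p => f p - lam * f2 p).
  exact: (measurable_funB m0 (measurable_funM (measurable_cst _) m2)).
have l02 : L2 (fun p => f p + - lam * f2 p) := square_integrableD l0 (square_integrableZ (- lam) l2).
have eqf : (fun p => f p + - lam * f2 p) = (fun p => f p - lam * f2 p).
  by apply/funext => p; rewrite mulNr.
rewrite eqf in l02.
have [_ q] := (square_integrableP mu _).1 l02.
rewrite (L1_EFin q0) (L1_EFin q) lee_fin.
have qs := L1D q1 q02.
have -> : \int[mu]_p (f p ^+ 2) = \int[mu]_p (f p ^+ 2 - 2 * lam * (f1 p ^+ 2 + f p * f2 p)).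
  by rewrite (RintB q0 (L1Z (2 * lam) qs)) (RintZ _ qs) parts mulr0 subr0.
apply: (le_Rint (L1B q0 (L1Z (2 * lam) qs)) q) => p.
have := mulr_ge0 lam0 (sqr_ge0 (f1 p)); have := sqr_ge0 (lam * f2 p).
by rewrite sqrrB exprMn mulrDr mulrA; nra.
Qed.

Lemma symbolC b b' G : symbol s b (symbol s b' G) = symbol s b' (symbol s b G).
Proof. by apply/funext => xi; rewrite /symbol/=; congr pair; ring. Qed.

(** The operator commutes with the derivations, so that the bounds of order zero
    propagate to all derivatives. *)
Lemma resolvent_smooth (lam A B : R) k G : 0 <= lam -> 0 <= A -> spectral s k.+4.+1 A G ->
  smooth s k B (fun p => inverse_transform G p -
    lam * sder s true (sder s true (inverse_transform G)) p) ->
  smooth s k B (inverse_transform G).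
Proof.
move=> lam0 A0; elim: k G => [|k IH] G hG; set f := inverse_transform G => hB.
all: have hf3 : smooth s 3 A f by apply: (spectral_smooth s_gt0 A0); exact: (spectral_leq _ hG).
all: have base : bounded2 s B f.
1,3: by split; [exact: smooth_measurable hf3|
  move=> p; exact: (resolvent_le p lam0 (smoothS hf3) (fun q => smooth_le q hB))|
  apply: (le_trans (resolvent_L2 lam0 hf3)); have [] := smooth_bounded2 hB].
  by split.
split => // b; have [_ /(_ b)[_ hBd]] := hB.
have [d0 e0] := sder_inverse_transform s_gt0 b (spectral_leq (isT : (3 <= k.+4.+2)%N) hG).
split; first exact: d0.
rewrite e0; apply: IH; first exact: spectral_symbol.
rewrite -/f in hBd *.
have hG3 := spectral_leq (isT : (3 <= k.+4.+1)%N) (spectral_symbol true hG).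
have [dt et] := sder_inverse_transform s_gt0 true (spectral_leq (isT : (3 <= k.+4.+2)%N) hG).
have [dtt ett] := sder_inverse_transform s_gt0 true hG3.
have hG4 := spectral_leq (isT : (3 <= k.+4)%N) (spectral_symbol true (spectral_symbol true hG)).
have [dttb ettb] := sder_inverse_transform s_gt0 b hG4.
have hGb3 := spectral_leq (isT : (3 <= k.+4.+1)%N) (spectral_symbol b hG).
have [_ ebt] := sder_inverse_transform s_gt0 true hGb3.
have hGb4 := spectral_leq (isT : (3 <= k.+4)%N) (spectral_symbol true (spectral_symbol b hG)).
have [_ ebtt] := sder_inverse_transform s_gt0 true hGb4.
have comm : sder s true (sder s true (inverse_transform (symbol s b G))) =
    sder s b (sder s true (sder s true f)).
  by rewrite ebt ebtt /f et ett ettb (symbolC b) (symbolC b).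
have dtt2 : partial_derivable b (sder s true (sder s true f)) by rewrite /f et ett.
rewrite comm; move: hBd.
have -> : (fun p => f p - lam * sder s true (sder s true f) p) =
    (fun p => f p + - lam * sder s true (sder s true f) p).
  by apply/funext => p; rewrite mulNr.
rewrite (sderD _ d0 (partial_derivableZ dtt2 (c := - lam))) (sderZ _ _ dtt2) -e0.
by congr (smooth s k B); apply/funext => p; rewrite mulNr.
Qed.
End resolvent.

(** * Continuous curves *)
Section curves.
Context {R : realType}.
Implicit Types (f g : plane R -> R) (p : plane R) (b : bool) (k : nat) (u v : R -> plane R -> R).
Variables (s : R) (J : set R).
Hypothesis s_gt0 : 0 < s.
Let s_ge0 : 0 <= s := ltW s_gt0.

(** Continuity on [J] for the bounds that define [smooth]. *)
Definition continuous_smooth k u := forall t0, J t0 -> forall e : R, 0 < e ->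
  \forall t \near within J (nbhs t0), smooth s k e (fun p => u t p - u t0 p).

Definition bounded_smooth k (B : R) u := forall t, J t -> smooth s k B (u t).

Lemma nearJ (t0 : R) : \forall t \near within J (nbhs t0), J t.
Proof. by rewrite near_withinE; near=> t. Unshelve. all: by end_near. Qed.

Lemma continuous_smooth_leq k k' u : (k' <= k)%N -> continuous_smooth k u -> continuous_smooth k' u.
Proof.
move=> kk hu t0 Jt0 e e0; apply: filterS (hu t0 Jt0 e e0) => t; exact: smooth_leq.
Qed.

Lemma continuous_smoothD k u v : continuous_smooth k u -> continuous_smooth k v ->
  continuous_smooth k (fun t p => u t p + v t p).
Proof.
move=> hu hv t0 Jt0 e e0; have e4 : 0 < e / 4 by rewrite divr_gt0.
apply: filterS2 (hu t0 Jt0 _ e4) (hv t0 Jt0 _ e4) => t h1 h2.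
have -> : (fun p => u t p + v t p - (u t0 p + v t0 p)) =
   (fun p => (u t p - u t0 p) + (v t p - v t0 p)) by apply/funext => p; ring.
have := smoothD s_ge0 h1 h2; have -> : 2 * (e / 4 + e / 4) = e by field.
by [].
Qed.

Lemma continuous_smoothZ k (c : R) u : continuous_smooth k u ->
  continuous_smooth k (fun t p => c * u t p).
Proof.
move=> hu t0 Jt0 e e0.
have c0 : 0 < `|c| + 1 by rewrite ltr_wpDl.
have ec : 0 < e / (`|c| + 1) by rewrite divr_gt0.
apply: filterS (hu t0 Jt0 _ ec) => t h.
have -> : (fun p => c * u t p - c * u t0 p) = (fun p => c * (u t p - u t0 p)).
  by apply/funext => p; ring.
apply: (smoothW s_ge0 _ (smoothZ c h)).
by rewrite mulrCA ler_piMr ?(ltW e0)// ler_pdivrMr// mul1r lerDl.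
Qed.

Lemma continuous_smoothM k B C u v : bounded_smooth k B u -> bounded_smooth k C v ->
  continuous_smooth k u -> continuous_smooth k v ->
  continuous_smooth k (fun t p => u t p * v t p).
Proof.
move=> bu bv hu hv t0 Jt0 e e0.
have B0 := smooth_ge0 (bu t0 Jt0); have C0 := smooth_ge0 (bv t0 Jt0).
pose A : R := 2 * 4 ^+ k * (B + C); have A0 : 0 <= A by rewrite !mulr_ge0 ?addr_ge0// exprn_ge0.
have A1 : 0 < A + 1 by rewrite ltr_wpDl.
have ec : 0 < e / (A + 1) by rewrite divr_gt0.
apply: filterS3 (nearJ t0) (hu t0 Jt0 _ ec) (hv t0 Jt0 _ ec) => t Jt h1 h2.
have -> : (fun p => u t p * v t p - u t0 p * v t0 p) =
   (fun p => (u t p - u t0 p) * v t p + u t0 p * (v t p - v t0 p)) by apply/funext => p; ring.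
apply: (smoothW s_ge0 _ (smoothD s_ge0 (smoothM s_ge0 h1 (bv t Jt)) (smoothM s_ge0 (bu t0 Jt0) h2))).
have -> : 2 * (4 ^+ k * (e / (A + 1) * C) + 4 ^+ k * (B * (e / (A + 1)))) = A * (e / (A + 1)).
  by rewrite /A; ring.
by rewrite mulrCA ler_piMr ?(ltW e0)// ler_pdivrMr// mul1r lerDl.
Qed.

Lemma smoothB_sder b k B C D f g : smooth s k.+1 B f -> smooth s k.+1 C g ->
  smooth s k.+1 D (fun p => f p - g p) -> smooth s k D (fun p => sder s b f p - sder s b g p).
Proof.
move=> hf hg h; have df := smooth_derivable (b := b) hf; have dg := smooth_derivable (b := b) hg.
have -> : (fun p => sder s b f p - sder s b g p) = sder s b (fun p => f p - g p).
  have -> : (fun p => f p - g p) = (fun p => f p + (-1) * g p) by apply/funext => p; ring.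
  rewrite (sderD _ df (partial_derivableZ dg (c := -1))) (sderZ _ _ dg).
  by apply/funext => p; ring.
exact: smooth_sder.
Qed.

Lemma continuous_smooth_sder b k B u : bounded_smooth k.+1 B u -> continuous_smooth k.+1 u ->
  continuous_smooth k (fun t => sder s b (u t)).
Proof.
move=> bu hu t0 Jt0 e e0; apply: filterS2 (nearJ t0) (hu t0 Jt0 e e0) => t Jt h.
exact: (smoothB_sder b (bu t Jt) (bu t0 Jt0)).
Qed.

End curves.

Section sobolev_curves.
Context {R : realType}.
Implicit Types (f g : plane R -> R) (p : plane R) (b : bool) (k : nat) (u v : R -> plane R -> R).
Variables (s : R) (J : set R).
Hypotheses (s_gt0 : 0 < s) (s_le1 : s <= 1).
Let s_ge0 : 0 <= s := ltW s_gt0.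

(** The norms of order [0] and [k + 2] of the increments suffice. *)
Lemma C_Hs_continuous_smooth k (sigma : R) u : k.+2%:R <= sigma -> C_Hs (s ^+ 2) sigma J u ->
  (forall t, J t -> continuous (u t)) -> continuous_smooth s J k u.
Proof.
move=> ks hu cu t0 Jt0 e e0; have [h0 lim] := hu t0 Jt0.
pose e' := e / 2 ^+ k.+3; have e'0 : 0 < e' by rewrite divr_gt0// exprn_gt0.
have e'2 : (0 < (e' ^+ 2)%:E)%E by rewrite lte_fin exprn_gt0.
have sigma0 : 0 <= sigma by apply: le_trans ks.
have small (tau : R) : 0 <= tau <= sigma -> \forall t \near within J (nbhs t0),
    (Hnorm2 (s ^+ 2) tau (u t \- u t0)%R <= (e' ^+ 2)%:E)%E.
  move=> /lim l; have : nbhs (0 : \bar R)%E [set x | (x < (e' ^+ 2)%:E)%E].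
    exists (e' ^+ 2) => /=; first by rewrite exprn_gt0.
    by move=> y /=; rewrite sub0r normrN lte_fin; apply: le_lt_trans; exact: ler_norm.
  move=> /l h; have h' : \forall t \near within J (nbhs t0),
    (Hnorm2 (s ^+ 2) tau (u t \- u t0)%R < (e' ^+ 2)%:E)%E := h.
  by apply: filterS h' => t; exact: ltW.
have z1 : (0:R) <= 0 <= sigma by rewrite lexx.
have z2 : (0:R) <= k.+2%:R <= sigma by rewrite ler0n.
apply: filterS3 (nearJ J t0) (small _ z1) (small _ z2) => t Jt h1 h2.
have -> : e = 2 ^+ k.+3 * e' by rewrite /e' mulrCA mulfV ?mulr1// gt_eqF// exprn_gt0.
have [ht _] := hu t Jt.
have eqf : (fun p => u t p + (-1) * u t0 p) = u t \- u t0 by apply/funext => p /=; ring.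
have hd : Hs sigma (u t \- u t0) by rewrite -eqf; exact: HsD.
have cd : continuous (u t \- u t0) by move=> p; apply: cvgB; [exact: cu|exact: cu].
exact: (Hs_smooth s_gt0 s_le1 ks (ltW e'0) hd cd h1 h2).
Qed.

Lemma le_Hs_bounded_smooth k (sigma M : R) u : k.+2%:R <= sigma ->
  (forall t, J t -> [/\ Hs sigma (u t), continuous (u t) & le_Hs (s ^+ 2) sigma M (u t)]) ->
  bounded_smooth s J k (2 ^+ k.+3 * `|M|) u.
Proof.
move=> ks hu t Jt; have [h c l] := hu t Jt.
have sigma0 : 0 <= sigma by apply: le_trans ks.
have M2 : `|M| ^+ 2 = M ^+ 2 by rewrite real_normK ?num_real.
apply: (@Hs_smooth R s s_gt0 s_le1 k sigma) => //; rewrite M2; apply: l; rewrite ?lexx//.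
by rewrite ler0n.
Qed.

Lemma C_Hs_le (sigma sigma' : R) (J' : set R) eps u : sigma' <= sigma -> J' `<=` J ->
  C_Hs eps sigma J u -> C_Hs eps sigma' J' u.
Proof.
move=> ss JJ hu t0 Jt0; have [h l] := hu t0 (JJ _ Jt0); split; first exact: Hs_le h.
move=> tau /andP[t1 t2]; have /l : 0 <= tau <= sigma by rewrite t1 (le_trans t2).
apply: cvg_trans; apply: cvg_app; exact: within_subset.
Qed.

Lemma C_HsD (sigma c : R) u v : C_Hs (s ^+ 2) sigma J u -> C_Hs (s ^+ 2) sigma J v ->
  C_Hs (s ^+ 2) sigma J (fun t p => u t p + c * v t p).
Proof.
move=> hu hv t0 Jt0; have [u0 lu] := hu t0 Jt0; have [v0 lv] := hv t0 Jt0.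
split; first exact: HsD.
move=> tau ht; have tsig : tau <= sigma by case/andP: ht.
have lim : (2%:E * Hnorm2 (s ^+ 2) tau (u t \- u t0)%R +
    (2 * c ^+ 2)%:E * Hnorm2 (s ^+ 2) tau (v t \- v t0)%R)%E @[t --> within J (nbhs t0)] --> (0 : \bar R)%E.
  rewrite [X in _ --> X](_ : _ = (2%:E * 0 + (2 * c ^+ 2)%:E * 0)%E); last by rewrite !mule0 adde0.
  apply: cvgeD; first by rewrite !mule0.
    by apply: cvgeZl => //; exact: lu.
  by apply: cvgeZl => //; exact: lv.
apply: (squeeze_cvge _ (cvg_cst _) lim).
have := nearJ J t0; apply: filterS => t Jt; rewrite Hnorm2_ge0//=.
have [ut _] := hu t Jt; have [vt _] := hv t Jt.
have eqf f g : (fun p => f p + (-1) * g p) = f \- g :> (plane R -> R) by apply/funext => p /=; ring.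
have hd : Hs tau (u t \- u t0) by rewrite -eqf; apply: (Hs_le tsig); exact: HsD.
have hd' : Hs tau (v t \- v t0)%R by rewrite -eqf; apply: (Hs_le tsig); exact: HsD.
have -> : (fun p => u t p + c * v t p) \- (fun p => u t0 p + c * v t0 p) =
    (fun p => (u t \- u t0) p + c * (v t \- v t0) p) by apply/funext => p /=; ring.
exact: (Hnorm2D s_gt0 c hd hd').
Qed.

Lemma smooth_le_Hs k (B sigma : R) f : smooth s k.+1 B f -> integrable_derivatives s k.+1 f ->
  0 <= sigma <= k%:R -> Hs sigma f /\ le_Hs (s ^+ 2) sigma (spectral_cst k * B) f.
Proof.
move=> hf hi hs; split; first exact: (smooth_Hs s_gt0 s_le1 hf hi).
move=> tau /andP[t0 ts]; apply: (smooth_Hnorm2 s_gt0 hf hi).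
by rewrite t0 (le_trans ts)//; case/andP: hs.
Qed.

Lemma integrable_derivativesB k (B C : R) f g : smooth s k B f -> smooth s k C g ->
  integrable_derivatives s k f -> integrable_derivatives s k g ->
  integrable_derivatives s k (fun p => f p - g p).
Proof.
move=> hf hg fi gi.
have -> : (fun p => f p - g p) = (fun p => f p + (-1) * g p) by apply/funext => p; ring.
apply: (integrable_derivativesD hf (smoothZ (-1) hg) fi).
exact: (integrable_derivativesZ (-1) hg gi).
Qed.

Lemma cvge0_le {I : Type} (F : set_system I) {FF : Filter F} (x : I -> \bar R) :
  (forall e : R, 0 < e -> \forall i \near F, (0 <= x i <= e%:E)%E) -> x i @[i --> F] --> 0%E.
Proof.
move=> hx A [e /= e0 hA]; have e2 : 0 < e / 2 by rewrite divr_gt0.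
apply: filterS (hx _ e2) => i /=; case: (x i) => [r| |]//= /andP[r0 re].
by apply: hA => /=; rewrite sub0r normrN ger0_norm//; have h : r <= e / 2 := re; lra.
by move: re; rewrite leye_eq.
Qed.

(** The converse passage, for functions with integrable derivatives. *)
Lemma smooth_cvg0_Hs {I : Type} (F : set_system I) {FF : Filter F} k (h : I -> plane R -> R) (sigma : R) :
  sigma <= k%:R ->
  (forall e : R, 0 < e ->
     \forall i \near F, smooth s k.+1 e (h i) /\ integrable_derivatives s k.+1 (h i)) ->
  cvg0_Hs (s ^+ 2) sigma F h.
Proof.
move=> sk hh tau /andP[t0 ts]; apply: cvge0_le => e e0.
have c0 : 0 < spectral_cst k :> R := lt_le_trans ltr01 (spectral_cst_ge1 k).
have se : 0 < Num.sqrt e by rewrite sqrtr_gt0.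
have ce : 0 < Num.sqrt e / spectral_cst k by rewrite divr_gt0.
apply: filterS (hh _ ce) => i [hs hi]; rewrite Hnorm2_ge0//=.
have tk : 0 <= tau <= k%:R by rewrite t0 (le_trans ts).
have := smooth_Hnorm2 s_gt0 hs hi tk.
by rewrite mulrCA mulfV ?gt_eqF// mulr1 sqr_sqrtr// ltW.
Qed.

End sobolev_curves.

(** * Strong measurability *)
Section step_functions.
Context {R : realType}.
Implicit Types (f g : plane R -> R) (p : plane R) (k : nat) (r : R -> plane R -> R).
Variable T : R.
Hypothesis T_gt0 : 0 < T.

Let J : set R := [set t | 0 < t < T].

(** The equations hold on the open interval only; the value [0] outside of it
    makes the step functions converge at the end points too. *)
Definition extend0 r (t : R) : plane R -> R := if 0 < t < T then r t else fun=> 0.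

(** The number of the cell of length [T / (n + 1)] that contains [t], counted from
    [1]; [0] outside of the interval. *)
Definition cell (n : nat) (t : R) : nat :=
  if 0 < t < T then (Num.truncn (t * n.+1%:R / T)).+1 else 0%N.

Definition midpoint (n j : nat) : R := (j%:R + 2^-1) * T / n.+1%:R.

Definition step r (n i : nat) : plane R -> R :=
  if i is j.+1 then extend0 r (midpoint n j) else fun=> 0.

Lemma cell_itv n j (t : R) : 0 < t < T ->
  (cell n t == j.+1) = (j%:R * T / n.+1%:R <= t < j.+1%:R * T / n.+1%:R).
Proof.
move=> Jt; have /andP[t0 tT] := Jt; rewrite /cell Jt eqSS.
have x0 : 0 <= t * n.+1%:R / T by rewrite divr_ge0 ?mulr_ge0 ?ler0n ?ltW.
rewrite ler_pdivrMr ?ltr0Sn// ltr_pdivlMr ?ltr0Sn// -ler_pdivlMr// -ltr_pdivrMr//.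
by rewrite truncn_eq.
Qed.

Lemma cell_le n (t : R) : (cell n t <= n.+1)%N.
Proof.
rewrite /cell; case: ifP => // /andP[t0 tT]; rewrite ltnS -ltnS.
have x0 : 0 <= t * n.+1%:R / T by rewrite divr_ge0 ?mulr_ge0 ?ler0n ?ltW.
have /andP[h _] := truncn_itv x0.
rewrite -(ltr_nat R); apply: (le_lt_trans h); rewrite ltr_pdivrMr// mulrC ltr_pM2l ?ltr0Sn//.
Qed.

Lemma midpoint_near n (t : R) : 0 < t < T ->
  0 < midpoint n (cell n t).-1 < T /\ `|midpoint n (cell n t).-1 - t| <= T / n.+1%:R.
Proof.
move=> Jt; have := cell_le n t; case E : (cell n t) => [|j] /=; first by move: E; rewrite /cell Jt.
rewrite ltnS => jn; have : cell n t == j.+1 by rewrite E.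
rewrite (cell_itv n j Jt); set d := T / n.+1%:R.
have d0 : 0 < d by rewrite divr_gt0 ?ltr0Sn.
rewrite /midpoint -!mulrA -/d => /andP[h1 h2].
have jR : j%:R + 1 <= n.+1%:R :> R by rewrite -natr1 lerD2r ler_nat.
have nd : n.+1%:R * d = T by rewrite /d mulrCA mulfV ?mulr1// gt_eqF// ltr0Sn.
have j0 : 0 <= j%:R :> R by rewrite ler0n.
rewrite -natr1 in h2; split.
  apply/andP; split; first by rewrite mulr_gt0// ltr_wpDl.
  by rewrite -nd ltr_pM2r//; lra.
rewrite ler_norml; apply/andP; split; nra.
Qed.

Lemma measurable_cell n i : measurable (cell n @^-1` [set i] : set (measurableTypeR R)).
Proof.
case: i => [|j].
  have -> : cell n @^-1` [set 0%N] = ~` `]0, T[%classic.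
    apply/seteqP; split => t /=; rewrite /cell in_itv/=; first by case: ifP.
    by case: ifP.
  by apply: measurableC; exact: measurable_itv.
have -> : cell n @^-1` [set j.+1] =
    `]0, T[%classic `&` `[j%:R * T / n.+1%:R, j.+1%:R * T / n.+1%:R[%classic.
  apply/seteqP; split => t /=; rewrite !in_itv/=.
    move=> h; have Jt : 0 < t < T by move: h; rewrite /cell; case: ifP.
    by split => //; rewrite -(cell_itv n j Jt) h.
  by move=> [Jt h]; apply/eqP; rewrite (cell_itv n j Jt).
by apply: measurableI; exact: measurable_itv.
Qed.

Variable s : R.
Hypotheses (s_gt0 : 0 < s) (s_le1 : s <= 1).

(** Strong measurability of a continuous curve: it is the limit of the step
    functions equal on each cell of a uniform grid to its value at the middle. *)
Lemma Linfty_Hs_extend0 k (B sigma : R) r : 0 <= sigma <= k%:R ->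
  bounded_smooth s J k.+1 B r ->
  (forall t, J t -> integrable_derivatives s k.+1 (r t)) ->
  continuous_smooth s J k.+1 r ->
  Linfty_Hs (s ^+ 2) sigma T (spectral_cst k * B) (extend0 r).
Proof.
move=> hs hB hi hc; have s0 := ltW s_gt0.
have B0 : 0 <= B.
  have JT : J (T / 2) by have := T_gt0; rewrite /J/= => T0; apply/andP; split; lra.
  exact: (smooth_ge0 (hB _ JT)).
have eB t : smooth s k.+1 B (extend0 r t).
  rewrite /extend0; case: ifP => [Jt|_]; first exact: hB.
  exact: (smoothW s0 B0 (smooth0 s _)).
have ei t : integrable_derivatives s k.+1 (extend0 r t).
  rewrite /extend0; case: ifP => [Jt|_]; first exact: hi.
  exact: integrable_derivatives0.
have eH t := smooth_le_Hs s_gt0 s_le1 (eB t) (ei t) hs.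
split; last first.
  by apply: (@filterS _ _ _ setT) => [t _ _|]; [exact: eH|exact: filterT].
exists (fun n t => step r n (cell n t)); split.
  move=> n; split.
  - apply: (@sub_finite_set _ _ (step r n @` `I_n.+2)); last first.
      by apply: finite_image; exact: finite_II.
    by move=> _ [t _ <-]; exists (cell n t) => //=; rewrite ltnS cell_le.
  - move=> h.
    have -> : (fun t => step r n (cell n t)) @^-1` [set h] =
       \bigcup_(i in [set i | step r n i = h]) (cell n @^-1` [set i]).
      apply/seteqP; split => t /=; first by move=> e; exists (cell n t).
      by move=> [i /= <- ->].
    by apply: bigcup_measurable => i _; exact: measurable_cell.
  - move=> t; case: (cell n t) => [|j]; last exact: (eH _).1.
    have := eH 0; rewrite /extend0 ltxx/= => -[h _]; exact: h.
apply: (@filterS _ _ _ setT) => [t _ _|]; last exact: filterT.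
have [_ sk] := andP hs.
apply: (smooth_cvg0_Hs s_gt0 sk).
move=> e e0; have [Jt|nJt] := boolP (0 < t < T); last first.
  apply: nearW => n.
  have -> : extend0 r t \- step r n (cell n t) = (fun=> 0).
    by apply/funext => p; rewrite /extend0 /cell (negbTE nJt) /= subr0.
  split; [exact: (smoothW s0 (ltW e0) (smooth0 s _))|exact: integrable_derivatives0].
have := hc t Jt e e0; rewrite near_withinE => /nbhs_ballP[d dpos hd]; have d0 : 0 < d := dpos.
have lim : T * n.+1%:R^-1 @[n --> \oo] --> T * 0 by apply: cvgM; [exact: cvg_cst|exact: cvg_harmonic].
rewrite mulr0 in lim; move/cvgrPdist_lt : lim => /(_ _ d0); apply: filterS => n.
rewrite sub0r normrN ger0_norm ?divr_ge0 ?ler0n ?(ltW T_gt0)// => nd.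
have [Jm mt] := midpoint_near n Jt.
have ball_m : ball t d (midpoint n (cell n t).-1).
  by rewrite /ball/= distrC (le_lt_trans mt).
have hm := hd _ ball_m Jm.
have -> : extend0 r t \- step r n (cell n t) =
    (fun p => (-1) * (r (midpoint n (cell n t).-1) p - r t p)).
  have : cell n t = (cell n t).-1.+1 by rewrite /cell Jt.
  move=> ->; apply/funext => p; rewrite /= /extend0 Jt Jm /=; ring.
split; first by have := smoothZ (-1) hm; rewrite normrN1 mul1r.
apply: (integrable_derivativesZ (-1) hm).
exact: (integrable_derivativesB (hB _ Jm) (hB _ Jt) (hi _ Jm) (hi _ Jt)).
Qed.

End step_functions.

(** * Bounds uniform in the parameter *)
(** Bounds uniform over a family of problems: the constant is chosen before the
    parameter [i], which stands for [eps] and the solution. *)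
Section families.
Context {R : realType} {I : Type}.
Implicit Types (u v : I -> R -> plane R -> R) (b : bool) (k : nat) (c : I -> R).
Variables (s : I -> R) (J : I -> set R).
Hypothesis s_gt0 : forall i, 0 < s i.
Let s_ge0 i : 0 <= s i := ltW (s_gt0 i).

Definition smooth_family k u := exists B, forall i,
  bounded_smooth (s i) (J i) k B (u i) /\ continuous_smooth (s i) (J i) k (u i).

Definition integrable_family k u := smooth_family k u /\
  forall i t, J i t -> integrable_derivatives (s i) k (u i t).

Lemma smooth_family_leq k k' u : (k' <= k)%N -> smooth_family k u -> smooth_family k' u.
Proof.
move=> kk [B hB]; exists B => i; have [h1 h2] := hB i; split.
  by move=> t Jt; exact: (smooth_leq kk (h1 t Jt)).
exact: (continuous_smooth_leq kk h2).
Qed.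

Lemma smooth_familyD k u v : smooth_family k u -> smooth_family k v ->
  smooth_family k (fun i t p => u i t p + v i t p).
Proof.
move=> [B hB] [C hC]; exists (2 * (B + C)) => i.
have [h1 h2] := hB i; have [g1 g2] := hC i; split.
  by move=> t Jt; exact: (smoothD (s_ge0 i) (h1 t Jt) (g1 t Jt)).
exact: (continuous_smoothD (s_gt0 i) h2 g2).
Qed.

Lemma smooth_familyZ k (A : R) c u : (forall i, `|c i| <= A) -> smooth_family k u ->
  smooth_family k (fun i t p => c i * u i t p).
Proof.
move=> cA [B hB]; exists (A * `|B|) => i; have [h1 h2] := hB i; split.
  move=> t Jt; have B0 := smooth_ge0 (h1 t Jt).
  apply: (smoothW (s_ge0 i) _ (smoothZ (c i) (h1 t Jt))).
  by rewrite (ger0_norm B0) ler_wpM2r.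
exact: (continuous_smoothZ (s_gt0 i) (c i) h2).
Qed.

Lemma smooth_familyM k u v : smooth_family k u -> smooth_family k v ->
  smooth_family k (fun i t p => u i t p * v i t p).
Proof.
move=> [B hB] [C hC]; exists (4 ^+ k * (B * C)) => i.
have [h1 h2] := hB i; have [g1 g2] := hC i; split.
  by move=> t Jt; exact: (smoothM (s_ge0 i) (h1 t Jt) (g1 t Jt)).
exact: (continuous_smoothM (s_gt0 i) h1 g1 h2 g2).
Qed.

Lemma smooth_family_sder b k u : smooth_family k.+1 u ->
  smooth_family k (fun i t => sder (s i) b (u i t)).
Proof.
move=> [B hB]; exists B => i; have [h1 h2] := hB i; split.
  by move=> t Jt; exact: (smooth_sder b (h1 t Jt)).
exact: (continuous_smooth_sder b h1 h2).
Qed.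

Lemma integrable_familyD k u v : integrable_family k u -> integrable_family k v ->
  integrable_family k (fun i t p => u i t p + v i t p).
Proof.
move=> [hu iu] [hv iv]; split; first exact: smooth_familyD.
move=> i t Jt; have [B hB] := hu; have [C hC] := hv.
exact: (integrable_derivativesD ((hB i).1 t Jt) ((hC i).1 t Jt) (iu i t Jt) (iv i t Jt)).
Qed.

Lemma integrable_familyZ k (A : R) c u : (forall i, `|c i| <= A) -> integrable_family k u ->
  integrable_family k (fun i t p => c i * u i t p).
Proof.
move=> cA [hu iu]; split; first exact: smooth_familyZ cA hu.
move=> i t Jt; have [B hB] := hu.
exact: (integrable_derivativesZ (c i) ((hB i).1 t Jt) (iu i t Jt)).
Qed.

Lemma integrable_familyM k u v : smooth_family k u -> smooth_family k v ->
  integrable_family k (fun i t p => u i t p * v i t p).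
Proof.
move=> hu hv; split; first exact: smooth_familyM.
move=> i t Jt; have [B hB] := hu; have [C hC] := hv.
exact: (integrable_derivativesM (s_ge0 i) ((hB i).1 t Jt) ((hC i).1 t Jt)).
Qed.

Lemma integrable_family_sder b k u : integrable_family k.+1 u ->
  integrable_family k (fun i t => sder (s i) b (u i t)).
Proof.
move=> [hu iu]; split; first exact: smooth_family_sder.
by move=> i t Jt; exact: (integrable_derivatives_sder b (iu i t Jt)).
Qed.

End families.

(** * Algebra of the substitution *)
Section residuals.
Context {R : realType}.
Implicit Types (h : plane R -> R) (p q : plane R) (u v w z : R -> plane R -> R) (B C D t : R).
Variable s : R.
Hypothesis s_gt0 : 0 < s.
Local Notation X := (sder s true).
Local Notation Y := (sder s false).
Local Notation eps := (s ^+ 2).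
Let s_ge0 : 0 <= s := ltW s_gt0.

(** With [eps = s ^+ 2] the fractional powers of [eps] are powers of [s], and the
    factors [s] combine with [dy] into [Y]. *)
Lemma powR_sqr_half : eps `^ (1 / 2) = s.
Proof. by rewrite mul1r powR12_sqrt ?sqr_ge0// sqrtr_sqr gtr0_norm. Qed.

Lemma powR_sqr_3half : eps `^ (3 / 2) = s ^+ 3.
Proof.
rewrite -(powR_mulrn 2 s_ge0) -powRrM -(powR_mulrn 3 s_ge0); congr (s `^ _).
by rewrite mulrCA mulfV ?mulr1// pnatr_eq0.
Qed.

Lemma sder_combination b (c : R) (h h' : plane R -> R) : partial_derivable b h -> partial_derivable b h' ->
  sder s b (fun p => h p + c * h' p) = fun p => sder s b h p + c * sder s b h' p.
Proof.
by move=> dh dh'; rewrite (sderD _ dh (partial_derivableZ dh' (c := c))) (sderZ _ _ dh').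
Qed.

Lemma one_dxxE (k : R) h p : one_dxx k h p = h p + k * X (X h) p.
Proof. by rewrite /one_dxx !sder_dx. Qed.

Lemma scaled_one_dxx_dy (k : R) B h p : smooth s 3 B h ->
  s * one_dxx k (dy h) p = Y h p + k * X (X (Y h)) p.
Proof.
move=> hh; have hY := smooth_sder false hh.
have dY := smooth_derivable (b := true) hY.
have dXY := smooth_derivable (b := true) (smooth_sder true hY).
have -> : dy h = fun p => s^-1 * Y h p.
  by apply/funext => q; rewrite sder_dy mulrA mulVf ?mul1r// gt_eqF.
rewrite one_dxxE (sderZ _ _ dY) (sderZ _ _ dXY); field.
by rewrite gt_eqF.
Qed.

Lemma B1E (a b : R) v w z t p : B1 a b eps v w z t p =
  one_dxx (- (b * eps)) (dt v t) p + (X (z t) p + a * eps * X (X (X (z t))) p)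
  + eps * (v t p * X (v t) p + 2^-1 * (w t p * X (w t) p)) + eps / 2 * (w t p * Y (v t) p).
Proof.
rewrite /B1 powR_sqr_3half (one_dxxE (a * eps)) -!(sder_dx s) (sder_dy s (v t)).
by congr (_ + _); rewrite exprS; ring.
Qed.

Lemma B1'E (a b : R) v w z t p : B1' a b eps v w z t p =
  B1 a b eps v w z t p + eps / 2 * (z t p * X (z t) p).
Proof. by rewrite /B1' /B1 !sder_dx. Qed.

Lemma B2E (e f B : R) v w z t p : smooth s 3 B (z t) -> B2 e f eps v w z t p =
  one_dxx (- (e * eps)) (dt w t) p + (Y (z t) p + f * eps * X (X (Y (z t))) p)
  + eps / 2 * (v t p * X (w t) p)
  + eps * (w t p * Y (w t) p + 2^-1 * (v t p * Y (v t) p)).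
Proof.
move=> hz; rewrite /B2 powR_sqr_half powR_sqr_3half (scaled_one_dxx_dy _ _ hz).
rewrite -!(sder_dx s) (sder_dy s (w t)) (sder_dy s (v t)).
by congr (_ + _); rewrite exprS; ring.
Qed.

Lemma B2'E (e f : R) v w z t p : B2' e f eps v w z t p =
  B2 e f eps v w z t p + eps / 2 * (z t p * Y (z t) p).
Proof.
rewrite /B2' /B2 powR_sqr_3half (sder_dy s (z t)).
move: (one_dxx _ (dt w t) p) (one_dxx _ (dy (z t)) p) (dx (w t) p) (dy (w t) p) (dy (v t) p).
by move: (dy (z t) p) (z t p) (w t p) (v t p) (eps `^ _) => *; rewrite exprS; ring.
Qed.

Lemma B3E (c d g B : R) v w z t p : smooth s 3 B (w t) -> B3 c d g eps v w z t p =
  (dt z t p - d * eps * X (X (dt z t)) p) + (X (v t) p + c * eps * X (X (X (v t))) p)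
  + (Y (w t) p + g * eps * X (X (Y (w t))) p)
  + eps * X (fun q => z t q * v t q) p + eps * Y (fun q => z t q * w t q) p.
Proof.
move=> hw; rewrite /B3 powR_sqr_half powR_sqr_3half (scaled_one_dxx_dy _ _ hw) !one_dxxE.
rewrite -!(sder_dx s) (sder_dy s (fun q => z t q * w t q)).
have swap (a1 a2 a3 a4 a5 m : R) : a1 + - (d * eps) * a2 + a3 + a4 + a5 + s ^+ 3 * m =
  a1 - d * eps * a2 + a3 + a4 + a5 + eps * (s * m) by rewrite exprS; ring.
exact: swap.
Qed.

Lemma B3'E (c d g B : R) v w z t p : smooth s 3 B (w t) -> B3' c d g eps v w z t p =
  (dt z t p - d * eps * X (X (dt z t)) p) + (X (v t) p + c * eps * X (X (X (v t))) p)
  + (Y (w t) p + g * eps * X (X (Y (w t))) p)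
  + eps * (v t p * X (z t) p + w t p * Y (z t) p)
  + eps / 2 * (z t p * X (v t) p + z t p * Y (w t) p).
Proof.
move=> hw; rewrite /B3' powR_sqr_half powR_sqr_3half (scaled_one_dxx_dy _ _ hw) !one_dxxE.
rewrite -!(sder_dx s) (sder_dy s (z t)) (sder_dy s (w t)).
have swap (a1 a2 a3 a4 a5 zy wy z0 v0 w0 : R) :
  a1 + - (d * eps) * a2 + a3 + a4 + eps * (v0 * a5) + s ^+ 3 * (w0 * zy)
    + eps / 2 * (z0 * X (v t) p) + s ^+ 3 / 2 * (z0 * wy) =
  a1 - d * eps * a2 + a3 + a4 + eps * (v0 * a5 + w0 * (s * zy))
    + eps / 2 * (z0 * X (v t) p + z0 * (s * wy)) by rewrite exprS; field.
exact: swap.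
Qed.

Lemma modified_heightE (k : R) z : modified_height k z =
  fun t p => z t p + - (k / 4) * (z t p * z t p).
Proof.
apply/funext => t; apply/funext => p.
by rewrite /modified_height real_normK ?num_real// expr2 mulNr.
Qed.

Lemma dt_modified_height (k : R) z t : (forall p, derivable (fun r : R => z r p) t 1) ->
  dt (modified_height k z) t = fun p => dt z t p + - (k / 2) * (z t p * dt z t p).
Proof.
move=> dz; apply/funext => p; rewrite modified_heightE /dt.
have d : is_derive t (1:R) (fun r => z r p) (derive1 (fun r => z r p) t).
  by rewrite derive1E; apply: DeriveDef.
rewrite [LHS]derive1E.
have d2 : is_derive t (1:R) (fun r => z r p + - (k / 4) * (z r p * z r p))
    (derive1 (fun r => z r p) t + - (k / 2) * (z t p * derive1 (fun r => z r p) t)).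
  by apply: is_derive_eq; rewrite /GRing.scale/=; field.
by rewrite derive_val.
Qed.

Definition residual1 (a : R) z t p : R :=
  - (3 / 8) * (z t p * z t p * X (z t) p)
  + eps / 16 * (z t p * z t p * z t p * X (z t) p)
  + - (a / 4) * X (X (X (fun q => z t q * z t q))) p.

Definition residual2 (f : R) z t p : R :=
  - (3 / 8) * (z t p * z t p * Y (z t) p)
  + eps / 16 * (z t p * z t p * z t p * Y (z t) p)
  + - (f / 4) * X (X (Y (fun q => z t q * z t q))) p.

(** By the third equation of the first system, [dt z + X v + Y w] is [eps] times
    this expression. *)
Definition mass_defect (c d g : R) v w z t p : R :=
  d * X (X (dt z t)) p + - c * X (X (X (v t))) p + - g * X (X (Y (w t))) p
  + -1 * X (fun q => z t q * v t q) p + -1 * Y (fun q => z t q * w t q) p.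

Definition residual3 (c d g : R) v w z t p : R :=
  d / 2 * X (X (fun q => z t q * dt z t q)) p
  + - 2^-1 * (z t p * mass_defect c d g v w z t p)
  + - 2^-1 * (v t p * z t p * X (z t) p)
  + - 2^-1 * (w t p * z t p * Y (z t) p)
  + - 8^-1 * (z t p * z t p * X (v t) p)
  + - 8^-1 * (z t p * z t p * Y (w t) p).

Lemma sder_square b B h : smooth s 1 B h ->
  sder s b (fun p => h p * h p) = fun p => sder s b h p * h p + h p * sder s b h p.
Proof. by move=> hh; have dh := smooth_derivable (b := b) hh; rewrite (sderM _ dh dh). Qed.

Lemma sder_modified_height b B z t : smooth s 1 B (z t) ->
  sder s b (modified_height eps z t) =
  fun p => sder s b (z t) p + - (eps / 4) * sder s b (fun q => z t q * z t q) p.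
Proof.
move=> hz; have dz := smooth_derivable (b := b) hz.
by rewrite modified_heightE (sder_combination _ dz (partial_derivableM dz dz)).
Qed.

Lemma sder3_modified_height b1 b2 b3 B z t : smooth s 3 B (z t) ->
  sder s b1 (sder s b2 (sder s b3 (modified_height eps z t))) =
  fun p => sder s b1 (sder s b2 (sder s b3 (z t))) p +
    - (eps / 4) * sder s b1 (sder s b2 (sder s b3 (fun q => z t q * z t q))) p.
Proof.
move=> hz; have hzz := smoothM s_ge0 hz hz.
rewrite (sder_modified_height b3 (smoothS (smoothS hz))).
have hz2 := smooth_sder b3 hz; have hzz2 := smooth_sder b3 hzz.
rewrite (sder_combination _ (smooth_derivable (b := b2) hz2) (smooth_derivable (b := b2) hzz2)).
have hz1 := smooth_sder b2 hz2; have hzz1 := smooth_sder b2 hzz2.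
by rewrite (sder_combination _ (smooth_derivable (b := b1) hz1) (smooth_derivable (b := b1) hzz1)).
Qed.

Lemma modified_height_pointwise z t p :
  modified_height eps z t p = z t p + - (eps / 4) * (z t p * z t p).
Proof. by rewrite modified_heightE. Qed.

(** The cubic and quartic terms that the substitution leaves, once the quadratic
    ones have cancelled; [z1], [z3], [q1], [q3] stand for the derivatives of
    [z] and of its square. *)
Lemma substitution_identity (a D V W m0 m1 m3 z0 z1 z3 q1 q3 : R) :
  m0 = z0 + - (eps / 4) * (z0 * z0) -> m1 = z1 + - (eps / 4) * q1 ->
  m3 = z3 + - (eps / 4) * q3 -> q1 = z1 * z0 + z0 * z1 ->
  D + (m1 + a * eps * m3) + V + W + eps / 2 * (m0 * m1) =
  D + (z1 + a * eps * z3) + V + W + eps ^+ 2 * (- (3 / 8) * (z0 * z0 * z1)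
    + eps / 16 * (z0 * z0 * z0 * z1) + - (a / 4) * q3).
Proof. by move=> -> -> -> ->; field. Qed.

Lemma B1'_modified_height (a b B : R) v w z t p : smooth s 3 B (z t) ->
  B1' a b eps v w (modified_height eps z) t p =
  B1 a b eps v w z t p + eps ^+ 2 * residual1 a z t p.
Proof.
move=> hz; have hz1 := smoothS (smoothS hz).
rewrite B1'E !B1E /residual1; apply: substitution_identity.
- exact: modified_height_pointwise.
- exact: (congr1 (@^~ p) (sder_modified_height true hz1)).
- exact: (congr1 (@^~ p) (sder3_modified_height true true true hz)).
- exact: (congr1 (@^~ p) (sder_square true hz1)).
Qed.

Lemma B2'_modified_height (e f B : R) v w z t p : smooth s 3 B (z t) ->
  B2' e f eps v w (modified_height eps z) t p =
  B2 e f eps v w z t p + eps ^+ 2 * residual2 f z t p.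
Proof.
move=> hz; have hz1 := smoothS (smoothS hz).
have hm : smooth s 3 (2 * (B + `|- (eps / 4)| * (4 ^+ 3 * (B * B)))) (modified_height eps z t).
  by rewrite modified_heightE; exact: (smoothD s_ge0 hz (smoothZ _ (smoothM s_ge0 hz hz))).
rewrite B2'E (B2E _ _ _ _ _ hm) (B2E _ _ _ _ _ hz) /residual2; apply: substitution_identity.
- exact: modified_height_pointwise.
- exact: (congr1 (@^~ p) (sder_modified_height false hz1)).
- exact: (congr1 (@^~ p) (sder3_modified_height true true false hz)).
- exact: (congr1 (@^~ p) (sder_square false hz1)).
Qed.

(** The last premise is the third equation; solving it for [zt] turns the terms of
    order [k] of the substitution into terms of order [k ^+ 2]. *)
Lemma mass_identity (c d g xxzt xxxv xxyw xz yz xv yw zt z0 v0 w0 q k m0 mt xxmt mx my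
    qx qy xzv yzw : R) :
  m0 = z0 + - (k / 4) * (z0 * z0) -> mt = zt + - (k / 2) * (z0 * zt) ->
  xxmt = xxzt + - (k / 2) * q ->
  mx = xz + - (k / 4) * qx -> my = yz + - (k / 4) * qy ->
  qx = xz * z0 + z0 * xz -> qy = yz * z0 + z0 * yz ->
  xzv = xz * v0 + z0 * xv -> yzw = yz * w0 + z0 * yw ->
  zt - d * k * xxzt + (xv + c * k * xxxv) + (yw + g * k * xxyw) + k * xzv + k * yzw = 0 ->
  mt - d * k * xxmt + (xv + c * k * xxxv) + (yw + g * k * xxyw)
    + k * (v0 * mx + w0 * my) + k / 2 * (m0 * xv + m0 * yw) =
  k ^+ 2 * (d / 2 * q + - 2^-1 * (z0 * (d * xxzt + - c * xxxv + - g * xxyw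
    + -1 * xzv + -1 * yzw)) + - 2^-1 * (v0 * z0 * xz)
    + - 2^-1 * (w0 * z0 * yz) + - 8^-1 * (z0 * z0 * xv) + - 8^-1 * (z0 * z0 * yw)).
Proof.
move=> -> -> -> -> -> -> -> -> -> h.
have -> : zt = - (- (d * k * xxzt) + (xv + c * k * xxxv) + (yw + g * k * xxyw)
  + k * (xz * v0 + z0 * xv) + k * (yz * w0 + z0 * yw)) by lra.
by field.
Qed.

Lemma B3'_modified_height (c d g B C D A : R) v w z t p :
  smooth s 3 B (z t) -> smooth s 3 C (v t) -> smooth s 3 D (w t) -> smooth s 3 A (dt z t) ->
  (forall p, derivable (fun r : R => z r p) t 1) ->
  B3 c d g eps v w z t p = 0 ->
  B3' c d g eps v w (modified_height eps z) t p = eps ^+ 2 * residual3 c d g v w z t p.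
Proof.
move=> hz hv hw hzt dz h3; have hz1 := smoothS (smoothS hz).
have hzzt := smoothM s_ge0 hz hzt.
have et := dt_modified_height eps dz.
have e1 : X (X (dt (modified_height eps z) t)) =
    fun p => X (X (dt z t)) p + - (eps / 2) * X (X (fun q => z t q * dt z t q)) p.
  rewrite et (sder_combination _ (smooth_derivable (b := true) hzt) (smooth_derivable (b := true) hzzt)).
  by rewrite (sder_combination _ (smooth_derivable (b := true) (smooth_sder true hzt))
    (smooth_derivable (b := true) (smooth_sder true hzzt))).
rewrite (B3'E _ _ _ _ _ _ hw) /residual3 /mass_defect; apply: mass_identity.
- exact: modified_height_pointwise.
- exact: (congr1 (@^~ p) et).
- exact: (congr1 (@^~ p) e1).
- exact: (congr1 (@^~ p) (sder_modified_height true hz1)).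
- exact: (congr1 (@^~ p) (sder_modified_height false hz1)).
- exact: (congr1 (@^~ p) (sder_square true hz1)).
- exact: (congr1 (@^~ p) (sder_square false hz1)).
- exact: (congr1 (@^~ p) (sderM s (smooth_derivable (b := true) hz) (smooth_derivable (b := true) hv))).
- exact: (congr1 (@^~ p) (sderM s (smooth_derivable (b := false) hz) (smooth_derivable (b := false) hw))).
- by rewrite -(B3E _ _ _ _ _ _ hw).
Qed.

End residuals.

(** * Consistency *)
Section family_tools.
Context {R : realType} {I : Type}.
Implicit Types (u v : I -> R -> plane R -> R) (k : nat).
Variable s : I -> R.
Hypotheses (s_gt0 : forall i, 0 < s i) (s_le1 : forall i, s i <= 1).

Lemma smooth_family_subset (J J' : I -> set R) k u : (forall i, J' i `<=` J i) ->
  smooth_family s J k u -> smooth_family s J' k u.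
Proof.
move=> JJ [B hB]; exists B => i; have [h1 h2] := hB i; split.
  by move=> t Jt; exact: h1 (JJ i _ Jt).
move=> t0 Jt0 e e0; have := h2 t0 (JJ i _ Jt0) e e0.
by rewrite !near_withinE; apply: filterS => t ht /JJ.
Qed.

Lemma integrable_family_C_Hs (J : I -> set R) k (sigma : R) u i : 0 <= sigma <= k%:R ->
  integrable_family s J k.+1 u -> C_Hs (s i ^+ 2) sigma (J i) (u i).
Proof.
move=> hs [[B hB] hi] t0 Jt0; have [h1 h2] := hB i; have [_ sk] := andP hs; split.
  exact: (smooth_le_Hs (s_gt0 i) (s_le1 i) (h1 _ Jt0) (hi i _ Jt0) hs).1.
apply: (smooth_cvg0_Hs (s_gt0 i) sk) => e e0.
apply: filterS2 (nearJ (J i) t0) (h2 t0 Jt0 e e0) => t Jt h; split; first exact: h.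
exact: (integrable_derivativesB (h1 t Jt) (h1 t0 Jt0) (hi i t Jt) (hi i t0 Jt0)).
Qed.

Lemma integrable_family_Linfty (T : I -> R) k (sigma : R) u : 0 <= sigma <= k%:R ->
  (forall i, 0 < T i) -> integrable_family s (fun i => [set t | 0 < t < T i]) k.+1 u ->
  exists C0, forall C, C0 <= C -> forall i, Linfty_Hs (s i ^+ 2) sigma (T i) C (extend0 (T i) (u i)).
Proof.
move=> hs T0 [[B hB] hi]; exists (spectral_cst k * `|B|) => C BC i; have [h1 h2] := hB i.
have c0 : 0 < spectral_cst k :> R := lt_le_trans ltr01 (spectral_cst_ge1 k).
have -> : C = spectral_cst k * (C / spectral_cst k) by rewrite mulrCA mulfV ?mulr1// gt_eqF.
apply: (Linfty_Hs_extend0 (T0 i) (s_gt0 i) (s_le1 i) hs _ (hi i) h2) => t Jt.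
apply: (smoothW (ltW (s_gt0 i)) _ (h1 t Jt)).
by rewrite ler_pdivlMr// mulrC (le_trans _ BC)// ler_wpM2l ?ler_norm// ltW.
Qed.

End family_tools.

Section consistency.
Context {R : realType} {I : Type}.
Variables (a b c d e f g N sigma T M : R) (K : nat).
(* Orders of regularity: [K + 1] for the residuals, whose norms of order at most
   [K] are estimated; [K + 3] for [\partial_t z], which is derived twice; [K + 8]
   for inverting the operator of the third equation on it; [3] more for [z]. *)
Hypotheses (hN : 0 <= N <= K%:R) (hsigma : K.+4.+4.+4%:R <= sigma) (T_gt0 : 0 < T).
Variables (s : I -> R) (v w z : I -> R -> plane R -> R).
Hypotheses (s_gt0 : forall i, 0 < s i) (s_le1 : forall i, s i <= 1).
Let tmax i := T / s i ^+ 2.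
Hypotheses (v_curve : forall i, smooth_curve (s i ^+ 2) sigma (tmax i) (v i))
  (w_curve : forall i, smooth_curve (s i ^+ 2) sigma (tmax i) (w i))
  (z_curve : forall i, smooth_curve (s i ^+ 2) sigma (tmax i) (z i))
  (bounds : forall i, bounded_solution d (s i ^+ 2) sigma (tmax i) M (v i) (w i) (z i))
  (solution : forall i, solves_B a b c d e f g (s i ^+ 2) (tmax i) (v i) (w i) (z i)).

Let J i : set R := [set t | 0 < t < tmax i].
Let Jc i : set R := [set t | 0 <= t <= tmax i].

Let sub_J i : J i `<=` Jc i.
Proof. by move=> t /= /andP[h1 h2]; apply/andP; split; exact: ltW. Qed.

Let tmax_gt0 i : 0 < tmax i.
Proof. by rewrite divr_gt0// exprn_gt0. Qed.

Let le_sigma k : (k <= K.+4.+4.+4)%N -> k%:R <= sigma.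
Proof. by move=> h; apply: le_trans hsigma; rewrite ler_nat. Qed.

Let le_sigma3 k : (k <= K.+4.+4.+1)%N -> k%:R <= sigma - 3.
Proof.
move=> h; rewrite lerBrDr -natrD; apply: le_sigma.
by rewrite addn3.
Qed.

Let eps_le1 i : `|s i ^+ 2| <= 1.
Proof. by rewrite ger0_norm ?sqr_ge0// expr_le1// ltW. Qed.

Lemma solution_family k u : (k <= K.+4.+4.+2)%N ->
  (forall i, smooth_curve (s i ^+ 2) sigma (tmax i) (u i)) ->
  (forall i t, Jc i t -> le_Hs (s i ^+ 2) sigma M (u i t)) ->
  smooth_family s Jc k u.
Proof.
move=> kK hu hM; exists (2 ^+ k.+3 * `|M|) => i; have [hC hc _ _ _] := hu i.
have ks : k.+2%:R <= sigma by apply: le_sigma; lia.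
split; last exact: (C_Hs_continuous_smooth (s_gt0 i) (s_le1 i) ks hC hc).
apply: (le_Hs_bounded_smooth (s_gt0 i) (s_le1 i) ks) => t Jt.
by have [h _] := hC t Jt; split => //; [exact: hc|exact: hM].
Qed.

Let v_closed : smooth_family s Jc K.+4.+2 v.
Proof.
apply: solution_family => //; first by lia.
by move=> i t Jt; have [h _] := bounds i; have [? ? ?] := h t Jt.
Qed.

Let w_closed : smooth_family s Jc K.+4.+2 w.
Proof.
apply: solution_family => //; first by lia.
by move=> i t Jt; have [h _] := bounds i; have [? ? ?] := h t Jt.
Qed.

Let z_closed : smooth_family s Jc K.+4.+2 z.
Proof.
apply: solution_family => //; first by lia.
by move=> i t Jt; have [h _] := bounds i; have [? ? ?] := h t Jt.
Qed.

Let fam k u := smooth_family s J k u.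
Let v_fam k : (k <= K.+4.+2)%N -> fam k v.
Proof. by move=> h; apply: (smooth_family_leq h); exact: (smooth_family_subset sub_J v_closed). Qed.
Let w_fam k : (k <= K.+4.+2)%N -> fam k w.
Proof. by move=> h; apply: (smooth_family_leq h); exact: (smooth_family_subset sub_J w_closed). Qed.
Let z_fam k : (k <= K.+4.+2)%N -> fam k z.
Proof. by move=> h; apply: (smooth_family_leq h); exact: (smooth_family_subset sub_J z_closed). Qed.

(** The third equation, solved for [(1 - d eps \partial_x^2) \partial_t z]. *)
Let rate i t p : R :=
  -1 * (sder (s i) true (v i t) p
  + s i ^+ 2 * (c * sder (s i) true (sder (s i) true (sder (s i) true (v i t))) p)
  + sder (s i) false (w i t) p
  + s i ^+ 2 * (g * sder (s i) true (sder (s i) true (sder (s i) false (w i t))) p)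
  + s i ^+ 2 * sder (s i) true (fun q => z i t q * v i t q) p
  + s i ^+ 2 * sder (s i) false (fun q => z i t q * w i t q) p).

Lemma rate_family : fam K.+3 rate.
Proof.
have cst (r : R) : forall i : I, `|(fun=> r) i| <= `|r| by [].
have v3 := smooth_family_sder true (smooth_family_sder true (smooth_family_sder true (v_fam (leqnn _)))).
have w3 := smooth_family_sder true (smooth_family_sder true (smooth_family_sder false (w_fam (leqnn _)))).
have v1 := smooth_family_sder true (v_fam (k := K.+4) ltac:(lia)).
have w1 := smooth_family_sder false (w_fam (k := K.+4) ltac:(lia) ).
have zv := smooth_family_sder true (smooth_familyM s_gt0 (z_fam (k := K.+4) ltac:(lia))
  (v_fam (k := K.+4) ltac:(lia))).
have zw := smooth_family_sder false (smooth_familyM s_gt0 (z_fam (k := K.+4) ltac:(lia))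
  (w_fam (k := K.+4) ltac:(lia))).
apply: (smooth_familyZ s_gt0 (cst (-1))).
apply: (smooth_familyD s_gt0); last exact: (smooth_familyZ s_gt0 eps_le1 zw).
apply: (smooth_familyD s_gt0); last exact: (smooth_familyZ s_gt0 eps_le1 zv).
apply: (smooth_familyD s_gt0); last first.
  exact: (smooth_familyZ s_gt0 eps_le1 (smooth_familyZ s_gt0 (cst g) w3)).
apply: (smooth_familyD s_gt0); last exact: w1.
apply: (smooth_familyD s_gt0); first exact: v1.
exact: (smooth_familyZ s_gt0 eps_le1 (smooth_familyZ s_gt0 (cst c) v3)).
Qed.

Lemma rateE i t p : J i t -> dt (z i) t p
  - (d * s i ^+ 2) * sder (s i) true (sder (s i) true (dt (z i) t)) p = rate i t p.
Proof.
move=> Jt; have [B hB] := w_fam (k := 3) ltac:(lia).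
have [_ _ h3] := solution p Jt.
have solved (y q1 q2 q3 q4 q5 q6 q7 k : R) :
    y - d * k * q1 + (q2 + c * k * q3) + (q4 + g * k * q5) + k * q6 + k * q7 = 0 ->
    y - d * k * q1 = -1 * (q2 + k * (c * q3) + q4 + k * (g * q5) + k * q6 + k * q7) by lra.
move: h3; rewrite (B3E (s_gt0 i) _ _ _ _ _ _ ((hB i).1 t Jt)) /rate; exact: solved.
Qed.

Let zt i := dt (z i).

(** A uniform bound on [\partial_t z] is assumed when [d < 0]; otherwise it follows
    from the third equation. Continuity in time is part of the hypotheses. *)
Lemma zt_family : fam K.+3 zt.
Proof.
have hc i : C_Hs (s i ^+ 2) (sigma - 3) (J i) (zt i) by have [] := z_curve i.
have cc i t : J i t -> continuous (zt i t) by move=> Jt; have [_ _ _ _ h] := z_curve i; exact: h.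
have k3 : K.+3.+2%:R <= sigma - 3 by apply: le_sigma3; lia.
have cont i : continuous_smooth (s i) (J i) K.+3 (zt i).
  exact: (C_Hs_continuous_smooth (s_gt0 i) (s_le1 i) k3 (hc i) (cc i)).
have [d0|d0] := ltP d 0.
  exists (2 ^+ K.+3.+3 * `|M|) => i; split; last exact: cont.
  apply: (le_Hs_bounded_smooth (s_gt0 i) (s_le1 i) k3) => t Jt.
  have [_ /(_ d0) h] := bounds i.
  by split; [exact: (hc i t Jt).1|exact: cc|exact: h].
have [B hB] := rate_family; exists B => i; split; last exact: cont.
move=> t Jt; have [hr _] := hB i.
have h2 : 2 <= sigma - 3 by apply: (le_sigma3 (k := 2)); lia.
have [hs _] := hc i t Jt.
have inv := continuous_Hs_inverse (s_gt0 i) (s_le1 i) h2 hs (cc i t Jt).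
have k8 : K.+3.+4.+1%:R <= sigma - 3 by apply: le_sigma3; lia.
have [A A0 sp] := Hs_spectral (s_gt0 i) (s_le1 i) k8 hs.
rewrite inv; apply: (resolvent_smooth (s_gt0 i) (lam := d * s i ^+ 2) _ A0 sp).
  by rewrite mulr_ge0// sqr_ge0.
rewrite -inv; have := hr t Jt; congr (smooth _ _ _); apply/funext => p.
by rewrite -(rateE _ Jt).
Qed.

Let cst (r : R) : forall i : I, `|(fun=> r) i| <= `|r|.
Proof. by []. Qed.

Let zz_fam k : (k <= K.+4.+2)%N -> fam k (fun i t p => z i t p * z i t p).
Proof. by move=> h; exact: (smooth_familyM s_gt0 (z_fam h) (z_fam h)). Qed.

Lemma residual1_family : integrable_family s J K.+1 (fun i t p => residual1 (s i) a (z i) t p).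
Proof.
have Z := z_fam (k := K.+1) ltac:(lia).
have ZZ := zz_fam (k := K.+1) ltac:(lia).
have ZX := smooth_family_sder true (z_fam (k := K.+2) ltac:(lia)).
have z4 := z_fam (k := K.+4) ltac:(lia).
have eps16 i : `|s i ^+ 2 / 16| <= 1.
  rewrite normrM (le_trans (ler_wpM2r _ (eps_le1 i)))// mul1r ger0_norm ?invr_ge0//.
  by rewrite invf_le1// ler1n.
apply: (integrable_familyD s_gt0); last first.
  apply: (integrable_familyZ s_gt0 (cst _)).
  do 3 apply: integrable_family_sder; exact: (integrable_familyM s_gt0 z4 z4).
apply: (integrable_familyD s_gt0).
  apply: (integrable_familyZ s_gt0 (cst _)).
  exact: (integrable_familyM s_gt0 ZZ ZX).
apply: (integrable_familyZ s_gt0 eps16).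
exact: (integrable_familyM s_gt0 (smooth_familyM s_gt0 ZZ Z) ZX).
Qed.

Lemma residual2_family : integrable_family s J K.+1 (fun i t p => residual2 (s i) f (z i) t p).
Proof.
have Z := z_fam (k := K.+1) ltac:(lia).
have ZZ := zz_fam (k := K.+1) ltac:(lia).
have ZY := smooth_family_sder false (z_fam (k := K.+2) ltac:(lia)).
have z4 := z_fam (k := K.+4) ltac:(lia).
have eps16 i : `|s i ^+ 2 / 16| <= 1.
  rewrite normrM (le_trans (ler_wpM2r _ (eps_le1 i)))// mul1r ger0_norm ?invr_ge0//.
  by rewrite invf_le1// ler1n.
apply: (integrable_familyD s_gt0); last first.
  apply: (integrable_familyZ s_gt0 (cst _)).
  do 3 apply: integrable_family_sder; exact: (integrable_familyM s_gt0 z4 z4).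
apply: (integrable_familyD s_gt0).
  apply: (integrable_familyZ s_gt0 (cst _)).
  exact: (integrable_familyM s_gt0 ZZ ZY).
apply: (integrable_familyZ s_gt0 eps16).
exact: (integrable_familyM s_gt0 (smooth_familyM s_gt0 ZZ Z) ZY).
Qed.

Lemma residual3_family :
  integrable_family s J K.+1 (fun i t p => residual3 (s i) c d g (v i) (w i) (z i) t p).
Proof.
have Z := z_fam (k := K.+1) ltac:(lia).
have V := v_fam (k := K.+1) ltac:(lia).
have W := w_fam (k := K.+1) ltac:(lia).
have ZZ := zz_fam (k := K.+1) ltac:(lia).
have ZX := smooth_family_sder true (z_fam (k := K.+2) ltac:(lia)).
have ZY := smooth_family_sder false (z_fam (k := K.+2) ltac:(lia)).
have VX := smooth_family_sder true (v_fam (k := K.+2) ltac:(lia)).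
have WY := smooth_family_sder false (w_fam (k := K.+2) ltac:(lia)).
have z3 := z_fam (k := K.+3) ltac:(lia).
have z2 := z_fam (k := K.+2) ltac:(lia).
have v2 := v_fam (k := K.+2) ltac:(lia).
have w2 := w_fam (k := K.+2) ltac:(lia).
have v4 := v_fam (k := K.+4) ltac:(lia).
have w4 := w_fam (k := K.+4) ltac:(lia).
have defect : smooth_family s J K.+1 (fun i t p => mass_defect (s i) c d g (v i) (w i) (z i) t p).
  apply: (smooth_familyD s_gt0); last first.
    apply: (smooth_familyZ s_gt0 (cst _)); apply: smooth_family_sder.
    exact: (smooth_familyM s_gt0 z2 w2).
  apply: (smooth_familyD s_gt0); last first.
    apply: (smooth_familyZ s_gt0 (cst _)); apply: smooth_family_sder.
    exact: (smooth_familyM s_gt0 z2 v2).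
  apply: (smooth_familyD s_gt0); last first.
    by apply: (smooth_familyZ s_gt0 (cst _)); do 3 apply: smooth_family_sder; exact: w4.
  apply: (smooth_familyD s_gt0); last first.
    by apply: (smooth_familyZ s_gt0 (cst _)); do 3 apply: smooth_family_sder; exact: v4.
  by apply: (smooth_familyZ s_gt0 (cst _)); do 2 apply: smooth_family_sder; exact: zt_family.
apply: (integrable_familyD s_gt0); last first.
  exact: (integrable_familyZ s_gt0 (cst _) (integrable_familyM s_gt0 ZZ WY)).
apply: (integrable_familyD s_gt0); last first.
  exact: (integrable_familyZ s_gt0 (cst _) (integrable_familyM s_gt0 ZZ VX)).
apply: (integrable_familyD s_gt0); last first.
  exact: (integrable_familyZ s_gt0 (cst _) (integrable_familyM s_gt0 (smooth_familyM s_gt0 W Z) ZY)).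
apply: (integrable_familyD s_gt0); last first.
  exact: (integrable_familyZ s_gt0 (cst _) (integrable_familyM s_gt0 (smooth_familyM s_gt0 V Z) ZX)).
apply: (integrable_familyD s_gt0); last first.
  exact: (integrable_familyZ s_gt0 (cst _) (integrable_familyM s_gt0 Z defect)).
apply: (integrable_familyZ s_gt0 (cst _)).
by do 2 apply: integrable_family_sder; exact: (integrable_familyM s_gt0 z3 zt_family).
Qed.

Lemma consistency : exists C : R, forall i,
  [/\ C_Hs (s i ^+ 2) N (Jc i) (v i), C_Hs (s i ^+ 2) N (Jc i) (w i),
      C_Hs (s i ^+ 2) N (Jc i) (modified_height (s i ^+ 2) (z i))
    & exists r1 r2 r3 : R -> plane R -> R,
      [/\ solves_B'_up_to a b c d e f g (s i ^+ 2) (tmax i)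
            (v i) (w i) (modified_height (s i ^+ 2) (z i)) r1 r2 r3,
          Linfty_Hs (s i ^+ 2) N (tmax i) C r1,
          Linfty_Hs (s i ^+ 2) N (tmax i) C r2
        & Linfty_Hs (s i ^+ 2) N (tmax i) C r3]].
Proof.
have [C1 h1] := integrable_family_Linfty s_gt0 s_le1 hN tmax_gt0 residual1_family.
have [C2 h2] := integrable_family_Linfty s_gt0 s_le1 hN tmax_gt0 residual2_family.
have [C3 h3] := integrable_family_Linfty s_gt0 s_le1 hN tmax_gt0 residual3_family.
have Nsigma : N <= sigma by have /andP[_ h] := hN; apply: (le_trans h); apply: le_sigma; lia.
exists (`|C1| + `|C2| + `|C3|) => i.
have hCz := let: And5 h _ _ _ _ := z_curve i in h.
split.
- by have [h _ _ _ _] := v_curve i; exact: (C_Hs_le Nsigma _ h).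
- by have [h _ _ _ _] := w_curve i; exact: (C_Hs_le Nsigma _ h).
- rewrite modified_heightE; apply: (C_HsD (s_gt0 i)); first exact: (C_Hs_le Nsigma _ hCz).
  apply: (integrable_family_C_Hs s_gt0 s_le1 (k := K) (u := fun i t p => z i t p * z i t p)) => //.
  have zc : smooth_family s Jc K.+1 z by apply: smooth_family_leq z_closed; lia.
  exact: (integrable_familyM s_gt0 zc zc).
exists (extend0 (tmax i) (residual1 (s i) a (z i))), (extend0 (tmax i) (residual2 (s i) f (z i))),
  (extend0 (tmax i) (residual3 (s i) c d g (v i) (w i) (z i))); split.
- move=> t p Jt; have [B1_0 B2_0 B3_0] := solution p Jt; rewrite /extend0 Jt.
  have [Bz hz] := z_fam (k := 3) ltac:(lia).
  have [Bv hv] := v_fam (k := 3) ltac:(lia).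
  have [Bw hw] := w_fam (k := 3) ltac:(lia).
  have [Bt hzt] : fam 3 zt by apply: smooth_family_leq zt_family; lia.
  have z3 := (hz i).1 t Jt; split.
  + by rewrite (B1'_modified_height (s_gt0 i) a b _ _ p z3) B1_0 add0r.
  + by rewrite (B2'_modified_height (s_gt0 i) e f _ _ p z3) B2_0 add0r.
  + apply: (B3'_modified_height (s_gt0 i) z3 ((hv i).1 t Jt) ((hw i).1 t Jt) ((hzt i).1 t Jt)) => //.
    by move=> q; have [_ _ h _ _] := z_curve i; exact: h.
- by apply: h1; rewrite -addrA (le_trans (ler_norm _))// lerDl addr_ge0.
- by apply: h2; rewrite addrAC (le_trans (ler_norm _))// lerDr addr_ge0.
- by apply: h3; rewrite (le_trans (ler_norm _))// lerDr addr_ge0.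
Qed.

End consistency.

Theorem proposition1p3 (R : realType) (a b c d e f g : R)
  (habcd : a + b + c + d = 1 / 3) (hdefg : d + e + f + g = 2 / 3)
  (N : R) (hN : 2 <= N) :
  exists s0 : R, forall s : R, s0 <= s ->
  forall T M : R, 0 < T ->
  exists C : R, forall eps : R, 0 < eps < 1 ->
  forall v w zeta : R -> plane R -> R,
    smooth_curve eps s (T / eps) v ->
    smooth_curve eps s (T / eps) w ->
    smooth_curve eps s (T / eps) zeta ->
    bounded_solution d eps s (T / eps) M v w zeta ->
    solves_B a b c d e f g eps (T / eps) v w zeta ->
    [/\ C_Hs eps N [set t | 0 <= t <= T / eps] v,
        C_Hs eps N [set t | 0 <= t <= T / eps] w,
        C_Hs eps N [set t | 0 <= t <= T / eps] (modified_height eps zeta)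
      & exists r1 r2 r3 : R -> plane R -> R,
        [/\ solves_B'_up_to a b c d e f g eps (T / eps)
              v w (modified_height eps zeta) r1 r2 r3,
            Linfty_Hs eps N (T / eps) C r1,
            Linfty_Hs eps N (T / eps) C r2
          & Linfty_Hs eps N (T / eps) C r3]].
Proof.
have N0 : 0 <= N by apply: le_trans hN.
pose K := (Num.truncn N).+1.
have hNK : 0 <= N <= K%:R by rewrite N0 ltW//; have /andP[] := truncn_itv N0.
exists K.+4.+4.+4%:R => s hs T M T0.
(* The constant has to be chosen before [eps] and the solution, which are therefore
   gathered in the index of a family. *)
pose data := (R * (R -> plane R -> R) * (R -> plane R -> R) * (R -> plane R -> R))%type.
pose admissible (x : data) := let: (sq, v, w, z) := x in
  [/\ 0 < sq <= 1, smooth_curve (sq ^+ 2) s (T / sq ^+ 2) v,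
      smooth_curve (sq ^+ 2) s (T / sq ^+ 2) w,
      smooth_curve (sq ^+ 2) s (T / sq ^+ 2) z &
      bounded_solution d (sq ^+ 2) s (T / sq ^+ 2) M v w z /\
      solves_B a b c d e f g (sq ^+ 2) (T / sq ^+ 2) v w z].
pose I := {x : data | admissible x}.
have pos (x : I) : 0 < (sval x).1.1.1 by case: x => -[[[sq v] w] z] /= [/andP[]].
have le1 (x : I) : (sval x).1.1.1 <= 1 by case: x => -[[[sq v] w] z] /= [/andP[]].
have hv (x : I) : smooth_curve ((sval x).1.1.1 ^+ 2) s (T / (sval x).1.1.1 ^+ 2) (sval x).1.1.2.
  by case: x => -[[[sq v] w] z] /= [].
have hw (x : I) : smooth_curve ((sval x).1.1.1 ^+ 2) s (T / (sval x).1.1.1 ^+ 2) (sval x).1.2.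
  by case: x => -[[[sq v] w] z] /= [].
have hz (x : I) : smooth_curve ((sval x).1.1.1 ^+ 2) s (T / (sval x).1.1.1 ^+ 2) (sval x).2.
  by case: x => -[[[sq v] w] z] /= [].
have hb (x : I) : bounded_solution d ((sval x).1.1.1 ^+ 2) s (T / (sval x).1.1.1 ^+ 2) M
    (sval x).1.1.2 (sval x).1.2 (sval x).2.
  by case: x => -[[[sq v] w] z] /= [_ _ _ _ []].
have hB (x : I) : solves_B a b c d e f g ((sval x).1.1.1 ^+ 2) (T / (sval x).1.1.1 ^+ 2)
    (sval x).1.1.2 (sval x).1.2 (sval x).2.
  by case: x => -[[[sq v] w] z] /= [_ _ _ _ []].
have [C hC] := consistency hNK hs T0 pos le1 hv hw hz hb hB.
exists C => eps /andP[e0 e1] v w z {}hv {}hw {}hz {}hb {}hB.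
have sq0 : 0 < Num.sqrt eps <= 1 by rewrite sqrtr_gt0 e0 -sqrtr1 ler_wsqrtr// ltW.
have epsE := sqr_sqrtr (ltW e0); rewrite -epsE in hv hw hz hb hB *.
have adm : admissible (Num.sqrt eps, v, w, z) by split.
exact: (hC (exist _ _ adm)).
Qed.
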